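(* Let $\Omega\subset\mathbb{R}^N$ be a bounded domain of class $C^2$ and let $\lambda_n$, $n=1,2,\dots$, be the eigenvalues of $-\Delta$ on $\Omega$ (with homogeneous Dirichlet boundary conditions) ranked in ascending order. Let $0<\sigma\le\frac{2}{N-2}$ if $N>2$ and $0<\sigma<\infty$ if $N=1,2$. Let $a>0$, $b<0$, $\alpha,\beta\in\mathbb{R}$ with $\alpha/a=\beta/b$, and let $k>0$ be such that $k/a\in(\lambda_n,\lambda_{n+1})$ for some $n\in\mathbb{N}$, $n\ge1$. Then the equilibrium solution $u\equiv0$ of $$\partial_tu=(a+i\alpha)\Delta u-(b+i\beta)|u|^\sigma u+ku\ \text{ in }\Omega,\ t>0,\qquad u=0\ \text{ on }\partial\Omega,$$ is unstable.
   Context: All functions are complex-valued. For each $u_0\in H^1_0(\Omega)$ the equation has a unique maximal strong solution $u(t)=S(t)u_0$ on some interval $[0,T(u_0))$, $0<T(u_0)\le\infty$, with $u(0)=u_0$: $u$ is continuous on $[0,T(u_0))$ with values in $H^1_0(\Omega)$ and, for $t\in(0,T(u_0))$, $u(t)\in H^2(\Omega)\cap H^1_0(\Omega)$, $\frac{du}{dt}(t)$ exists in $L^2(\Omega)$ and the differential equation holds. The equilibrium $0$ is stable if for every $\delta>0$ there is $\varepsilon>0$ such that every $v\in H^1_0(\Omega)$ with $\|v\|_{H^1}<\varepsilon$ has a global solution ($T(v)=\infty$) and $\sup_{t\ge0}\|S(t)v\|_{H^1}<\delta$. It is unstable if it is not stable. *)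

(* Defs.v *)
From HB Require Import structures.
From mathcomp Require Import all_boot all_order all_algebra.
From mathcomp Require Import all_classical all_reals all_analysis.
From mathcomp Require Export complex.

Set Implicit Arguments.
Unset Strict Implicit.
Unset Printing Implicit Defensive.
Import Order.TTheory GRing.Theory Num.Theory.
Import numFieldNormedType.Exports.
Export numFieldNormedType.Exports.

Local Open Scope classical_set_scope.
Local Open Scope ring_scope.
Local Open Scope complex_scope.

(* Borel sigma-algebra of R^n, generated by the coordinate maps *)
Section sigma_algebra.
Context {R : realType} {n : nat}.

Let coord (i : 'I_n) (x : 'rV[R]_n) : measurableTypeR R := x 0 i.

Let coord_set0 : g_sigma_preimage coord set0.
Proof. exact: sigma_algebra0. Qed.

Let coord_setC A : g_sigma_preimage coord A -> g_sigma_preimage coord (~` A).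
Proof. exact: sigma_algebraC. Qed.

Let coord_bigcup (F : (set 'rV[R]_n)^nat) :
  (forall i, g_sigma_preimage coord (F i)) ->
  g_sigma_preimage coord (\bigcup_i (F i)).
Proof. exact: sigma_algebra_bigcup. Qed.

HB.instance Definition _ := @isMeasurable.Build default_measure_display
  'rV[R]_n (g_sigma_preimage coord) coord_set0 coord_setC coord_bigcup.

End sigma_algebra.

Section lebesgue_rV.
Context {R : realType}.
Local Notation RR := (measurableTypeR R).

Definition tuple_cons n (p : RR * n.-tuple RR) : n.+1.-tuple RR :=
  [the n.+1.-tuple RR of p.1 :: p.2].

Section lebesgue_tuple_step.
Variables (n : nat) (mu : {sigma_finite_measure set (n.-tuple RR) -> \bar R}).

Definition lebesgue_tuple_step : set (n.+1.-tuple RR) -> \bar R :=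
  pushforward (@lebesgue_measure R \x mu)%E (@tuple_cons n).

Let mcons : measurable_fun setT (@tuple_cons n).
Proof. exact: measurable_cons. Qed.

Let step0 : lebesgue_tuple_step set0 = 0%E.
Proof. exact: measure0. Qed.

Let step_ge0 A : (0 <= lebesgue_tuple_step A)%E.
Proof. exact: measure_ge0. Qed.

Let step_sigma_additive : semi_sigma_additive lebesgue_tuple_step.
Proof. exact: measure_semi_sigma_additive. Qed.

HB.instance Definition _ := isMeasure.Build _ _ _ lebesgue_tuple_step
  step0 step_ge0 step_sigma_additive.

Let step_sigma_finite : sigma_finite setT lebesgue_tuple_step.
Proof.
have /sigma_finiteP[F [TF ndF Foo]] := sigma_finiteT (@lebesgue_measure R).
have /sigma_finiteP[G [TG ndG Goo]] := sigma_finiteT mu.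
exists (fun k => [set t | F k (thead t) /\ G k [tuple of behead t]]).
  apply/esym; rewrite -subTset => t _ /=.
  have [i _ Fi] : (\bigcup_i F i) (thead t) by rewrite -TF.
  have [j _ Gj] : (\bigcup_i G i) [tuple of behead t] by rewrite -TG.
  exists (maxn i j) => //; split.
  - by move: Fi; exact/subsetPset/ndF/leq_maxl.
  - by move: Gj; exact/subsetPset/ndG/leq_maxr.
move=> k; have [mF Fk] := Foo k; have [mG Gk] := Goo k; split.
  apply: measurableI.
    rewrite -[X in measurable X]setTI.
    exact: (measurable_tnth ord0 measurableT mF).
  rewrite -[X in measurable X]setTI.
  exact: (measurable_behead measurableT mG).
rewrite /lebesgue_tuple_step /pushforward (_ : _ @^-1` _ = F k `*` G k).
  by rewrite product_measure1E// lte_mul_pinfty// ge0_fin_numE.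
have consK (p : RR * n.-tuple RR) : [tuple of behead (tuple_cons p)] = p.2.
  exact: val_inj.
by apply/seteqP; split => -[x t] /=; rewrite theadE consK.
Qed.

HB.instance Definition _ := Measure_isSigmaFinite.Build _ _ _
  lebesgue_tuple_step step_sigma_finite.
End lebesgue_tuple_step.

Fixpoint lebesgue_tuple n : {sigma_finite_measure set (n.-tuple RR) -> \bar R} :=
  if n is m.+1 then lebesgue_tuple_step (lebesgue_tuple m)
  else dirac [tuple].

Section lebesgue_rV_def.
Variable n : nat.

Definition rV_of_tuple (t : n.-tuple RR) : 'rV[R]_n := \row_i tnth t i.

(* Lebesgue measure on R^n, as the n-fold product of lebesgue_measure *)
Definition lebesgue_rV : set 'rV[R]_n -> \bar R :=
  pushforward (lebesgue_tuple n) rV_of_tuple.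

Let mrV : measurable_fun setT rV_of_tuple.
Proof.
move=> _ A; rewrite setTI {1}/measurable /= => mA.
have : preimage_set_system setT rV_of_tuple (g_sigma_preimage
    (fun i (x : 'rV[R]_n) => x 0 i : RR)) (rV_of_tuple @^-1` A).
  by exists A => //; rewrite setTI.
rewrite -g_sigma_preimage_comp; congr (g_sigma_preimage _ _).
by apply/funext => i; apply/funext => t /=; rewrite mxE.
Qed.

Let lebesgue_rV0 : lebesgue_rV set0 = 0%E.
Proof. exact: measure0. Qed.

Let lebesgue_rV_ge0 A : (0 <= lebesgue_rV A)%E.
Proof. exact: measure_ge0. Qed.

Let lebesgue_rV_sigma_additive : semi_sigma_additive lebesgue_rV.
Proof. exact: measure_semi_sigma_additive. Qed.

HB.instance Definition _ := isMeasure.Build _ _ _ lebesgue_rV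
  lebesgue_rV0 lebesgue_rV_ge0 lebesgue_rV_sigma_additive.

End lebesgue_rV_def.
End lebesgue_rV.

Section Ck.
Context {R : realType} {n : nat}.

Definition basis_vec (i : 'I_n) : 'rV[R]_n := delta_mx 0 i.

Fixpoint Ck (k : nat) (f : 'rV[R]_n -> R) : Prop :=
  continuous f /\
  if k is k'.+1 then forall i,
    (forall x, derivable f x (basis_vec i)) /\
    Ck k' ('D_(basis_vec i) f)
  else True.
End Ck.

Section function_spaces.
Context {R : realType} {N : nat}.
Local Notation E := 'rV[R]_N.
Local Notation mu := (@lebesgue_rV R N).
Implicit Types (Om : set E) (u v g : E -> R[i]) (f : E -> R).

Definition real_test_function Om f : Prop :=
  [/\ forall k, Ck k f,
      compact (closure [set x | f x != 0]) &
      closure [set x | f x != 0] `<=` Om].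

Definition test_function Om u : Prop :=
  real_test_function Om (fun x => complex.Re (u x)) /\
  real_test_function Om (fun x => complex.Im (u x)).

Definition eq_ae Om u v : Prop := {ae mu, forall x, Om x -> u x = v x}.

Definition modulus (z : R[i]) : R := Normc.normc z.

Definition sqnorm2 Om u : \bar R :=
  (\int[mu]_(x in Om) (modulus (u x) ^+ 2)%:E)%E.

Definition L2norm Om u : \bar R := (sqnorm2 Om u `^ 2^-1)%E.

(* An element of L^2(Om) is represented by a function on the whole space; only
   its values on Om matter, up to a null set (see eq_ae). Since every Lebesgue
   measurable function is a.e. equal to a Borel one, using the Borel
   sigma-algebra loses no element of L^2(Om). *)
Definition L2 Om u : Prop :=
  [/\ measurable_fun Om (fun x => complex.Re (u x)),
      measurable_fun Om (fun x => complex.Im (u x)) &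
      (L2norm Om u < +oo)%E].

Definition cintegral Om u : R[i] :=
  (\int[mu]_(x in Om) complex.Re (u x)) +i* (\int[mu]_(x in Om) complex.Im (u x)).

Definition is_weak_partial Om (i : 'I_N) u g : Prop :=
  L2 Om g /\
  forall f, real_test_function Om f ->
    cintegral Om (fun x => u x * ('D_(basis_vec i) f x)%:C) =
    - cintegral Om (fun x => g x * (f x)%:C).

(* For u in L^2(Om), the weak derivative is unique up to a null set when it
   exists; if there is none, the value 0 is junk. H1norm, weak_laplacian, etc.
   are therefore only meaningful under membership in H1, resp. H2. *)
Definition weak_partial Om i u : E -> R[i] :=
  xget (fun=> 0) [set g | is_weak_partial Om i u g].

Definition weak_laplacian Om u : E -> R[i] :=
  fun x => \sum_(i < N) weak_partial Om i (weak_partial Om i u) x.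

Definition H1 Om u : Prop :=
  L2 Om u /\ forall i, exists g, is_weak_partial Om i u g.

Definition H1norm Om u : \bar R :=
  ((sqnorm2 Om u + \sum_(i < N) sqnorm2 Om (weak_partial Om i u)) `^ 2^-1)%E.

(* Closure of the complex-valued test functions in the H^1 norm *)
Definition H10 Om u : Prop :=
  H1 Om u /\
  forall e : R, 0 < e -> exists2 phi, test_function Om phi &
    (H1norm Om (u \- phi)%R < e%:E)%E.

Definition H2 Om u : Prop :=
  H1 Om u /\ forall i, H1 Om (weak_partial Om i u).

(* Near each boundary point, Om is the strict epigraph of a C^2 function of
   the N - 1 coordinates other than the i-th one, the i-th axis being reversed
   when s = true. *)
Definition C2_boundary Om : Prop :=
  forall x0, (closure Om `\` interior Om) x0 ->
  exists r : R, exists i : 'I_N, exists s : bool, exists gamma : 'rV[R]_N.-1 -> R,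
  [/\ 0 < r, Ck 2 gamma &
    Om `&` ball x0 r = [set x | gamma (col' i x) < (-1) ^+ s * x 0 i] `&` ball x0 r].

Definition bounded_C2_domain Om : Prop :=
  [/\ Om !=set0, open Om, connected Om, bounded_set Om & C2_boundary Om].

Definition dirichlet_eigenspace Om (l : R) : set (E -> R[i]) := [set u |
  [/\ H2 Om u, H10 Om u &
      eq_ae Om (fun x => - weak_laplacian Om u x) (fun x => l%:C * u x)]].

(* lam 1 <= lam 2 <= ... (lam 0 is unused) lists the eigenvalues of -Delta with
   domain H^2 /\ H^1_0, each one repeated according to its multiplicity: the
   phi j with lam j = l form a basis, modulo null sets, of the eigenspace of
   l. *)
Definition dirichlet_eigenvalues Om (lam : nat -> R) : Prop :=
  (forall i j, (1 <= i <= j)%N -> lam i <= lam j) /\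
  exists phi : nat -> E -> R[i],
  [/\ forall j, (1 <= j)%N -> dirichlet_eigenspace Om (lam j) (phi j),
      forall m (c : nat -> R[i]),
        eq_ae Om (fun x => \sum_(1 <= j < m.+1) c j * phi j x) (fun=> 0) ->
        forall j, (1 <= j <= m)%N -> c j = 0 &
      forall l u, dirichlet_eigenspace Om l u ->
        exists m (c : nat -> R[i]), (forall j, lam j != l -> c j = 0) /\
          eq_ae Om u (fun x => \sum_(1 <= j < m.+1) c j * phi j x)].

(* The interval [0, T[, where T may be +oo *)
Definition times (T : \bar R) : set R := [set t | 0 <= t /\ (t%:E < T)%E].

(* (a + i alpha) Delta u - (b + i beta) |u|^sigma u + k u *)
Definition gl_rhs Om (a alpha b beta k sigma : R) u : E -> R[i] :=
  fun x => (a +i* alpha) * weak_laplacian Om u x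
           - (b +i* beta) * (modulus (u x) `^ sigma)%:C * u x
           + k%:C * u x.

Definition L2_derivative Om (u : R -> E -> R[i]) (t : R) v : Prop :=
  L2 Om v /\
  L2norm Om (fun x => (h^-1)%:C * (u (t + h) x - u t x) - v x) @[h --> 0^']
    --> 0%E.

Definition strong_solution Om (a alpha b beta k sigma : R) u0 (T : \bar R)
    (u : R -> E -> R[i]) : Prop :=
  [/\ (0 < T)%E, eq_ae Om (u 0) u0,
      forall t, times T t -> H10 Om (u t),
      forall t, times T t ->
        H1norm Om (u s \- u t) @[s --> within (times T) (nbhs t)]
          --> 0%E &
      forall t, times T t -> 0 < t -> H2 Om (u t) /\
        exists2 v, L2_derivative Om u t v &
          eq_ae Om v (gl_rhs Om a alpha b beta k sigma (u t))].

(* A strong solution that has no strong extension to a longer interval *)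
Definition maximal_solution Om (a alpha b beta k sigma : R) u0 (T : \bar R)
    (u : R -> E -> R[i]) : Prop :=
  strong_solution Om a alpha b beta k sigma u0 T u /\
  forall T' w, strong_solution Om a alpha b beta k sigma u0 T' w ->
    (forall t, times T t -> times T' t -> eq_ae Om (w t) (u t)) ->
    (T' <= T)%E.

Definition zero_stable Om (a alpha b beta k sigma : R) : Prop :=
  forall delta : R, 0 < delta -> exists2 eps : R, 0 < eps &
  forall v, H10 Om v -> (H1norm Om v < eps%:E)%E ->
  exists T (u : R -> E -> R[i]),
    [/\ maximal_solution Om a alpha b beta k sigma v T u, T = +oo%E &
        (ereal_sup [set H1norm Om (u t) | t in [set t | 0 <= t]%R] < delta%:E)%E].

Definition zero_unstable Om (a alpha b beta k sigma : R) : Prop :=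
  ~ zero_stable Om a alpha b beta k sigma.

End function_spaces.

(* Main.v *)
(** Put c = -b and m = alpha/a = beta/b. The equation reads
    u_t = (1 + im) X + k u with X = a Δu + c |u|^σ u, and Re <u, iX> = 0, so that
    the energy
      E(u) = a/2 |∇u|^2 - c/(σ+2) ∫ |u|^(σ+2) - k/2 |u|^2
    satisfies dE/dt = - |X + ku|^2 <= 0, while d|u|^2/dt >= - 4 E(u). A small multiple
    of an eigenfunction of λ_n < k/a has E < 0; along its solution |u|^2 therefore
    grows at least linearly, which contradicts stability.
    A strong solution is differentiable in time with values in L^2 only, so E cannot
    be differentiated along it. As the Dirichlet integral and ∫ |u|^(σ+2) are convex,
    the increments E(u(t)) - E(u(t-h)) can be bounded from above, and a left Dini
    derivative argument applies. The nonlinearity is controlled by the embedding of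
    H^1_0 into L^(2σ+2), proved from the Gagliardo-Nirenberg-Sobolev inequality for
    test functions. *)

(* The derivative has to be a left one. Bounding the increment of the Dirichlet integral from above
   by convexity places the gradient at the later of the two times, and Green's formula turns it into
   Δu there. For a left derivative that time is the fixed t; for a right one it would be t + h, and
   Δu(t + h) is not known to converge as h tends to 0. The power term carries the opposite sign, so
   its gradient falls on the earlier time t - h, and the difference between |u|^σ u at t and at t -
   h has to be controlled separately. The exponent 2σ + 2 is the one for which |u|^σ u lies in L^2;
   for N > 2 the condition on σ says that it is at most the critical exponent 2N/(N-2). No solution
   is constructed: stability with δ = 1 itself supplies a global solution bounded in H^1, hence with
   a bound on ∫ |u|^(2σ+2) uniform in time. With κ = -4 E(u(0)) > 0, the growth |u(t)|^2 >= κt is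
   incompatible with |u|^2 < 1 at the explicit time 1/κ. *)
Require Import Defs.
From HB Require Import structures.
From mathcomp Require Import all_boot all_order all_algebra.
From mathcomp Require Import all_classical all_reals all_analysis.
From mathcomp Require Import measurable_realfun.
From mathcomp Require Import ring lra.
Set Implicit Arguments.
Unset Strict Implicit.
Unset Printing Implicit Defensive.
Import Order.TTheory GRing.Theory Num.Theory.
Local Open Scope classical_set_scope.
Local Open Scope ring_scope.

(** * Integration on R^N *)

Section measurability.
Context {R : realType} {N : nat}.
Implicit Types (x c d : 'rV[R]_N) (f : 'rV[R]_N -> R).

Lemma measurable_coord (i : 'I_N) :
  measurable_fun setT (fun x => x 0 i : measurableTypeR R).
Proof.
move=> _ B mB; rewrite setTI; apply: sub_sigma_algebra => /=.
rewrite -bigcup_seq/=; exists i => /=; first by rewrite mem_index_enum.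
by exists B => //; rewrite setTI.
Qed.

Definition open_box c d := [set x : 'rV[R]_N | forall i, c 0 i < x 0 i < d 0 i].
Definition closed_box c d := [set x : 'rV[R]_N | forall i, c 0 i <= x 0 i <= d 0 i].

Lemma open_box_closed_box c d : open_box c d `<=` closed_box c d.
Proof. by move=> x + i => /(_ i)/andP[/ltW-> /ltW->]. Qed.

Lemma closed_box_closed c d : closed (closed_box c d).
Proof.
have -> : closed_box c d =
    \bigcap_(i in [set: 'I_N]) ((fun x : 'rV[R]_N => x 0 i) @^-1` [set` `[c 0 i, d 0 i]]).
  apply/seteqP; split => [x cdx i _ /=|x cdx i].
    by rewrite in_itv /= cdx.
  by have := cdx i I; rewrite /= in_itv.
apply: closed_bigI => i _; apply: closed_comp; last exact: itv_closed.
by move=> x _; exact: coord_continuous.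
Qed.

Lemma measurable_open_box c d : measurable (open_box c d).
Proof.
have -> : open_box c d =
    \bigcap_(i in [set: 'I_N]) ((fun x : 'rV[R]_N => x 0 i) @^-1` [set` `]c 0 i, d 0 i[]).
  apply/seteqP; split => [x cdx i _ /=|x cdx i].
    by rewrite in_itv /= cdx.
  by have := cdx i I; rewrite /= in_itv.
apply: fin_bigcap_measurable => // i _.
by rewrite -[X in measurable X]setTI; apply: measurable_coord.
Qed.

Definition rat_vec (q : 'rV[rat]_N) : 'rV[R]_N := map_mx ratr q.

(** The family is countable, which makes open sets measurable. Asking that the closed boxes lie in
    [O] is what later gives the bumps living on these boxes compact support inside [O]. *)
Lemma open_bigcup_box (O : set 'rV[R]_N) : open O ->
  O = \bigcup_(q in [set q : 'rV[rat]_N * 'rV[rat]_N |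
        closed_box (rat_vec q.1) (rat_vec q.2) `<=` O])
       open_box (rat_vec q.1) (rat_vec q.2).
Proof.
move=> oO; apply/seteqP; split; last first.
  by move=> x [q qO] /open_box_closed_box/qO.
move=> x Ox; have /nbhs_ballP[e e0 xeO] := open_nbhs_nbhs (conj oO Ox).
have lo i : exists q : rat, ratr q \in `]x 0 i - e, x 0 i[.
  by apply: rat_in_itvoo; rewrite ltrBlDr ltrDl.
have hi i : exists q : rat, ratr q \in `]x 0 i, x 0 i + e[.
  by apply: rat_in_itvoo; rewrite ltrDl.
have [/= c cP] := choice lo; have [/= d dP] := choice hi.
exists (\row_i c i, \row_i d i) => /=; last first.
  move=> i; rewrite !mxE; move: (cP i) (dP i); rewrite !in_itv /=.
  by move=> /andP[_ ->] /andP[-> _].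
move=> y cdy; apply: xeO; split=> // i j; rewrite ord1.
have := cdy j; rewrite !mxE; move: (cP j) (dP j); rewrite !in_itv /=.
move=> /andP[q1 q2] /andP[q3 q4] /andP[q5 q6].
by rewrite /ball /= ltr_norml; apply/andP; split; lra.
Qed.

Lemma open_measurable_rV (O : set 'rV[R]_N) : open O -> measurable O.
Proof.
move=> /open_bigcup_box ->; rewrite bigcup_mkcond.
apply: countable_bigcupT_measurable => [|q]; first exact: countableP.
by case: ifP => // _; exact: measurable_open_box.
Qed.

Lemma continuous_measurable_rV f : continuous f -> measurable_fun setT f.
Proof.
move=> /continuousP cf; apply: (measurability _ (RGenOpens.measurableE R)).
move=> _ [_ [a [b ->] <-]]; rewrite setTI.
by apply: open_measurable_rV; apply: cf; exact: interval_open.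
Qed.

Lemma measurable_rV_of_tuple :
  measurable_fun setT (@rV_of_tuple R N).
Proof.
move=> _ A; rewrite setTI {1}/measurable /= => mA.
have : preimage_set_system setT (@rV_of_tuple R N) (g_sigma_preimage
    (fun i x => x 0 i : measurableTypeR R)) (@rV_of_tuple R N @^-1` A).
  by exists A => //; rewrite setTI.
rewrite -g_sigma_preimage_comp; congr (g_sigma_preimage _ _).
by apply/funext => i; apply/funext => t /=; rewrite mxE.
Qed.

End measurability.

Section tuple_integrals.
Context {R : realType}.
Local Notation RR := (measurableTypeR R).
Local Notation leb := (@lebesgue_measure R).
Local Notation lam := (@lebesgue_tuple R).
Local Open Scope ereal_scope.

Definition tuple_upd n (t : n.-tuple RR) (i : 'I_n) (y : R) : n.-tuple RR :=
  [tuple if j == i then y : RR else tnth t j | j < n].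

Lemma tuple_upd_ord0 n x (t : n.-tuple RR) y :
  tuple_upd (tuple_cons (x, t)) ord0 y = tuple_cons (y, t).
Proof.
apply: eq_from_tnth => j; rewrite tnth_mktuple.
by case: (unliftP ord0 j) => [k|] -> //=; rewrite !tnthS.
Qed.

Lemma tuple_upd_lift n x (t : n.-tuple RR) i y :
  tuple_upd (tuple_cons (x, t)) (lift ord0 i) y = tuple_cons (x, tuple_upd t i y).
Proof.
apply: eq_from_tnth => j; rewrite tnth_mktuple.
case: (unliftP ord0 j) => [k|] -> //=.
by rewrite (inj_eq lift_inj) !tnthS tnth_mktuple.
Qed.

Lemma measurable_tuple_cons n : measurable_fun setT (@tuple_cons R n).
Proof. exact: measurable_cons. Qed.

Lemma measurable_tuple_consr n x :
  measurable_fun setT (fun t : n.-tuple RR => tuple_cons (x, t)).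
Proof. exact: (measurable_cons (measurable_cst x) (@measurable_id _ _ setT)). Qed.

Lemma ge0_integral_tuple12 n (F : n.+1.-tuple RR -> \bar R) :
  measurable_fun [set: n.+1.-tuple RR] F -> (forall t, 0 <= F t) ->
  \int[lam n.+1]_t F t = \int[leb]_x \int[lam n]_t F (tuple_cons (x, t)).
Proof.
move=> mF F0; rewrite [LHS]ge0_integral_pushforward//; last exact: measurable_tuple_cons.
rewrite preimage_setT fubini_tonelli1//.
  by apply: measurableT_comp => //; exact: measurable_tuple_cons.
by move=> x; exact: F0.
Qed.

Lemma ge0_integral_tuple21 n (F : n.+1.-tuple RR -> \bar R) :
  measurable_fun [set: n.+1.-tuple RR] F -> (forall t, 0 <= F t) ->
  \int[lam n.+1]_t F t = \int[lam n]_t \int[leb]_x F (tuple_cons (x, t)).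
Proof.
move=> mF F0; rewrite [LHS]ge0_integral_pushforward//; last exact: measurable_tuple_cons.
rewrite preimage_setT fubini_tonelli2//.
  by apply: measurableT_comp => //; exact: measurable_tuple_cons.
by move=> x; exact: F0.
Qed.

Lemma integrable_tuple_cons n (F : n.+1.-tuple RR -> \bar R) :
  (lam n.+1).-integrable setT F ->
  (leb \x lam n).-integrable setT (F \o @tuple_cons R n).
Proof.
move=> /integrableP[mF Foo]; apply/integrableP; split.
  by apply: measurableT_comp => //; exact: measurable_tuple_cons.
move: Foo; rewrite [X in X < _]ge0_integral_pushforward//.
  exact: measurable_tuple_cons.
exact: measurableT_comp.
Qed.

(** Fubini allows the [i]-th variable to be integrated first. The induction peels off the leading
    coordinate; integrability survives on almost every slice, which is all that the outer integral
    sees. *)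
Lemma integral_line_eq0 n (i : 'I_n) (h : n.-tuple RR -> \bar R) :
  (lam n).-integrable setT h ->
  (forall t, \int[leb]_y h (tuple_upd t i y) = 0) ->
  \int[lam n]_t h t = 0.
Proof.
elim: n => [|n IH] in i h *; first by case: i.
move=> ih h0; have mh := measurable_int _ ih.
have ih' := integrable_tuple_cons ih.
rewrite [LHS]integral_pushforward//; last exact: measurable_tuple_cons.
rewrite preimage_setT.
case: (unliftP ord0 i) => [j|] iE; last first.
  rewrite -integral21_prod_meas1//; apply: integral0_eq => t _ /=.
  rewrite -[RHS](h0 (tuple_cons (0%R, t))) iE; apply: eq_integral => y _ /=.
  by rewrite tuple_upd_ord0.
rewrite -integral12_prod_meas1//.
rewrite (ae_eq_integral (cst 0))//; first exact: integral0.
  exact: (measurable_int _ (integrable_fubini_F ih')).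
apply: filterS (ae_integrable1 ih') => x xh _ /=; apply: (IH j) => // t.
rewrite -[RHS](h0 (tuple_cons (x, t))) iE; apply: eq_integral => y _ /=.
by rewrite tuple_upd_lift.
Qed.

End tuple_integrals.

(** * Gagliardo-Nirenberg-Sobolev inequality *)

Section gagliardo_nirenberg.
Context {R : realType}.
Local Notation RR := (measurableTypeR R).
Local Notation leb := (@lebesgue_measure R).
Local Notation lam := (@lebesgue_tuple R).
Local Open Scope ereal_scope.

Lemma measurable_fun_powRr d (T : measurableType d) (D : set T) (f : T -> R)
    (p : R) : measurable_fun D f -> measurable_fun D (fun x => f x `^ p)%R.
Proof. exact: (measurableT_comp (measurable_powR p)). Qed.

Lemma hoelder_ge0 d (T : measurableType d) (mu : {measure set T -> \bar R})
    (f g : T -> R) (p q : R) :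
  measurable_fun setT f -> measurable_fun setT g ->
  (forall x, 0 <= f x)%R -> (forall x, 0 <= g x)%R ->
  (0 < p)%R -> (0 < q)%R -> (p^-1 + q^-1 = 1)%R ->
  \int[mu]_x (f x * g x)%:E <=
  (\int[mu]_x (f x `^ p)%:E) `^ p^-1 * (\int[mu]_x (g x `^ q)%:E) `^ q^-1.
Proof.
move=> mf mg f0 g0 p0 q0 pq; have := @hoelder _ _ _ mu f g p q mf mg p0 q0 pq.
rewrite Lnorm1 unlock.
under eq_integral do rewrite /= ger0_norm ?mulr_ge0//.
under [X in _ <= X `^ _ * _ -> _]eq_integral do rewrite /= ger0_norm//.
by under [X in _ <= _ * X `^ _ -> _]eq_integral do rewrite /= ger0_norm//.
Qed.

Lemma integral_tuple1 (F : 1.-tuple RR -> \bar R) :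
  measurable_fun [set: 1.-tuple RR] F -> (forall t, 0 <= F t) ->
  \int[lam 1%N]_t F t = \int[leb]_x F (tuple_cons (x, [tuple])).
Proof.
move=> mF F0; rewrite ge0_integral_tuple12//; apply: eq_integral => x _.
rewrite integral_dirac// ?diracT ?mul1e//.
by apply: measurableT_comp => //; exact: measurable_tuple_consr.
Qed.

Lemma poweR_1D (x : \bar R) (r : R) : 0 <= x -> (0 < r)%R ->
  x `^ (1 + r) = x * x `^ r.
Proof.
move=> x0 r0; rewrite poweRD ?poweRe1// add_neq0_poweRD_def//.
by rewrite gt_eqF ?addr_gt0.
Qed.

(** Let G be the integral of [g] along the first coordinate: it depends on the other coordinates
    only and dominates [u]. Hence u^(1 + 1/p) <= G^(1/p) u, and the slice hypothesis with [v] = G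
    bounds the integral over each slice by a constant times the slice integral of [g]; integrating
    over the first coordinate finishes. *)
Lemma gagliardo_nirenberg_step n (p : R) (u g : n.+1.-tuple RR -> R) :
  (0 < p)%R ->
  measurable_fun setT u -> measurable_fun setT g ->
  (forall t, 0 <= u t)%R -> (forall t, 0 <= g t)%R ->
  (forall t, (u t)%:E <= \int[leb]_y (g (tuple_upd t ord0 y))%:E) ->
  (forall x (v : n.-tuple RR -> R), measurable_fun setT v ->
    (forall t, 0 <= v t)%R ->
    \int[lam n]_t (v t `^ p^-1 * u (tuple_cons (x, t)))%:E <=
    (\int[lam n]_t (v t)%:E) `^ p^-1 *
      \int[lam n]_t (g (tuple_cons (x, t)))%:E) ->
  \int[lam n.+1]_t (u t `^ (1 + p^-1))%:E <=
  (\int[lam n.+1]_t (g t)%:E) `^ (1 + p^-1).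
Proof.
move=> p0 mu mg u0 g0 ug H.
have mgE : measurable_fun setT (EFin \o g) by exact: measurableT_comp.
have g0E t : 0 <= (EFin \o g) t by rewrite lee_fin.
set J := \int[lam n.+1]_t (g t)%:E.
have J0 : 0 <= J by apply: integral_ge0 => t _; rewrite lee_fin.
(* If the right-hand side is infinite there is nothing to prove; otherwise G is finite almost
   everywhere, so that [fine \o G] may serve as the real-valued [v]. *)
have [Joo|Joo] := eqVneq J +oo.
  by rewrite Joo poweRyr ?leey// gt_eqF ?addr_gt0 ?invr_gt0.
pose G (t : n.-tuple RR) := \int[leb]_y (g (tuple_cons (y, t)))%:E.
have G0 t : 0 <= G t by apply: integral_ge0 => y _; rewrite lee_fin.
have JG : J = \int[lam n]_t G t by rewrite /J (ge0_integral_tuple21 mgE g0E).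
have mgc : measurable_fun setT ((EFin \o g) \o @tuple_cons R n).
  by apply: measurableT_comp => //; exact: measurable_tuple_cons.
have mG : measurable_fun setT G.
  by apply: (measurable_fun_fubini_tonelli_G (m1 := leb) _ mgc) => x; rewrite lee_fin.
have iG : (lam n).-integrable setT G.
  apply/integrableP; split => //.
  by under eq_integral do rewrite gee0_abs//; rewrite -JG ltey.
have aeG := integrable_ae measurableT iG.
have mus x : measurable_fun setT (fun t => u (tuple_cons (x, t)) `^ (1 + p^-1))%R.
  apply: measurable_fun_powRr; apply: measurableT_comp => //.
  exact: measurable_tuple_consr.
have slice x : \int[lam n]_t (u (tuple_cons (x, t)) `^ (1 + p^-1))%:E <=
    J `^ p^-1 * \int[lam n]_t (g (tuple_cons (x, t)))%:E.
  have mv : measurable_fun setT (fine \o G) by exact: measurableT_comp.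
  apply: (@le_trans _ _ (\int[lam n]_t
      ((fine \o G) t `^ p^-1 * u (tuple_cons (x, t)))%:E)).
    apply: ae_ge0_le_integral => //.
    - by move=> t _; rewrite lee_fin powR_ge0.
    - exact: measurableT_comp.
    - by move=> t _; rewrite lee_fin mulr_ge0 ?powR_ge0.
    - apply: measurableT_comp => //; apply: measurable_funM.
        exact: measurable_fun_powRr.
      by apply: measurableT_comp => //; exact: measurable_tuple_consr.
    - apply: filterS aeG => t /(_ I) Gt _.
      rewrite lee_fin powRD; last by rewrite gt_eqF ?addr_gt0 ?invr_gt0.
      rewrite powRr1// mulrC ler_wpM2r//.
      apply: ge0_ler_powR; rewrite ?nnegrE ?invr_ge0 ?fine_ge0 ?(ltW p0)//.
      rewrite -lee_fin /= fineK//; have := ug (tuple_cons (x, t)).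
      by under eq_integral do rewrite tuple_upd_ord0.
  apply: le_trans (H x (fine \o G) mv _) _ => [t|]; first exact: fine_ge0.
  apply: lee_wpmul2r; first by apply: integral_ge0 => t _; rewrite lee_fin.
  apply: gt0_ler_poweR; rewrite ?invr_ge0 ?(ltW p0)//.
  - rewrite in_itv /= leey andbT.
    by apply: integral_ge0 => t _; rewrite lee_fin fine_ge0.
  - by rewrite in_itv /= leey andbT.
  - rewrite JG; apply: ge0_le_integral => //.
    + by move=> t _; rewrite lee_fin fine_ge0.
    + exact: measurableT_comp.
    + by move=> t _ /=; case: (G t) (G0 t).
rewrite ge0_integral_tuple12//; last first.
- by move=> t; rewrite lee_fin powR_ge0.
- by apply: measurableT_comp => //; exact: measurable_fun_powRr.
have mgF : measurable_fun setT
    (fun x => \int[lam n]_t (g (tuple_cons (x, t)))%:E).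
  by apply: (measurable_fun_fubini_tonelli_F (m2 := lam n) _ mgc) => x; rewrite lee_fin.
have gF0 x : 0 <= \int[lam n]_t (g (tuple_cons (x, t)))%:E.
  by apply: integral_ge0 => t _; rewrite lee_fin.
rewrite poweR_1D ?invr_gt0// {1}/J (ge0_integral_tuple12 mgE g0E) muleC.
rewrite -ge0_integralZl ?poweR_ge0//; last by move=> x _; exact: gF0.
apply: ge0_le_integral => //.
- by move=> x _; apply: integral_ge0 => t _; rewrite lee_fin powR_ge0.
- have mup : measurable_fun setT
      ((fun t => (u t `^ (1 + p^-1))%:E) \o @tuple_cons R n).
    apply: measurableT_comp; last exact: measurable_tuple_cons.
    by apply: measurableT_comp => //; exact: measurable_fun_powRr.
  apply: (measurable_fun_fubini_tonelli_F (m2 := lam n) _ mup) => x.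
  by rewrite lee_fin powR_ge0.
- exact: measurable_funeM.
Qed.

(* Only one majorant [g] is needed for all directions, so that the step is a
   two-function Hoelder inequality on the slices. *)
Lemma gagliardo_nirenberg n (u g : n.+2.-tuple RR -> R) :
  measurable_fun setT u -> measurable_fun setT g ->
  (forall t, 0 <= u t)%R -> (forall t, 0 <= g t)%R ->
  (forall i t, (u t)%:E <= \int[leb]_y (g (tuple_upd t i y))%:E) ->
  \int[lam n.+2]_t (u t `^ (1 + n.+1%:R^-1))%:E <=
  (\int[lam n.+2]_t (g t)%:E) `^ (1 + n.+1%:R^-1).
Proof.
elim: n => [|n IH] in u g * => mu mg u0 g0 ug.
  (* Dimension 2, with p = 1: on a one-dimensional slice the integral of [g] bounds [u] pointwise,
     so no Hölder inequality is involved. *)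
  apply: gagliardo_nirenberg_step => //.
  move=> x v mv v0; rewrite invr1.
  rewrite poweRe1; last by apply: integral_ge0 => t _; rewrite lee_fin.
  under eq_integral do rewrite powRr1//.
  have mgx : measurable_fun setT (fun t => (g (tuple_cons (x, t)))%:E).
    apply: measurableT_comp => //; apply: measurableT_comp => //.
    exact: measurable_tuple_consr.
  have gx0 t : 0 <= (g (tuple_cons (x, t)))%:E by rewrite lee_fin.
  rewrite -ge0_integralZr//; first last.
  - by apply: integral_ge0 => t _.
  - by move=> t _; rewrite lee_fin.
  - exact: measurableT_comp.
  apply: ge0_le_integral => //.
  - by move=> t _; rewrite lee_fin mulr_ge0.
  - apply: measurableT_comp => //; apply: measurable_funM => //.
    by apply: measurableT_comp => //; exact: measurable_tuple_consr.
  - by apply: emeasurable_funM => //; exact: measurableT_comp.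
  - move=> t _; rewrite EFinM lee_wpmul2l ?lee_fin//.
    apply: (le_trans (ug (lift ord0 ord0) _)).
    rewrite (integral_tuple1 mgx gx0) le_eqVlt; apply/orP; left; apply/eqP.
    apply: eq_integral => y _; rewrite tuple_upd_lift; congr (g (tuple_cons (x, _)))%:E.
    by apply: eq_from_tnth => -[[|//] j1]; rewrite tnth_mktuple.
apply: gagliardo_nirenberg_step => //.
move=> x v mv v0.
set s : R := (1 + n.+1%:R^-1)%R.
have s0 : (0 < s)%R by rewrite addr_gt0.
have mux : measurable_fun setT (fun t => u (tuple_cons (x, t))).
  by apply: measurableT_comp => //; exact: measurable_tuple_consr.
have mgx : measurable_fun setT (fun t => g (tuple_cons (x, t))).
  by apply: measurableT_comp => //; exact: measurable_tuple_consr.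
(* The exponents n + 2 and s = (n + 2)/(n + 1) are conjugate, and s is exactly the power that the
   induction hypothesis controls on the slice. *)
apply: (le_trans (@hoelder_ge0 _ _ (lam n.+2) _ _ n.+2%:R s _ _ _ _ _ _ _)) => //.
- exact: measurable_fun_powRr.
- by move=> t; exact: powR_ge0.
- have m0 : (0 < n.+1%:R :> R)%R by rewrite ltr0n.
  rewrite /s -natr1; set m : R := n.+1%:R in m0 *; field.
  by rewrite !gt_eqF// addr_gt0.
apply: lee_pmul => //; [exact: poweR_ge0|exact: poweR_ge0| |].
  rewrite le_eqVlt; apply/orP; left; apply/eqP; congr (_ `^ _).
  apply: eq_integral => t _; rewrite -powRrM mulVf ?powRr1//.
have H : \int[lam n.+2]_t (u (tuple_cons (x, t)) `^ s)%:E <=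
    (\int[lam n.+2]_t (g (tuple_cons (x, t)))%:E) `^ s.
  apply: (IH _ _ mux mgx) => // i t; apply: (le_trans (ug (lift ord0 i) _)).
  rewrite le_eqVlt; apply/orP; left; apply/eqP.
  by apply: eq_integral => y _; rewrite tuple_upd_lift.
rewrite -[leRHS]poweRe1; last by apply: integral_ge0 => t _; rewrite lee_fin.
rewrite -(mulfV (lt0r_neq0 s0)) poweRrM; apply: gt0_ler_poweR => //.
- by rewrite invr_ge0 ltW.
- rewrite in_itv /= leey andbT.
  by apply: integral_ge0 => t _; rewrite lee_fin powR_ge0.
- by rewrite in_itv /= leey andbT poweR_ge0.
Qed.

End gagliardo_nirenberg.

(** * Calculus on the line *)

Section one_variable.
Context {R : realType}.
Implicit Types (f : R -> R).

Lemma cvg_is_derive1 f (x l : R) :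
  h^-1 * (f (h + x) - f x) @[h --> 0^'] --> l -> is_derive x 1 f l.
Proof.
move=> fl.
have E : (fun h => h^-1 *: ((f \o shift x) (h *: (1 : R)) - f x)) =
    (fun h => h^-1 * (f (h + x) - f x)).
  by apply/funext => h /=; rewrite -[h%:A]/(h * 1) mulr1.
split; first by rewrite /derivable E; apply/cvg_ex; exists l.
by rewrite /derive E; exact/cvg_lim.
Qed.

Lemma continuous_norm_powR (p : R) : 0 <= p -> continuous (fun s : R => `|s| `^ p).
Proof.
move=> p0 x; have [->|x0] := eqVneq x 0; last first.
  suff : {for x, continuous ((@powR R ^~ p) \o Num.norm)} by [].
  apply: continuous_comp; first exact: norm_continuous.
  apply/differentiable_continuous/derivable1_diffP/derivable_powR.
  by rewrite in_itv /= andbT normr_gt0.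
have [->|pn0] := eqVneq p 0.
  by under eq_fun do rewrite powRr0; exact: cvg_cst.
have {}p0 : 0 < p by rewrite lt_def pn0.
apply/cvgrPdist_lt => e e0; near=> s.
rewrite normr0 powR0// sub0r normrN ger0_norm ?powR_ge0//.
have -> : e = (e `^ p^-1) `^ p by rewrite -powRrM mulVf// powRr1// ltW.
apply: gt0_ltr_powR => //; rewrite ?nnegrE ?powR_ge0//.
near: s; apply: (@cvgr0_norm_lt _ _ _ _ _ id) => //.
by rewrite powR_gt0.
Unshelve. all: by end_near. Qed.

(** At the origin the difference quotient has modulus |h|^(q-1), which tends to 0. For q >= 2 the
    derivative written in this way is a product of continuous functions, as the fundamental theorem
    of calculus requires. *)
Lemma is_derive_norm_powR (q s : R) : 2 <= q ->
  is_derive s 1 (fun s : R => `|s| `^ q) (q * (`|s| `^ (q - 2) * s)).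
Proof.
move=> q2; have q0 : 0 < q by lra.
have [s0|s0|->] := ltgtP s 0.
- have ds : is_derive s 1 ((@powR R ^~ q) \o -%R) (q * (- s) `^ (q - 1) * -1).
    by apply: is_derive1_comp; apply: is_derive1_powR; rewrite oppr_gt0.
  apply: near_eq_is_derive.
    near=> r; have r0 : r < 0 by near: r; exact: lt_nbhsl.
    by rewrite ltr0_norm.
  apply: (is_derive_eq ds); rewrite ltr0_norm// -mulrA; congr (_ * _).
  rewrite [q - 1](_ : _ = (q - 2) + 1); last by ring.
  rewrite powRD ?oppr_eq0 ?(lt_eqF s0) ?implybT// powRr1 ?oppr_ge0 ?ltW//; ring.
- have ds := is_derive1_powR q s0.
  apply: near_eq_is_derive.
    near=> r; have r0 : 0 < r by near: r; exact: lt_nbhsr.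
    by rewrite gtr0_norm.
  apply: (is_derive_eq ds); rewrite gtr0_norm//; congr (_ * _).
  rewrite [q - 1](_ : _ = (q - 2) + 1); last by ring.
  by rewrite powRD ?(gt_eqF s0) ?implybT// powRr1 ?ltW.
- apply: cvg_is_derive1; rewrite mulr0 mulr0.
  have := @continuous_norm_powR (q - 1) ltac:(lra) 0.
  rewrite /continuous_at normr0 powR0 ?(gt_eqF _)//; last by lra.
  move=> /cvgr0Pnorm_lt H; apply/cvgr0Pnorm_lt => e e0; near=> h.
  have h0 : h != 0 by near: h; exact: nbhs_dnbhs_neq.
  have : `|h| `^ (q - 1) < e.
    rewrite -[ltLHS]ger0_norm ?powR_ge0//.
    near: h; apply: nbhs_dnbhs; exact: H.
  apply: le_lt_trans; rewrite addr0 powR0 ?gt_eqF// subr0.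
  rewrite normrM normfV (ger0_norm (powR_ge0 _ _)).
  by rewrite -(mulr_powRB1 (normr_ge0 h) q0) mulKf ?normr_eq0.
Unshelve. all: by end_near. Qed.

(** Both halves come from the fundamental theorem of calculus: the first becomes integration by
    parts, the second the pointwise bound that starts the Sobolev inequality. *)
Lemma continuous_compact_supp_FTC (f df : R -> R) (M : R) : 0 <= M ->
  (forall y : R, is_derive y 1 f (df y)) -> continuous df ->
  (forall y, M < `|y| -> f y = 0) ->
  (\int[@lebesgue_measure R]_y (df y)%:E = 0)%E /\
  forall x, (`|f x|%:E <= \int[@lebesgue_measure R]_y `|df y|%:E)%E.
Proof.
move=> M0 fdf cdf f0.
have cf : continuous f.
  by move=> x; apply/differentiable_continuous/derivable1_diffP; case: (fdf x).
have FTC a b : a < b ->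
    (\int[@lebesgue_measure R]_(y in `[a, b]) (df y)%:E = (f b)%:E - (f a)%:E)%E.
  move=> ab; apply: continuous_FTC2 => //.
  - exact: continuous_subspaceT.
  - split; [by move=> x _; case: (fdf x)| |].
      exact/cvg_at_right_filter/cf.
    exact/cvg_at_left_filter/cf.
  - by move=> x _; rewrite derive1E; case: (fdf x).
have df0 y : M < `|y| -> df y = 0.
  move=> My; have [_ <-] := fdf y; rewrite (@near_eq_derive _ _ _ _ (cst 0)).
    by rewrite derive_cst.
  near=> z; rewrite f0//; near: z.
  by apply: (cvgr_gt `|y|) => //; exact: norm_continuous.
split.
  (* One unit of margin is taken because [f] is known to vanish only where |y| exceeds [M]
     strictly. *)
  transitivity (\int[@lebesgue_measure R]_(y in `[(- M - 1)%R, (M + 1)%R]) (df y)%:E)%E.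
    rewrite [RHS]integral_mkcond; apply: eq_integral => y _.
    rewrite patchE; case: ifPn => //; rewrite notin_setE /= in_itv /= => yM.
    rewrite df0// ltNge; apply: contra_notN yM; rewrite ler_norml => /andP[? ?].
    by apply/andP; split; lra.
  rewrite FTC; last by lra.
  by rewrite !f0 ?subee//; [rewrite ler0_norm; lra|rewrite ger0_norm; lra].
move=> x; have [xM|xM] := ltP M `|x|.
  rewrite f0// normr0; apply: integral_ge0 => y _; rewrite lee_fin//.
have xM' : - M - 1 < x by move: xM; rewrite ler_norml => /andP[? ?]; lra.
have E : (f x)%:E = (\int[@lebesgue_measure R]_(y in `[(- M - 1)%R, x]) (df y)%:E)%E.
  by rewrite FTC// (f0 (- M - 1)) ?sube0// ler0_norm; lra.
have mdf : measurable_fun setT df by exact: continuous_measurable_fun.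
rewrite -[leLHS]/(`|(f x)%:E|)%E E; apply: le_trans.
  apply: le_abse_integral => //; apply/measurable_EFinP; exact: measurable_funTS.
apply: ge0_subset_integral => //.
by apply: measurableT_comp => //; exact/measurable_EFinP.
Unshelve. all: by end_near. Qed.

End one_variable.

(** * Compactly supported functions on R^N *)

Section compact_support.
Context {R : realType} {N : nat}.
Local Notation E := 'rV[R]_N.
Local Notation mu := (@lebesgue_rV R N).
Local Notation partial i f := ('D_(basis_vec i) f).
Implicit Types (x : E) (f g : E -> R) (M : R).

Definition cube M : set E := [set x : E | forall i, `|x 0 i| <= M].

Definition supp_cube M f := forall x, f x != 0 -> cube M x.

Lemma supp_cube_eq0 M f (i : 'I_N) x : supp_cube M f -> M < `|x 0 i| -> f x = 0.
Proof.
by move=> fM; apply: contraPP => /eqP/fM/(_ i) ?; apply/negP; rewrite -leNgt.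
Qed.

Lemma cubeE M : cube M = closed_box (const_mx (- M)) (const_mx M).
Proof.
by apply/seteqP; split => x xM i; have := xM i; rewrite !mxE ler_norml.
Qed.

Lemma closed_cube M : closed (cube M).
Proof. by rewrite cubeE; exact: closed_box_closed. Qed.

Lemma measurable_cube M : measurable (cube M).
Proof.
rewrite -[cube M]setCK; apply: measurableC; apply: open_measurable_rV.
exact/closed_openC/closed_cube.
Qed.

Lemma cube_norm M x : 0 <= M -> cube M x <-> `|x| <= M.
Proof.
move=> M0; rewrite [`|x|]/Num.Def.normr /= mx_normrE; split => [xM|xM i].
  by apply: bigmax_le => // -[i j] _; rewrite ord1; exact: xM.
apply: le_trans xM.
exact: (@le_bigmax _ _ _ 0 (fun ij : 'I_1 * 'I_N => `|x ij.1 ij.2|) (ord0, i)).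
Qed.

Lemma compact_cube M : 0 <= M -> compact (cube M).
Proof.
move=> M0; apply: bounded_closed_compact; last exact: closed_cube.
exists M; split; first exact: num_real.
by move=> r Mr x /(cube_norm _ M0)/le_trans; apply; exact: ltW.
Qed.

Definition tuple_cube n M : set (n.-tuple (measurableTypeR R)) :=
  [set t | forall i, `|tnth t i : R| <= M].

Lemma lebesgue_tuple_cube n M :
  measurable (@tuple_cube n M) /\ (lebesgue_tuple n (@tuple_cube n M) < +oo)%E.
Proof.
elim: n => [|n [mc c_oo]].
  have -> : @tuple_cube 0 M = setT.
    by apply/seteqP; split => // t _ [].
  by split; [exact: measurableT|rewrite /= diracT ltry].
have E : @tuple_cons R n @^-1`
      @tuple_cube n.+1 M =
    `[- M, M] `*` @tuple_cube n M.
  apply/seteqP; split => [[x t] /= xtM|[x t] /= [xM tM] i].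
    split => [|i]; first by have := xtM ord0; rewrite in_itv /= -ler_norml.
    by have := xtM (lift ord0 i); rewrite tnthS.
  case: (unliftP ord0 i) => [j|] -> /=; first by rewrite tnthS.
  by move: xM; rewrite in_itv /= -ler_norml.
split.
  have -> : @tuple_cube n.+1 M =
    \bigcap_(i in [set: 'I_n.+1]) ((@tnth n.+1 (measurableTypeR R))^~ i @^-1` `[- M, M]).
    apply/seteqP; split => [t tM i _ /=|t tM i].
      by rewrite in_itv /= -ler_norml.
    by have := tM i I; rewrite /= in_itv /= -ler_norml.
  apply: fin_bigcap_measurable => // i _; rewrite -[X in measurable X]setTI.
  by apply: measurable_tnth => //; exact: measurable_itv.
have -> : lebesgue_tuple n.+1 (@tuple_cube n.+1 M) =
    (@lebesgue_measure R \x lebesgue_tuple n)%E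
      (@tuple_cons R n @^-1` @tuple_cube n.+1 M) by [].
rewrite E product_measure1E//= lte_mul_pinfty//; last first.
  by rewrite ge0_fin_numE// lebesgue_measure_itv; case: ifP => _; rewrite -?EFinD ltry.
Qed.

Lemma lebesgue_cube M : (mu (cube M) < +oo)%E.
Proof.
have [_] := lebesgue_tuple_cube N M; apply: le_lt_trans.
rewrite le_eqVlt; apply/orP; left; apply/eqP; congr (lebesgue_tuple N _).
by apply/seteqP; split => t tM i; have := tM i; rewrite mxE.
Qed.

Definition rV_upd x (i : 'I_N) (y : R) : E := \row_j if j == i then y else x 0 j.

Lemma rV_of_tuple_upd t (i : 'I_N) y :
  rV_of_tuple (tuple_upd t i y) = rV_upd (rV_of_tuple t) i y.
Proof. by apply/rowP => j; rewrite !mxE tnth_mktuple. Qed.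

Lemma rV_upd_id x (i : 'I_N) : rV_upd x i (x 0 i) = x.
Proof. by apply/rowP => j; rewrite mxE; case: eqP => // ->. Qed.

Lemma rV_updD x (i : 'I_N) h y : rV_upd x i (h + y) = h *: basis_vec i + rV_upd x i y.
Proof.
apply/rowP => j; rewrite !mxE eqxx /=.
by case: eqP => _; rewrite /= ?mulr1 ?mulr0 ?add0r.
Qed.

Lemma continuous_rV_upd x (i : 'I_N) : continuous (rV_upd x i).
Proof.
have -> : rV_upd x i = fun y => y *: basis_vec i + rV_upd x i 0.
  by apply/funext => y; rewrite -rV_updD addr0.
by move=> y; apply: cvgD; [apply: cvgZr_tmp; exact: cvg_id|exact: cvg_cst].
Qed.

Lemma continuous_line x (i : 'I_N) f : continuous f ->
  continuous (fun y : R => f (rV_upd x i y)).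
Proof.
move=> cf y; apply: (@continuous_comp _ _ _ (rV_upd x i) f).
  exact: continuous_rV_upd.
exact: cf.
Qed.

Lemma is_derive_rV_upd f x (i : 'I_N) y : derivable f (rV_upd x i y) (basis_vec i) ->
  is_derive y 1 (fun y => f (rV_upd x i y)) (partial i f (rV_upd x i y)).
Proof.
move=> df; apply: cvg_is_derive1.
rewrite (_ : (fun h => _) = fun h =>
    h^-1 *: ((f \o shift (rV_upd x i y)) (h *: basis_vec i) - f (rV_upd x i y))).
  exact: df.
by apply/funext => h /=; rewrite rV_updD.
Qed.

Lemma integrable_supp_cube f M : continuous f -> 0 <= M -> supp_cube M f ->
  mu.-integrable setT (EFin \o f).
Proof.
move=> cf M0 fM.
have -> : EFin \o f = (EFin \o f) \_ (cube M).
  apply/funext => x; rewrite patchE; case: ifPn => //.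
  rewrite notin_setE => xM; rewrite /=; congr EFin; apply/eqP.
  by apply: contra_notT xM; exact: fM.
have mc := measurable_cube M; apply/(integrable_mkcond _ mc).
apply: measurable_bounded_integrable.
- exact: measurable_cube.
- exact: lebesgue_cube.
- by apply: measurable_funTS; exact: continuous_measurable_rV.
- have /compact_bounded[K [_ Kf]] :=
    continuous_compact (continuous_subspaceT cf) (compact_cube M0).
  exists K; split; rewrite ?num_real// => r Kr x xM; apply: (Kf r Kr).
  by exists x.
Qed.

Lemma partial_supp_cube f (i : 'I_N) M : supp_cube M f -> supp_cube M (partial i f).
Proof.
move=> fM x; apply: contra_neqP => xM; rewrite (@near_eq_derive _ _ _ _ (cst 0)).
  by rewrite derive_cst.
have oM : open (~` cube M) by exact/closed_openC/closed_cube.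
have := open_nbhs_nbhs (conj oM xM); apply: filterS => y yM.
by apply/eqP; apply: contra_notT yM; exact: fM.
Qed.

Lemma integral_rV_tuple (f : E -> \bar R) : mu.-integrable setT f ->
  (lebesgue_tuple N).-integrable setT (f \o @rV_of_tuple R N) /\
  (\int[mu]_x f x = \int[lebesgue_tuple N]_t (f (rV_of_tuple t)))%E.
Proof.
move=> /integrableP[mf foo].
have mfr : measurable_fun setT (f \o @rV_of_tuple R N).
  by apply: measurableT_comp => //; exact: measurable_rV_of_tuple.
have ifr : (lebesgue_tuple N).-integrable setT (f \o @rV_of_tuple R N).
  apply/integrableP; split => //; move: foo.
  rewrite ge0_integral_pushforward//; first exact: measurable_rV_of_tuple.
  exact: measurableT_comp.
split => //; rewrite [LHS]integral_pushforward//.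
exact: measurable_rV_of_tuple.
Qed.

(** Along each line in direction [i] the integral vanishes by the fundamental theorem of calculus.
    Applied to a product, this is integration by parts. *)
Lemma integral_partial_eq0 f (i : 'I_N) M : Ck 1 f -> 0 <= M -> supp_cube M f ->
  (\int[mu]_x (partial i f x)%:E = 0)%E.
Proof.
move=> /= [cf Cf] M0 fM; have [df [cdf _]] := Cf i.
have idf := integrable_supp_cube cdf M0 (partial_supp_cube (i := i) fM).
have [idft ->] := integral_rV_tuple idf.
apply: (integral_line_eq0 (i := i) idft) => t.
under eq_integral do rewrite /= rV_of_tuple_upd.
pose F (y : R) := f (rV_upd (rV_of_tuple t) i y).
pose dF (y : R) := partial i f (rV_upd (rV_of_tuple t) i y).
have FdF (y : R) : is_derive y 1 F (dF y) by exact: is_derive_rV_upd.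
have cdF : continuous dF by exact: continuous_line.
have F0 y : M < `|y| -> F y = 0.
  by move=> My; apply: (supp_cube_eq0 (i := i) fM); rewrite mxE eqxx.
exact: (continuous_compact_supp_FTC M0 FdF cdF F0).1.
Qed.

End compact_support.

Section sobolev_smooth.
Context {R : realType} {N : nat}.
Local Notation E := 'rV[R]_N.
Local Notation mu := (@lebesgue_rV R N).
Local Notation partial i f := ('D_(basis_vec i) f).
Variables (f : E -> R) (M : R).
Hypotheses (M0 : 0 <= M) (C1f : Ck 1 f) (fM : supp_cube M f).

Let cf : continuous f. Proof. by case: C1f. Qed.

Let df (i : 'I_N) x : derivable f x (basis_vec i).
Proof. by case: C1f => _ /(_ i)[]. Qed.

Let cdf (i : 'I_N) : continuous (partial i f).
Proof. by case: C1f => _ /(_ i)[_ []]. Qed.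

Definition grad_norm (x : E) : R := Num.sqrt (\sum_i (partial i f x) ^+ 2).

Lemma partial_le_grad_norm i x : `|partial i f x| <= grad_norm x.
Proof.
rewrite -sqrtr_sqr ler_wsqrtr// (bigD1 i)//= lerDl.
by apply: sumr_ge0 => j _; exact: sqr_ge0.
Qed.

Lemma continuous_grad_norm : continuous grad_norm.
Proof.
move=> x; apply: (@continuous_comp _ _ _ _ (@Num.sqrt R)); last exact: sqrt_continuous.
move: x; apply: continuous_big => [|i _]; first exact: add_continuous.
move=> x; apply: (@continuous_comp _ _ _ (partial i f) (fun r : R => r ^+ 2)).
  exact: cdf.
exact: exprn_continuous.
Qed.

Lemma continuous_norm_powR_comp (p : R) : 0 <= p ->
  continuous (fun x => `|f x| `^ p).
Proof.
move=> p0 x; apply: (@continuous_comp _ _ _ f (fun s : R => `|s| `^ p)).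
  exact: cf.
exact: continuous_norm_powR.
Qed.

Lemma measurable_norm_powR (p : R) :
  measurable_fun setT (fun x => (`|f x| `^ p)%:E).
Proof.
apply/measurable_EFinP/measurable_fun_powRr; apply: measurableT_comp => //.
exact: continuous_measurable_rV.
Qed.

Lemma supp_cube_norm_powR (p : R) : 0 < p -> supp_cube M (fun x => `|f x| `^ p).
Proof.
move=> p0 x; have [fx0|/fM//] := eqVneq (f x) 0.
by rewrite fx0 normr0 powR0 ?eqxx// gt_eqF.
Qed.

Lemma integrable_norm_powR (p : R) : 0 < p ->
  mu.-integrable setT (fun x => (`|f x| `^ p)%:E).
Proof.
move=> p0; apply: (integrable_supp_cube _ M0 (supp_cube_norm_powR p0)).
by apply: continuous_norm_powR_comp; exact: ltW.
Qed.

(** This is q |f|^(q-1) |∇f|, which dominates every partial derivative of |f|^q at once: the common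
    majorant [g] of [gagliardo_nirenberg] for u = |f|^q. *)
Definition pow_grad (q : R) x := q * `|f x| `^ (q - 1) * grad_norm x.

Lemma continuous_pow_grad q : 1 <= q -> continuous (pow_grad q).
Proof.
move=> q1 x; apply: (@continuousM _ _ (fun x => q * `|f x| `^ (q - 1))).
  apply: (@continuousM _ _ (cst q)); first exact: cst_continuous.
  by apply: continuous_norm_powR_comp; rewrite subr_ge0.
exact: continuous_grad_norm.
Qed.

Lemma pow_grad_ge0 q x : 0 <= q -> 0 <= pow_grad q x.
Proof. by move=> q0; rewrite /pow_grad !mulr_ge0 ?powR_ge0 ?sqrtr_ge0. Qed.

Lemma norm_powR_le_line (q : R) (i : 'I_N) x : 2 <= q ->
  ((`|f x| `^ q)%:E <=
   \int[@lebesgue_measure R]_y (pow_grad q (rV_upd x i y))%:E)%E.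
Proof.
move=> q2.
pose F (y : R) := `|f (rV_upd x i y)| `^ q.
pose dF (y : R) := q * (`|f (rV_upd x i y)| `^ (q - 2) * f (rV_upd x i y)) *
  partial i f (rV_upd x i y).
have FdF (y : R) : is_derive y 1 F (dF y).
  apply: (@is_derive1_comp _ (fun s : R => `|s| `^ q)).
    exact: is_derive_norm_powR.
  exact: is_derive_rV_upd.
have cdF : continuous dF.
  apply: (continuous_line (f := fun x =>
    q * (`|f x| `^ (q - 2) * f x) * partial i f x)) => z.
  apply: (@continuousM _ _ (fun x => q * (`|f x| `^ (q - 2) * f x))); last exact: cdf.
  apply: (@continuousM _ _ (cst q)); first exact: cst_continuous.
  apply: (@continuousM _ _ (fun x => `|f x| `^ (q - 2))); last exact: cf.
  by apply: continuous_norm_powR_comp; rewrite subr_ge0.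
have F0 y : M < `|y| -> F y = 0.
  move=> My; rewrite /F (supp_cube_eq0 (i := i) fM) ?mxE ?eqxx//.
  by rewrite normr0 powR0// gt_eqF//; lra.
have cpg : continuous (fun y : R => pow_grad q (rV_upd x i y)).
  by apply: continuous_line; apply: continuous_pow_grad; lra.
have := (continuous_compact_supp_FTC M0 FdF cdF F0).2 (x 0 i).
rewrite /F rV_upd_id ger0_norm ?powR_ge0// => /le_trans; apply.
apply: ge0_le_integral => //.
- by apply: measurableT_comp => //; apply: measurableT_comp => //; exact: continuous_measurable_fun.
- by apply/measurable_EFinP; exact: (continuous_measurable_fun cpg).
- move=> y _; rewrite lee_fin /dF /pow_grad.
  set z := rV_upd x i y; rewrite !normrM (ger0_norm (powR_ge0 _ _)).
  rewrite ger0_norm; last by lra.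
  rewrite ler_pM ?mulr_ge0 ?powR_ge0 ?partial_le_grad_norm//; first by lra.
  rewrite ler_wpM2l//; first by lra.
  rewrite mulrC (_ : q - 2 = q - 1 - 1); last by ring.
  by rewrite mulr_powRB1// subr_gt0; lra.
Qed.

Definition norm_pow_int (p : R) : R := \int[mu]_x (`|f x| `^ p).
Local Notation I := norm_pow_int.

Lemma norm_pow_intE (p : R) : 0 < p ->
  (\int[mu]_x (`|f x| `^ p)%:E = (I p)%:E)%E.
Proof.
by move=> p0; rewrite fineK// integrable_fin_num//; exact: integrable_norm_powR.
Qed.

Lemma norm_pow_int_ge0 (p : R) : 0 <= I p.
Proof. by apply: Rintegral_ge0 => x _; exact: powR_ge0. Qed.

Lemma norm_pow_int_le (p P c d : R) : 0 < p -> 0 < P -> 0 <= c -> 0 <= d ->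
  (forall x, `|f x| `^ p <= c * `|f x| `^ 2 + d * `|f x| `^ P) ->
  I p <= c * I 2 + d * I P.
Proof.
move=> p0 P0 c0 d0 H; rewrite -lee_fin EFinD !EFinM -!norm_pow_intE//.
have m2 := measurable_norm_powR 2; have mP := measurable_norm_powR P.
rewrite -!ge0_integralZl//.
rewrite -ge0_integralD//; first last.
- exact: emeasurable_funM.
- by move=> x _; rewrite -EFinM lee_fin mulr_ge0 ?powR_ge0.
- exact: emeasurable_funM.
- by move=> x _; rewrite -EFinM lee_fin mulr_ge0 ?powR_ge0.
apply: ge0_le_integral => //.
- exact: measurable_norm_powR.
- by apply: emeasurable_funD; exact: emeasurable_funM.
- by move=> x _; rewrite -!EFinM -EFinD lee_fin.
Qed.

Lemma norm_pow_int_interp (p P : R) : 2 <= p -> p <= P -> I p <= I 2 + I P.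
Proof.
move=> p2 pP; rewrite -[I 2]mul1r -[I P]mul1r; apply: norm_pow_int_le; [lra..|].
move=> x; rewrite !mul1r; set r := `|f x|.
have [r1|r1] := leP 1 r.
  by rewrite (le_trans (ler_powR r1 pP))// lerDr powR_ge0.
have [->|r0] := eqVneq r 0.
  by rewrite powR0 ?addr_ge0 ?powR_ge0// gt_eqF//; lra.
rewrite (@le_trans _ _ (r `^ 2))//; last by rewrite lerDl powR_ge0.
by apply: ger_powR => //; rewrite lt_neqAle eq_sym r0 normr_ge0 ltW.
Qed.

Lemma pow_grad_int_le (q A : R) : 1 < q ->
  (\int[mu]_x (grad_norm x `^ 2)%:E <= A%:E)%E ->
  (\int[mu]_x (pow_grad q x)%:E <=
    (q * I (2 * q - 2) `^ 2^-1 * A `^ 2^-1)%:E)%E.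
Proof.
move=> q1 gA; have q0 : 0 <= q by lra.
have mg : measurable_fun setT grad_norm.
  exact: (continuous_measurable_rV continuous_grad_norm).
apply: le_trans.
  apply: (@hoelder_ge0 _ _ _ mu (fun x => q * `|f x| `^ (q - 1)) grad_norm 2 2).
  - apply: measurable_funM => //; apply/measurable_EFinP.
    exact: measurable_norm_powR.
  - exact: mg.
  - by move=> x; rewrite mulr_ge0 ?powR_ge0.
  - by move=> x; rewrite sqrtr_ge0.
  - by [].
  - by [].
  - by lra.
rewrite EFinM; apply: lee_pmul; [exact: poweR_ge0|exact: poweR_ge0| |].
  rewrite le_eqVlt; apply/orP; left; apply/eqP.
  have E x : (q * `|f x| `^ (q - 1)) `^ 2 = q `^ 2 * `|f x| `^ (2 * q - 2).
    by rewrite powRM ?powR_ge0// -powRrM; congr (_ * _ `^ _); ring.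
  under eq_integral do rewrite E EFinM.
  rewrite ge0_integralZl//; first last.
  - by rewrite lee_fin powR_ge0.
    - exact: measurable_norm_powR.
  rewrite norm_pow_intE; last by lra.
  rewrite -EFinM poweR_EFin powRM ?powR_ge0 ?norm_pow_int_ge0//.
  by rewrite -powRrM mulfV ?powRr1.
rewrite -poweR_EFin; apply: gt0_ler_poweR => //.
- rewrite in_itv /= leey andbT.
  by apply: integral_ge0 => x _; rewrite lee_fin powR_ge0.
- rewrite in_itv /= leey andbT; apply: le_trans gA.
  by apply: integral_ge0 => x _; rewrite lee_fin powR_ge0.
Qed.

Lemma grad_norm_int_le (A : R) :
  (forall i : 'I_N, (\int[mu]_x ((partial i f x) ^+ 2)%:E <= A%:E)%E) ->
  (\int[mu]_x (grad_norm x `^ 2)%:E <= (N%:R * A)%:E)%E.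
Proof.
move=> dA.
have E x : (grad_norm x `^ 2)%:E = (\sum_(i < N) ((partial i f x) ^+ 2)%:E)%E.
  rewrite powR_mulrn ?sqrtr_ge0// sqr_sqrtr ?sumEFin//.
  by apply: sumr_ge0 => i _; exact: sqr_ge0.
under eq_integral do rewrite E.
rewrite ge0_integral_sum//; first last.
- by move=> i x _; rewrite lee_fin sqr_ge0.
- move=> i; apply/measurable_EFinP; apply: measurable_funX.
  exact: continuous_measurable_rV.
apply: (le_trans (lee_sum _ (fun i _ => dA i))).
by rewrite sumEFin sumr_const card_ord mulr_natl.
Qed.

End sobolev_smooth.

Section sobolev_dimensions.
Context {R : realType}.

Lemma ge0_integral_rV_tuple N (f : 'rV[R]_N -> \bar R) :
  measurable_fun setT f -> (forall x, 0 <= f x)%E ->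
  (\int[@lebesgue_rV R N]_x f x =
   \int[lebesgue_tuple N]_t (f (rV_of_tuple t)))%E.
Proof.
move=> mf f0; rewrite [LHS]ge0_integral_pushforward//.
exact: measurable_rV_of_tuple.
Qed.

(** Applying the L^1 inequality to |f|^q instead of f, followed by Cauchy-Schwarz on |f|^(q-1) |∇f|,
    brings in the L^2 norm of the gradient. The price is the power 2q - 2 of f on the right, to be
    absorbed by a suitable choice of [q]. *)
Lemma norm_pow_int_gns n (f : 'rV[R]_n.+2 -> R) (M A q : R) :
  0 <= M -> Ck 1 f -> supp_cube M f -> 2 <= q ->
  (\int[@lebesgue_rV R n.+2]_x (grad_norm f x `^ 2)%:E <= A%:E)%E ->
  norm_pow_int f (q * (1 + n.+1%:R^-1)) <=
  (q * norm_pow_int f (2 * q - 2) `^ 2^-1 * A `^ 2^-1) `^ (1 + n.+1%:R^-1).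
Proof.
move=> M0 C1f fM q2 gA; have q1 : 1 < q by lra.
have s0 : 0 < 1 + n.+1%:R^-1 :> R by rewrite addr_gt0.
have mr := @measurable_rV_of_tuple R n.+2.
have mpg := continuous_measurable_rV (continuous_pow_grad C1f (ltW q1)).
have pg0 x : 0 <= pow_grad f q x by rewrite pow_grad_ge0//; lra.
have fq0 t : 0 <= `|f (rV_of_tuple t)| `^ q by exact: powR_ge0.
rewrite -lee_fin -(norm_pow_intE M0 C1f fM); last by rewrite mulr_gt0//; lra.
rewrite ge0_integral_rV_tuple//; last exact: measurable_norm_powR.
under eq_integral do rewrite powRrM.
apply: (@le_trans _ _ ((\int[lebesgue_tuple n.+2]_t
    (pow_grad f q (rV_of_tuple t))%:E) `^ (1 + n.+1%:R^-1))%E).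
  apply: (gagliardo_nirenberg
    (u := fun t => `|f (rV_of_tuple t)| `^ q)
    (g := fun t => pow_grad f q (rV_of_tuple t))) => //.
  - apply: (measurableT_comp (f := fun x => `|f x| `^ q)) => //.
    by apply/measurable_EFinP; exact: measurable_norm_powR.
  - exact: measurableT_comp.
  - move=> i t; apply: le_trans (norm_powR_le_line M0 C1f fM i _ q2) _.
    rewrite le_eqVlt; apply/orP; left; apply/eqP; apply: eq_integral => y _.
    by rewrite rV_of_tuple_upd.
rewrite -(ge0_integral_rV_tuple (f := fun x => (pow_grad f q x)%:E))//; last first.
  exact/measurable_EFinP.
rewrite -poweR_EFin; apply: gt0_ler_poweR; first exact: ltW.
- rewrite in_itv /= leey andbT; apply: integral_ge0 => x _.
  by rewrite lee_fin.
- by rewrite in_itv /= leey andbT lee_fin !mulr_ge0 ?powR_ge0//; lra.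
- exact: (pow_grad_int_le M0 C1f fM).
Qed.

Lemma norm_le_dim1 (f : 'rV[R]_1 -> R) (M A : R) :
  0 <= M -> Ck 1 f -> supp_cube M f ->
  (\int[@lebesgue_rV R 1]_x (grad_norm f x `^ 2)%:E <= A%:E)%E ->
  forall x, `|f x| `^ 2 <= 2 * norm_pow_int f 2 `^ 2^-1 * A `^ 2^-1.
Proof.
move=> M0 C1f fM gA x; rewrite -lee_fin.
have mpg := continuous_measurable_rV (continuous_pow_grad C1f (ltW (ltr1n R 2))).
have pg0 z : 0 <= pow_grad f 2 z by rewrite pow_grad_ge0.
apply: le_trans (norm_powR_le_line M0 C1f fM ord0 x (lexx 2)) _.
have := @pow_grad_int_le _ _ f M M0 C1f fM 2 A (ltr1n R 2) gA.
rewrite (_ : 2 * 2 - 2 = 2 :> R); last by ring.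
apply: le_trans.
rewrite ge0_integral_rV_tuple//; last exact/measurable_EFinP.
have mr : measurable_fun [set: 1.-tuple (measurableTypeR R)]
    (fun t => (pow_grad f 2 (rV_of_tuple t))%:E).
  apply/measurable_EFinP; apply: measurableT_comp => //.
  exact: measurable_rV_of_tuple.
rewrite [leRHS](integral_tuple1 mr (fun t => pg0 _)).
rewrite le_eqVlt; apply/orP; left; apply/eqP; apply: eq_integral => y _.
congr (pow_grad f 2 _)%:E; apply/rowP => j; rewrite !mxE ord1 eqxx.
by rewrite tnth0.
Qed.

End sobolev_dimensions.

Section sobolev.
Context {R : realType}.

(** On the right X occurs with the power s/2 < 1, so it can be divided out. *)
Lemma powR_sublinear_bound (X Y s : R) : 0 <= X -> 0 <= Y -> 0 < s -> s < 2 ->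
  X <= (Y * X `^ 2^-1) `^ s -> X <= Y `^ (s / (1 - s / 2)).
Proof.
move=> X0 Y0 s0 s2; have [->|Xn0] := eqVneq X 0; first by move=> _; exact: powR_ge0.
have {Xn0}X0 : 0 < X by rewrite lt_neqAle eq_sym Xn0.
have e0 : 0 < 1 - s / 2 by lra.
rewrite powRM ?powR_ge0// -powRrM => H.
have : X `^ (1 - s / 2) <= Y `^ s.
  rewrite powRB; last by rewrite (gt_eqF X0) implybT.
  rewrite powRr1 ?(ltW X0)// ler_pdivrMr ?powR_gt0//.
  by rewrite [s / 2]mulrC.
move=> {}H.
have XE : X = (X `^ (1 - s / 2)) `^ (1 - s / 2)^-1.
  by rewrite -powRrM mulfV ?gt_eqF// powRr1// ltW.
rewrite {1}XE powRrM.
by apply: ge0_ler_powR; rewrite ?nnegrE ?powR_ge0// invr_ge0 ltW.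
Qed.

(** The bound need not be homogeneous, so [K] may depend on [A] in any way and each dimension can be
    treated by its own means. It is essential that [K] is chosen before [f] and [M]: the size of the
    support must not enter when test functions approximate an element of H^1_0. *)
Lemma sobolev_smooth N (sigma A : R) : (1 <= N)%N -> 0 < sigma ->
  ((2 < N)%N -> sigma <= 2 / (N%:R - 2)) -> 0 <= A ->
  exists K : R, forall (f : 'rV[R]_N -> R) M, 0 <= M -> Ck 1 f -> supp_cube M f ->
    (\int[@lebesgue_rV R N]_x ((f x) ^+ 2)%:E <= A%:E)%E ->
    (forall i, (\int[@lebesgue_rV R N]_x (('D_(basis_vec i) f x) ^+ 2)%:E <= A%:E)%E) ->
    norm_pow_int f (2 * sigma + 2) <= K.
Proof.
move=> N1 s0 sN A0.
have I2 (f : 'rV[R]_N -> R) M : 0 <= M -> Ck 1 f -> supp_cube M f ->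
    (\int[@lebesgue_rV R N]_x ((f x) ^+ 2)%:E <= A%:E)%E -> norm_pow_int f 2 <= A.
  move=> M0 C1f fM fA; rewrite -lee_fin -(norm_pow_intE M0 C1f fM)//.
  apply: le_trans fA; rewrite le_eqVlt; apply/orP; left; apply/eqP.
  by apply: eq_integral => x _; rewrite powR_mulrn// real_normK// num_real.
case: N => [//|[|[|n]]] in N1 sN I2 *.
(* N = 1: f^2 is bounded pointwise by C, and |f|^(2σ+2) <= C^σ f^2. *)
- exists ((2 * A `^ 2^-1 * A `^ 2^-1) `^ sigma * A) => f M M0 C1f fM fA dA.
  have gA := grad_norm_int_le C1f dA; rewrite mul1r in gA.
  have fI := I2 f M M0 C1f fM fA.
  have sup := norm_le_dim1 M0 C1f fM gA.
  set C := 2 * A `^ 2^-1 * A `^ 2^-1.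
  have C0 : 0 <= C by rewrite !mulr_ge0 ?powR_ge0.
  have fC x : `|f x| `^ 2 <= C.
    apply: le_trans (sup x) _; rewrite ler_wpM2r ?powR_ge0// ler_wpM2l//.
    by apply: ge0_ler_powR; rewrite ?nnegrE ?norm_pow_int_ge0 ?invr_ge0.
  have : norm_pow_int f (2 * sigma + 2) <=
      C `^ sigma * norm_pow_int f 2 + 0 * norm_pow_int f 2.
    apply: (norm_pow_int_le M0 C1f fM); rewrite ?powR_ge0//; first by lra.
    move=> x; rewrite mul0r addr0 powRD; last first.
      by apply/implyP => /eqP; lra.
    rewrite ler_wpM2r ?powR_ge0// powRrM.
    by apply: ge0_ler_powR; rewrite ?nnegrE ?powR_ge0// ltW.
  rewrite mul0r addr0 => /le_trans; apply.
  by rewrite ler_wpM2l ?powR_ge0.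
(* N = 2: for this [q] the inequality bounds ∫ |f|^(2σ+4) by D ∫ |f|^(2σ+2). Splitting pointwise at
   f^2 = 2D gives |f|^(2σ+2) <= (2D)^σ f^2 + |f|^(2σ+4) / (2D), so half of the left-hand integral is
   absorbed. The summand 1 keeps D positive when A = 0. *)
- set q := sigma + 2.
  pose D : R := q ^+ 2 * (2 * A) + 1.
  have D1 : 1 <= D by rewrite lerDr mulr_ge0 ?sqr_ge0// mulr_ge0.
  pose c := (2 * D) `^ sigma.
  exists (2 * c * A) => f M M0 C1f fM fA dA.
  have gA := grad_norm_int_le C1f dA.
  have fI := I2 f M M0 C1f fM fA.
  have q2 : 2 <= q by rewrite /q; lra.
  have := norm_pow_int_gns M0 C1f fM q2 gA.
  rewrite (_ : 1 + 1^-1 = 2); last by rewrite invr1.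
  rewrite (_ : 2 * q - 2 = 2 * sigma + 2); last by rewrite /q; ring.
  set X := norm_pow_int f (2 * sigma + 2).
  have X0 : 0 <= X by exact: norm_pow_int_ge0.
  have q0 : 0 <= q by lra.
  rewrite powRM ?mulr_ge0 ?powR_ge0// powRM ?powR_ge0// -!powRrM mulVf//.
  rewrite !powRr1 ?mulr_ge0// powR_mulrn// => H.
  have H2 : norm_pow_int f (q * 2) <= D * X.
    apply: (le_trans H); rewrite mulrAC ler_wpM2r//.
    by rewrite lerDl.
  have : X <= c * norm_pow_int f 2 + (2 * D)^-1 * norm_pow_int f (q * 2).
    have D2 : 0 < 2 * D by lra.
    apply: (norm_pow_int_le M0 C1f fM); rewrite ?powR_ge0//; [lra|lra| |].
      by rewrite invr_ge0 ltW.
    move=> x; set r := `|f x|.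
    have [rD|rD] := leP (r `^ 2) (2 * D).
      apply: (@le_trans _ _ (c * r `^ 2)); last first.
        by rewrite lerDl mulr_ge0 ?powR_ge0// invr_ge0 ltW.
      rewrite powRD; last by apply/implyP => /eqP; lra.
      rewrite ler_wpM2r ?powR_ge0// powRrM.
      by apply: ge0_ler_powR; rewrite ?nnegrE ?powR_ge0// ltW.
    apply: (@le_trans _ _ ((2 * D)^-1 * r `^ (q * 2))); last first.
      by rewrite lerDr mulr_ge0 ?powR_ge0.
    rewrite (_ : q * 2 = 2 + (2 * sigma + 2)); last by rewrite /q; ring.
    rewrite [r `^ (2 + _)]powRD; last by apply/implyP => /eqP; lra.
    rewrite mulrA ler_peMl ?powR_ge0//.
    by rewrite ler_pdivlMl// mulr1 ltW.
  move=> HX.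
  have HX2 : (2 * D)^-1 * norm_pow_int f (q * 2) <= X / 2.
    rewrite ler_pdivrMl; last by rewrite mulr_gt0// (lt_le_trans ltr01).
    by rewrite (_ : 2 * D * (X / 2) = D * X)//; field.
  have : c * norm_pow_int f 2 <= c * A by rewrite ler_wpM2l ?powR_ge0.
  by clear -HX HX2; lra.
(* N >= 3 and m = N - 1: this [q] solves q (1 + 1/m) = 2q - 2, so the critical power 2N/(N-2) stands
   on both sides, on the right with exponent s/2 < 1. Smaller powers follow by interpolation with
   the power 2. *)
- pose m : R := n.+2%:R.
  have m2 : 2 <= m by rewrite /m ler_nat.
  pose q : R := 2 * m / (m - 1).
  pose s : R := 1 + m^-1.
  pose B : R := (n.+3%:R * A) `^ 2^-1.
  exists (A + (q * B) `^ (s / (1 - s / 2))) => f M M0 C1f fM fA dA.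
  have gA := grad_norm_int_le C1f dA.
  have fI := I2 f M M0 C1f fM fA.
  have q2 : 2 <= q by rewrite /q ler_pdivlMr; lra.
  have := norm_pow_int_gns M0 C1f fM q2 gA.
  rewrite -/m -/s.
  have mm : m - 1 != 0 by rewrite gt_eqF; lra.
  have mn0 : m != 0 by rewrite gt_eqF; lra.
  have qs : q * s = 2 * (2 / (m - 1)) + 2.
    rewrite /q /s; move: (m) mm mn0 => z z1 z0; field.
    by rewrite z0 z1.
  have -> : 2 * q - 2 = q * s.
    rewrite qs /q; move: (m) mm => z z1; field.
    by rewrite z1.
  set X := norm_pow_int f (q * s).
  rewrite -/B mulrAC => H.
  have q0 : 0 <= q by lra.
  have minv : m^-1 <= 2^-1 by rewrite lef_pV2// posrE; lra.
  have HX : X <= (q * B) `^ (s / (1 - s / 2)).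
    apply: powR_sublinear_bound H.
    - exact: norm_pow_int_ge0.
    - by rewrite mulr_ge0// powR_ge0.
    - by rewrite /s addr_gt0// invr_gt0; lra.
    - rewrite /s (_ : 2 = 1 + 1 :> R)// ltrD2l; apply: (le_lt_trans minv).
      by rewrite invf_lt1// ltr1n.
  apply: (@le_trans _ _ (norm_pow_int f 2 + X)); last by rewrite lerD.
  apply: (norm_pow_int_interp M0 C1f fM).
    by rewrite lerDr mulr_ge0// ltW.
  have := sN isT; rewrite (_ : n.+3%:R - 2 = m - 1); last first.
    by rewrite /m -natr1; ring.
  move=> sm.
  by rewrite qs lerD2r ler_wpM2l.
Qed.

End sobolev.

(** * Bump functions and the fundamental lemma *)

Section smooth_bumps.
Context {R : realType}.

(** The functions t^(-m) exp(-1/t), extended by 0. The parameter [m] makes the span of the family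
    closed under differentiation. *)
Definition flat (m : nat) (t : R) : R :=
  if 0 < t then t^-1 ^+ m * expR (- t^-1) else 0.

Lemma flat_ge0 m t : 0 <= flat m t.
Proof.
rewrite /flat; case: ifPn => // t0.
by rewrite mulr_ge0 ?expR_ge0// exprn_ge0// invr_ge0 ltW.
Qed.

(** exp(1/t) is cut into m + 1 equal factors, each at least 1/((m+1)t). A linear bound suffices for
    the derivative at 0, since flat m h / h = flat (m+1) h for h > 0. *)
Lemma flat_le_linear m t : 0 < t -> flat m t <= m.+1%:R ^+ m.+1 * t.
Proof.
move=> t0; rewrite /flat t0 expRN.
have m0 : (0 : R) < m.+1%:R by rewrite ltr0n.
have H : (m.+1%:R * t)^-1 ^+ m.+1 <= expR t^-1.
  have -> : t^-1 = m.+1%:R * (m.+1%:R * t)^-1.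
    by rewrite invfM mulrA divff ?mul1r// gt_eqF.
  rewrite expRM_natl; apply: lerXn2r; rewrite ?nnegrE ?expR_ge0//.
    by rewrite invr_ge0 mulr_ge0// ltW.
  by apply: le_trans (expR_ge1Dx _); rewrite lerDr.
rewrite ler_pdivrMr ?expR_gt0//; apply: le_trans (ler_wpM2l _ H); last first.
  by rewrite mulr_ge0 ?exprn_ge0// ltW.
rewrite invfM exprMn mulrACA -exprMn mulfV ?gt_eqF// expr1n mul1r.
by rewrite exprS mulrA mulfV ?gt_eqF// mul1r.
Qed.

Lemma is_derive_flat m (t : R) :
  is_derive t 1 (flat m) (flat m.+2 t - m%:R * flat m.+1 t).
Proof.
have [t0|t0|->] := ltgtP t 0.
- apply: (@near_eq_is_derive _ _ _ (cst 0)).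
    near=> s; rewrite /flat ltNge ltW//; near: s; exact: lt_nbhsl.
  apply: (is_derive_eq (is_derive_cst _ _ _)).
  by rewrite /flat ltNge ltW//= mulr0 subr0.
- have tn0 : t != 0 by rewrite gt_eqF.
  apply: (@near_eq_is_derive _ _ _ (fun t : R => t^-1 ^+ m * expR (- t^-1))).
    near=> s; rewrite /flat ifT//; near: s; exact: lt_nbhsr.
  have dV : is_derive t 1 (fun t : R => t^-1) (- t ^- 2).
    apply: DeriveDef; first exact: derivableV.
    by rewrite deriveV// derive_id -[_%:A]/(_ * 1) mulr1.
  have dVm : is_derive t 1 (fun t : R => t^-1 ^+ m) (- (m%:R * t^-1 ^+ m.+1)).
    rewrite (_ : (fun t : R => _) = (fun t : R => t^-1) ^+ m); last first.
      by rewrite exprfctE.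
    apply: (is_derive_eq (is_deriveX m dV)).
    rewrite -[LHS]/(_ * _) mulrN -exprVn -mulrA -exprD.
    by case: m => [|m]; rewrite ?mul0r// addn2.
  have dE : is_derive t 1 (fun t : R => expR (- t^-1)) (expR (- t^-1) * t ^- 2).
    apply: is_derive1_comp; apply: (is_derive_eq (is_deriveN _)).
    by rewrite opprK.
  apply: (is_derive_eq (is_deriveM dVm dE)).
  rewrite /flat t0 -!exprVn -![_ *: _]/(_ * _) -[in RHS](addn2 m) exprD; ring.
- apply: cvg_is_derive1.
  have f0 p : flat p 0 = 0 by rewrite /flat ltxx.
  rewrite !f0 mulr0 subr0.
  apply/cvgr0Pnorm_lt => e e0; near=> h.
  rewrite addr0 subr0.
  have [h0|h0] := leP h 0; first by rewrite /flat (le_gtF h0) mulr0 normr0.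
  have -> : h^-1 * flat m h = flat m.+1 h by rewrite /flat h0 exprS mulrA.
  rewrite ger0_norm ?flat_ge0//; apply: (le_lt_trans (flat_le_linear _ h0)).
  rewrite -ltr_pdivlMl; last by rewrite exprn_gt0.
  rewrite -[h]gtr0_norm//; near: h; apply: nbhs_dnbhs.
  by apply: nbhs0_lt; rewrite mulr_gt0 ?invr_gt0 ?exprn_gt0.
Unshelve. all: by end_near. Qed.

Lemma continuous_flat m : continuous (flat m).
Proof.
move=> t; apply/differentiable_continuous/derivable1_diffP.
by case: (is_derive_flat m t).
Qed.

Lemma flat0_le1 (t : R) : flat 0 t <= 1.
Proof.
rewrite /flat; case: ifPn => // t0.
by rewrite mul1r expR_le1 oppr_le0 invr_ge0 ltW.
Qed.

Lemma flat0_cvg (t : R) : 0 < t -> flat 0 (n.+1%:R * t) @[n --> \oo] --> (1 : R).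
Proof.
move=> t0.
have E n : flat 0 (n.+1%:R * t) = expR (- (t^-1 * n.+1%:R^-1)).
  by rewrite /flat mulr_gt0// expr0 mul1r invfM mulrC.
under eq_fun do rewrite E.
have H : - (t^-1 * n.+1%:R^-1) @[n --> \oo] --> - (t^-1 * 0).
  by apply: cvgN; apply: cvgMr; exact: cvg_harmonic.
have := @continuous_cvg _ _ _ _ _ _ _ _ (@continuous_expR R (- (t^-1 * 0))) H.
by rewrite mulr0 oppr0 expR0; apply.
Qed.

Lemma is_derive_line (V : normedModType R) (f : V -> R) (x v : V) (l : R) :
  is_derive (0 : R) 1 (fun h : R => f (h *: v + x)) l -> is_derive x v f l.
Proof.
move=> [d <-]; split; first exact/derivable1P.
rewrite /derive; set g1 := fun h => h^-1 *: _; set g2 := fun h => h^-1 *: _.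
suff -> : g1 = g2 by [].
rewrite funeqE /g1 /g2 => h /=.
by rewrite addr0 scale0r add0r -[h%:A]/(h * 1) mulr1.
Qed.

Context {N : nat}.
Local Notation E := 'rV[R]_N.
Local Notation partial i f := ('D_(basis_vec i) f).

(* This class is closed under partial derivatives, which makes its members C^k for
   every k. *)
Inductive flat_expr : (E -> R) -> Prop :=
| flat_expr_flat m (i : 'I_N) (a b : R) : flat_expr (fun x => flat m (a * x 0 i + b))
| flat_expr_cst (c : R) : flat_expr (cst c)
| flat_expr_add (f g : E -> R) : flat_expr f -> flat_expr g -> flat_expr (f \+ g)
| flat_expr_mul (f g : E -> R) : flat_expr f -> flat_expr g -> flat_expr (f \* g).

Lemma continuous_flat_expr f : flat_expr f -> continuous f.
Proof.
elim=> {f} [m i a b|c|f g _ cf _ cg|f g _ cf _ cg] x.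
- apply: (@continuous_comp _ _ _ (fun x : E => a * x 0 i + b) (flat m)).
    apply: (@continuousD _ _ _ (fun x : E => a * x 0 i) (cst b)); last exact: cst_continuous.
    apply: (@continuousM _ _ (cst a) (fun x : E => x 0 i)); first exact: cst_continuous.
    exact: coord_continuous.
  exact: continuous_flat.
- exact: cst_continuous.
- by apply: continuousD; [exact: cf|exact: cg].
- by apply: continuousM; [exact: cf|exact: cg].
Qed.

Lemma derive_flat_expr f : flat_expr f -> forall i : 'I_N,
  exists2 df, flat_expr df & forall x, is_derive x (basis_vec i) f (df x).
Proof.
elim=> {f} [m i a b|c|f g sf df sg dg|f g sf df sg dg] j.
- have [->|ij] := eqVneq i j.
    exists (fun x => a * flat m.+2 (a * x 0 j + b) +
        (- a * m%:R) * flat m.+1 (a * x 0 j + b)).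
      apply: (flat_expr_add (f := fun x => _) (g := fun x => _)).
        apply: (flat_expr_mul (f := cst a)); [exact: flat_expr_cst|exact: flat_expr_flat].
      apply: (flat_expr_mul (f := cst (- a * m%:R))); [exact: flat_expr_cst|exact: flat_expr_flat].
    move=> x; apply: is_derive_line.
    rewrite (_ : (fun h : R => _) = flat m \o (fun h => a * h + (a * x 0 j + b))); last first.
      by apply/funext => h /=; rewrite !mxE !eqxx mulr1 mulrDr addrA.
    have dl : is_derive (0 : R) 1 (fun h : R => a * h + (a * x 0 j + b)) a.
      apply: (is_derive_eq (is_deriveD (is_deriveM (is_derive_cst a _ _)
         (is_derive_id _ _)) (is_derive_cst _ _ _))).
      by rewrite scaler0 !addr0 -[LHS]/(a * 1) mulr1.
    apply: (is_derive_eq (is_derive1_comp (is_derive_flat m _) dl)).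
    rewrite mulr0 add0r; ring.
  exists (cst 0); first exact: flat_expr_cst.
  move=> x; apply: is_derive_line.
  rewrite (_ : (fun h : R => _) = cst (flat m (a * x 0 i + b))).
    exact: is_derive_cst.
  by apply/funext => h /=; rewrite !mxE (negPf ij) /= mulr0 add0r.
- by exists (cst 0) => [|x]; [exact: flat_expr_cst|exact: is_derive_cst].
- have [f' sf' ff'] := df j; have [g' sg' gg'] := dg j.
  exists (f' \+ g') => [|x]; first exact: flat_expr_add.
  exact: is_deriveD.
- have [f' sf' ff'] := df j; have [g' sg' gg'] := dg j.
  exists ((f \* g') \+ (g \* f')) => [|x].
    by apply: flat_expr_add; exact: flat_expr_mul.
  exact: is_deriveM.
Qed.

Lemma Ck_flat_expr k f : flat_expr f -> Ck k f.
Proof.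
elim: k f => [|k IH] f sf /=; split => //; try exact: continuous_flat_expr.
move=> i; have [df sdf fdf] := derive_flat_expr sf i; split.
  by move=> x; case: (fdf x).
rewrite (_ : 'D_(basis_vec i) f = df); first exact: IH.
by apply/funext => x; case: (fdf x).
Qed.

Lemma flat_expr_prod (I : Type) (r : seq I) (F : I -> E -> R) :
  (forall i, flat_expr (F i)) -> flat_expr (fun x => \prod_(i <- r) F i x).
Proof.
move=> sF; elim: r => [|i r IH].
  by under eq_fun do rewrite big_nil; exact: flat_expr_cst.
by under eq_fun do rewrite big_cons; exact: (flat_expr_mul (sF i) IH).
Qed.

End smooth_bumps.

Section test_functions.
Context {R : realType} {N : nat}.
Local Notation E := 'rV[R]_N.
Local Notation mu := (@lebesgue_rV R N).
Local Notation partial i f := ('D_(basis_vec i) f).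
Implicit Types (Om : set E) (f g : E -> R).

Lemma real_test_function_supp_cube Om f : real_test_function Om f ->
  exists2 M, 0 <= M & supp_cube M f.
Proof.
move=> [_ /compact_bounded[M [_ Mf]] _].
pose K := `|M| + 1; have K0 : 0 <= K by rewrite addr_ge0.
have MK : M < K by rewrite (le_lt_trans (ler_norm M))// ltrDl.
exists K => // x fx; apply/(cube_norm _ K0); apply: (Mf _ MK).
exact: subset_closure.
Qed.

Lemma real_test_functionP Om f (F : set E) : closed F -> F `<=` Om ->
  (exists M, F `<=` cube M) ->
  (forall k, Ck k f) -> (forall x, f x != 0 -> F x) -> real_test_function Om f.
Proof.
move=> clF FOm [M FM] Cf fF.
have clf : closure [set x | f x != 0] `<=` F.
  by rewrite [X in _ `<=` X](iffLR (closure_id F) clF); exact: closureS.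
split => //; last exact: subset_trans clf FOm.
apply: (@subclosed_compact _ _ (cube `|M|)); [exact: closed_closure|exact: compact_cube|].
move=> x /clf/FM xM i; exact: le_trans (xM i) (ler_norm M).
Qed.

Lemma closed_box_sub_cube (c d : E) : exists M, closed_box c d `<=` cube M.
Proof.
exists (\sum_i (`|c 0 i| + `|d 0 i|)) => x cdx i; have /andP[cx xd] := cdx i.
rewrite (bigD1 i)//=; apply: (@le_trans _ _ (`|c 0 i| + `|d 0 i|)).
  rewrite ler_norml; apply/andP; split.
    rewrite (le_trans _ cx)// lerNl (le_trans (ler_norm _))// normrN.
    by rewrite lerDl.
  by rewrite (le_trans xd)// (le_trans (ler_norm _))// lerDr.
by rewrite lerDl; apply: sumr_ge0 => j _; rewrite addr_ge0.
Qed.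

(** Since [flat 0] (n t) = exp(-1/(n t)) tends to 1 for t > 0, these smooth functions tend to the
    indicator of the open box, while all of them vanish outside that same box. *)
Definition box_bump (c d : E) (n : nat) (x : E) : R :=
  \prod_(i < N) (flat 0 (n.+1%:R * (x 0 i - c 0 i)) *
                 flat 0 (n.+1%:R * (d 0 i - x 0 i))).

Lemma box_bump_eq0 c d n x : ~ open_box c d x -> box_bump c d n x = 0.
Proof.
move=> /existsNP[i xi]; rewrite /box_bump (bigD1 i)//=; apply/eqP; rewrite !mulf_eq0.
move: xi => /negP; rewrite negb_and -!leNgt => /orP[xc|dx].
  apply/orP; left; apply/orP; left; rewrite /flat ifF//; apply/negbTE.
  by rewrite -leNgt pmulr_rle0// subr_le0.
apply/orP; left; apply/orP; right; rewrite /flat ifF//; apply/negbTE.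
by rewrite -leNgt pmulr_rle0// subr_le0.
Qed.

Lemma Ck_box_bump k c d n : Ck k (box_bump c d n).
Proof.
apply: Ck_flat_expr; apply: flat_expr_prod => i.
apply: (flat_expr_mul
  (f := fun x => flat 0 (n.+1%:R * (x 0 i - c 0 i)))
  (g := fun x => flat 0 (n.+1%:R * (d 0 i - x 0 i)))).
  rewrite (_ : (fun x => _) = fun x : E =>
    flat 0 (n.+1%:R * x 0 i + - n.+1%:R * c 0 i)); first exact: flat_expr_flat.
  by apply/funext => x; rewrite mulrBr mulNr.
rewrite (_ : (fun x => _) = fun x : E =>
  flat 0 (- n.+1%:R * x 0 i + n.+1%:R * d 0 i)); first exact: flat_expr_flat.
by apply/funext => x; rewrite mulrBr mulNr addrC.
Qed.

Lemma box_bump_test Om c d c' d' n : open_box c d `<=` closed_box c' d' ->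
  closed_box c' d' `<=` Om -> real_test_function Om (box_bump c d n).
Proof.
move=> cd' cdOm; apply: (@real_test_functionP _ _ (closed_box c' d')) => //.
- exact: closed_box_closed.
- exact: closed_box_sub_cube.
- by move=> k; exact: Ck_box_bump.
- move=> x; apply: contra_neqP => xF; apply: box_bump_eq0.
  by apply: contra_not xF; exact: cd'.
Qed.

Lemma box_bump_ge0 c d n x : 0 <= box_bump c d n x.
Proof. by apply: prodr_ge0 => i _; rewrite mulr_ge0 ?flat_ge0. Qed.

Lemma box_bump_le1 c d n x : box_bump c d n x <= 1.
Proof.
apply: prodr_ile1 => i; rewrite mulr_ge0 ?flat_ge0//=.
by rewrite mulr_ile1 ?flat_ge0 ?flat0_le1.
Qed.

Lemma box_bump_cvg c d x :
  box_bump c d n x @[n --> \oo] --> (\1_(open_box c d) x : R).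
Proof.
have [cdx|cdx] := pselect (open_box c d x); last first.
  rewrite indicE memNset//.
  by under eq_fun do rewrite (box_bump_eq0 _ cdx); exact: cvg_cst.
rewrite indicE mem_set//= (_ : 1%:R = \prod_(i < N) (1 * 1)); last first.
  by rewrite big1// => i _; rewrite mulr1.
apply: cvg_big => [|i _]; first exact: mul_continuous.
have /andP[ci di] := cdx i.
by apply: cvgM; apply: flat0_cvg; rewrite subr_gt0.
Qed.

Lemma continuous_box_bump c d n : continuous (box_bump c d n).
Proof.
by have [] := Ck_box_bump 0 c d n.
Qed.

Definition open_boxes : set (set E) := [set Q | exists c d, Q = open_box c d].

Lemma open_boxI (c d c' d' : E) : open_box c d `&` open_box c' d' =
  open_box (\row_i Num.max (c 0 i) (c' 0 i)) (\row_i Num.min (d 0 i) (d' 0 i)).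
Proof.
apply/seteqP; split => [x [cd cd'] i|x cdx].
  rewrite !mxE gt_max lt_min.
  by have /andP[-> ->] := cd i; have /andP[-> ->] := cd' i.
by split => i; have := cdx i; rewrite !mxE gt_max lt_min => /andP[/andP[? ?] /andP[? ?]];
  apply/andP; split.
Qed.

(** The generating sets are preimages under coordinates. For an open interval such a preimage is
    open, hence a countable union of rational boxes. Together with [open_boxI], this makes the boxes
    a generating π-system. *)
Lemma measurable_sub_open_boxes (A : set E) : measurable A -> <<s open_boxes >> A.
Proof.
pose T := g_sigma_algebraType open_boxes.
have mc (i : 'I_N) : measurable_fun setT (fun x : T => (x : E) 0 i : measurableTypeR R).
  apply: (measurability _ (RGenOpens.measurableE R)).
  move=> _ [_ [a [b ->] <-]]; rewrite setTI.
  have oab : open ((fun x : E => x 0 i) @^-1` `]a, b[%classic).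
    apply: open_comp; last exact: interval_open.
    by move=> x _; exact: coord_continuous.
  rewrite [X in measurable X](open_bigcup_box oab) bigcup_mkcond.
  apply: (@countable_bigcupT_measurable _ T) => [|q]; first exact: countableP.
  case: ifP => [_|_]; last exact: measurable0.
  by apply: sub_sigma_algebra; exists (rat_vec q.1), (rat_vec q.2).
apply: smallest_sub; first exact: smallest_sigma_algebra.
move=> B; rewrite -bigcup_seq => -[i _ [C mC <-]].
exact: (mc i measurableT C mC).
Qed.

Lemma integral_box_bump (g : E -> R) c d c0 d0 :
  mu.-integrable (open_box c0 d0) (EFin \o g) ->
  open_box c d `<=` open_box c0 d0 ->
  (forall n, \int[mu]_(x in open_box c0 d0) (g x * box_bump c d n x)%:E = 0)%E ->
  (\int[mu]_(x in open_box c d) (g x)%:E = 0)%E.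
Proof.
move=> ig cdS H; have mQ := measurable_open_box c0 d0.
have mg := measurable_int _ ig.
have ign : mu.-integrable (open_box c0 d0) (fun x => `|(g x)%:E|)%E.
  exact: integrable_abse.
have mgb n : measurable_fun (open_box c0 d0) (fun x => (g x * box_bump c d n x)%:E).
  apply/measurable_EFinP; apply: measurable_funM; first exact/measurable_EFinP.
  by apply: measurable_funTS; apply: continuous_measurable_rV; exact: continuous_box_bump.
have mgi : measurable_fun (open_box c0 d0) (fun x => (g x * \1_(open_box c d) x)%:E).
  apply/measurable_EFinP; apply: measurable_funM; first exact/measurable_EFinP.
  by apply: measurable_indic; exact: measurable_open_box.
have cvgb : {ae mu, forall x, open_box c0 d0 x ->
    (g x * box_bump c d n x)%:E @[n --> \oo] --> (g x * \1_(open_box c d) x)%:E}.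
  apply: aeW => x _.
  by apply: cvg_EFin; [exact: nearW|apply: cvgMr; exact: box_bump_cvg].
have domb : {ae mu, forall x n, open_box c0 d0 x ->
    (`|(g x * box_bump c d n x)%:E| <= `|(g x)%:E|)%E}.
  apply: aeW => x n _.
  by rewrite /= normrM lee_fin ler_piMr// ger0_norm ?box_bump_ge0 ?box_bump_le1.
have [_ _] := dominated_convergence mQ mgb mgi cvgb ign domb.
have -> : (fun n => \int[mu]_(x in open_box c0 d0) (g x * box_bump c d n x)%:E)%E =
    cst 0%E by apply/funext => n; exact: H.
move=> K; transitivity
    (\int[mu]_(x in open_box c0 d0) (g x * \1_(open_box c d) x)%:E)%E.
  rewrite -{1}(setIidr cdS) integral_mkcondr; apply: eq_integral => x _.
  by rewrite patchE indicE; case: ifP => _; rewrite ?mulr1 ?mulr0.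
exact: (cvg_unique _ K (cvg_cst _)).
Qed.

(** Dynkin's argument inside the fixed box Q: the measurable sets A for which g integrates to 0 over
    A ∩ Q form a λ-system that contains the π-system of open boxes. *)
Lemma ae_eq0_open_box (g : E -> R) c0 d0 :
  mu.-integrable (open_box c0 d0) (EFin \o g) ->
  (forall c d, open_box c d `<=` open_box c0 d0 ->
    (\int[mu]_(x in open_box c d) (g x)%:E = 0)%E) ->
  ae_eq mu (open_box c0 d0) (EFin \o g) (cst 0%E).
Proof.
set Q := open_box c0 d0 => ig H; have mQ : measurable Q := measurable_open_box c0 d0.
pose L : set (set E) :=
  [set A | measurable A /\ (\int[mu]_(x in A `&` Q) (g x)%:E = 0)%E].
have dL : dynkin L.
  split.
  - by split => //; rewrite setTI; apply: H.
  - move=> A [mA A0]; split; first exact: measurableC.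
    have : (\int[mu]_(x in Q) (g x)%:E = 0)%E by apply: H.
    have QE : Q = (A `&` Q) `|` (~` A `&` Q) by rewrite -setIUl setUv setTI.
    rewrite {1}QE integral_setU//.
    + by rewrite A0 add0e.
    + exact: measurableI.
    + by apply: measurableI => //; exact: measurableC.
    + by rewrite -QE; exact: (measurable_int _ ig).
    + by rewrite disj_set2E setIACA setICr set0I.
  - move=> F tF LF; split; first by apply: bigcupT_measurable => n; case: (LF n).
    rewrite setI_bigcupl integral_bigcup.
    + by rewrite eseries0// => n _ _; case: (LF n).
    + exact: trivIset_setIr.
    + by move=> n; apply: measurableI => //; case: (LF n).
    + rewrite -setI_bigcupl; apply: (integrableS mQ) => //.
      by apply: measurableI => //; apply: bigcupT_measurable => n; case: (LF n).
have sL : <<s open_boxes >> `<=` L.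
  apply: lambda_system_subset => //.
  - move=> A B [c [d ->]] [c' [d' ->]]; rewrite open_boxI.
    by eexists; eexists; reflexivity.
  - exact/dynkin_lambda_system.
  - move=> A [c [d ->]]; split; first exact: measurable_open_box.
    rewrite /Q open_boxI; apply: H; rewrite -open_boxI; exact: subIsetr.
apply: (integral_ae_eq mQ ig) => [|A AQ mA]; first exact: measurable_cst.
rewrite integral0; have [_] := sL _ (measurable_sub_open_boxes mA).
by rewrite (setIidl AQ).
Qed.

(** The fundamental lemma of the calculus of variations. On a box whose closure lies in [Om], bumps
    of all smaller boxes are admissible, so [g] vanishes almost everywhere there; countably many
    such boxes cover [Om]. *)
Lemma test_function_orthogonal_eq0 Om (g : E -> R) : open Om ->
  measurable_fun Om g -> (\int[mu]_(x in Om) ((g x) ^+ 2)%:E < +oo)%E ->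
  (forall f, real_test_function Om f -> \int[mu]_(x in Om) (g x * f x) = 0) ->
  {ae mu, forall x, Om x -> g x = 0}.
Proof.
move=> oOm mg g2 H; have mOm := open_measurable_rV oOm.
have mg2 : measurable_fun Om (fun x => ((g x) ^+ 2)%:E).
  by apply/measurable_EFinP; exact: measurable_funX.
have ig c d : closed_box c d `<=` Om -> mu.-integrable (open_box c d) (EFin \o g).
  move=> cdOm.
  have QOm : open_box c d `<=` Om by exact: subset_trans (@open_box_closed_box _ _ c d) cdOm.
  have mQ := measurable_open_box c d.
  have Qoo : (mu (open_box c d) < +oo)%E.
    have [M cdM] := closed_box_sub_cube c d.
    apply: le_lt_trans (lebesgue_cube M); apply: le_measure; rewrite ?inE//.
      exact: measurable_cube.
    exact: subset_trans (@open_box_closed_box _ _ c d) cdM.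
  apply/integrableP; split; first by apply/measurable_EFinP; exact: (measurable_funS mOm).
  (* A box has finite measure, so |g| <= 1 + g^2 makes a square-integrable function integrable on
     it. *)
  apply: (@le_lt_trans _ _ (\int[mu]_(x in open_box c d) (1 + ((g x) ^+ 2)%:E))%E).
    apply: ge0_le_integral => //.
    - apply: measurableT_comp => //; apply/measurable_EFinP; exact: (measurable_funS mOm).
    - apply: emeasurable_funD => //; exact: (measurable_funS mOm).
    - move=> x _; rewrite /= -EFinD lee_fin; have := sqr_ge0 (`|g x| - 1).
      by rewrite sqrrB1 real_normK ?num_real//; have := normr_ge0 (g x); lra.
  rewrite ge0_integralD//; last 2 first.
    by move=> x _; rewrite lee_fin sqr_ge0.
    exact: (measurable_funS mOm).
  rewrite integral_cst// mul1e lte_add_pinfty//.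
  apply: le_lt_trans g2; apply: ge0_subset_integral => //.
  by move=> x _; rewrite lee_fin sqr_ge0.
pose B (q : 'rV[rat]_N * 'rV[rat]_N) : set E :=
  [set x | closed_box (rat_vec q.1) (rat_vec q.2) `<=` Om /\
           open_box (rat_vec q.1) (rat_vec q.2) x /\ g x <> 0].
have nB q : mu.-negligible (B q).
  have [qOm|qOm] := pselect (closed_box (rat_vec (R := R) q.1) (rat_vec q.2) `<=` Om); last first.
    by apply: negligibleS (negligible_set0 mu) => x [].
  have QOm := subset_trans (@open_box_closed_box _ _ (rat_vec q.1) (rat_vec q.2)) qOm.
  have : ae_eq mu (open_box (rat_vec q.1) (rat_vec q.2)) (EFin \o g) (cst 0%E).
    apply: ae_eq0_open_box => [|c d cdq]; first exact: ig.
    apply: (integral_box_bump (ig _ _ qOm) cdq) => n.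
    have tb := box_bump_test n (subset_trans cdq (@open_box_closed_box _ _ _ _)) qOm.
    have mgb : measurable_fun (open_box (rat_vec q.1) (rat_vec q.2))
        (fun x => (g x * box_bump c d n x)%:E).
      apply/measurable_EFinP; apply: measurable_funM; first exact: (measurable_funS mOm).
      by apply: measurable_funTS; apply: continuous_measurable_rV; exact: continuous_box_bump.
    have igb : mu.-integrable (open_box (rat_vec q.1) (rat_vec q.2))
        (fun x => (g x * box_bump c d n x)%:E).
      apply: (le_integrable (measurable_open_box _ _) mgb _ (ig _ _ qOm)) => x _.
      by rewrite /= normrM lee_fin ler_piMr// ger0_norm ?box_bump_ge0 ?box_bump_le1.
    (* The orthogonality hypothesis concerns the real-valued integral, which is 0 by default when
       the extended one is infinite; integrability excludes this. *)
    rewrite -[LHS]fineK; last exact: (integrable_fin_num (measurable_open_box _ _)).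
    congr EFin; rewrite -[RHS](H _ tb); congr fine.
    rewrite -{1}(setIidr QOm) integral_mkcondr; apply: eq_integral => x _.
    rewrite patchE; case: ifPn => //; rewrite notin_setE => qx.
    by rewrite box_bump_eq0 ?mulr0// => /cdq.
  apply: negligibleS => x [_ [qx gx]] /= /(_ qx) [].
  exact.
have : mu.-negligible (\bigcup_n (if unpickle n is Some q then B q else set0)).
  apply: negligible_bigcup => n.
  by case: unpickle => [q|]; [exact: nB|exact: negligible_set0].
apply: negligibleS => x /= /not_implyP[Omx gx].
move: (Omx); rewrite (open_bigcup_box oOm) => -[q qOm qx].
by exists (pickle q) => //; rewrite pickleK.
Qed.

End test_functions.

(** * L^2, weak derivatives and H^1_0 *)

Local Open Scope complex_scope.

Section complex_parts.
Context {R : realType}.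
Implicit Types z w : R[i].
Local Notation Re := complex.Re.
Local Notation Im := complex.Im.

Lemma ReD z w : Re (z + w) = Re z + Re w. Proof. by case: z w => [? ?] []. Qed.
Lemma ImD z w : Im (z + w) = Im z + Im w. Proof. by case: z w => [? ?] []. Qed.
Lemma ReN z : Re (- z) = - Re z. Proof. by case: z. Qed.
Lemma ImN z : Im (- z) = - Im z. Proof. by case: z. Qed.
Lemma ReM z w : Re (z * w) = Re z * Re w - Im z * Im w.
Proof. by case: z w => [? ?] []. Qed.
Lemma ImM z w : Im (z * w) = Re z * Im w + Im z * Re w.
Proof. by case: z w => [? ?] []. Qed.
Lemma complex_eqP z w : Re z = Re w -> Im z = Im w -> z = w.
Proof. by case: z w => [? ?] [? ?] /= -> ->. Qed.

Lemma modulus_ge0 z : 0 <= modulus z.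
Proof. by case: z => x y; exact: sqrtr_ge0. Qed.

Lemma sqr_modulus z : modulus z ^+ 2 = Re z ^+ 2 + Im z ^+ 2.
Proof. by case: z => x y; rewrite /modulus /= sqr_sqrtr// addr_ge0 ?sqr_ge0. Qed.

End complex_parts.

Section L2_space.
Context {R : realType} {N : nat}.
Local Notation E := 'rV[R]_N.
Local Notation mu := (@lebesgue_rV R N).
Local Notation Re := complex.Re.
Local Notation Im := complex.Im.
Variable Om : set E.
Hypothesis mOm : measurable Om.
Implicit Types (f g h : E -> R) (u v w : E -> R[i]).

Definition real_L2 f := measurable_fun Om f /\ (\int[mu]_(x in Om) ((f x) ^+ 2)%:E < +oo)%E.

Lemma real_L2_integrable_sqr f : real_L2 f -> mu.-integrable Om (fun x => ((f x) ^+ 2)%:E).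
Proof.
move=> [mf foo]; apply/integrableP; split.
  by apply/measurable_EFinP; exact: measurable_funX.
by under eq_integral do rewrite /= ger0_norm ?sqr_ge0//.
Qed.

Lemma real_L2_integrableM f g : real_L2 f -> real_L2 g ->
  mu.-integrable Om (fun x => (f x * g x)%:E).
Proof.
move=> Lf Lg; have [mf _] := Lf; have [mg _] := Lg.
have := integrableD mOm (real_L2_integrable_sqr Lf) (real_L2_integrable_sqr Lg).
apply: le_integrable => //; first by apply/measurable_EFinP; exact: measurable_funM.
move=> x _; rewrite /= lee_fin [leRHS]ger0_norm ?addr_ge0 ?sqr_ge0//.
rewrite normrM -[f x ^+ 2]real_normK ?num_real// -[g x ^+ 2]real_normK ?num_real//.
have := sqr_ge0 (`|f x| - `|g x|); rewrite sqrrB.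
have := normr_ge0 (f x); have := normr_ge0 (g x).
set r := `|f x|; set s := `|g x|; rewrite -mulr_natr => s0 r0.
have := mulr_ge0 r0 s0; lra.
Qed.

Lemma real_L2D f g : real_L2 f -> real_L2 g -> real_L2 (fun x => f x + g x).
Proof.
move=> Lf Lg; have [mf _] := Lf; have [mg _] := Lg.
split; first exact: measurable_funD.
have H := integrableD mOm (real_L2_integrable_sqr Lf) (real_L2_integrable_sqr Lg).
have := integrable_lty mOm (integrableZl mOm 2 H); apply: le_lt_trans.
apply: ge0_le_integral => //.
- by move=> x _; rewrite lee_fin sqr_ge0.
- by apply/measurable_EFinP; apply: measurable_funX; exact: measurable_funD.
- exact: (measurable_int _ (integrableZl mOm 2 H)).
- move=> x _; rewrite /= lee_fin; have := sqr_ge0 (f x - g x); lra.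
Qed.

Lemma real_L2Z (r : R) f : real_L2 f -> real_L2 (fun x => r * f x).
Proof.
move=> Lf; have [mf _] := Lf; split; first exact: measurable_funM.
under eq_integral do rewrite exprMn EFinM.
apply: (integrable_lty mOm); apply: integrableZl => //.
exact: real_L2_integrable_sqr.
Qed.

Definition rip f g : R := \int[mu]_(x in Om) (f x * g x).

Lemma ripC f g : rip f g = rip g f.
Proof. by apply: eq_Rintegral => x _; rewrite mulrC. Qed.

Lemma ripDl f g h : real_L2 f -> real_L2 g -> real_L2 h ->
  rip (fun x => f x + g x) h = rip f h + rip g h.
Proof.
move=> Lf Lg Lh; rewrite /rip.
under eq_Rintegral do rewrite mulrDl.
by rewrite RintegralD//; exact: real_L2_integrableM.
Qed.

Lemma ripZl (r : R) f h : real_L2 f -> real_L2 h -> rip (fun x => r * f x) h = r * rip f h.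
Proof.
move=> Lf Lh; rewrite /rip; under eq_Rintegral do rewrite -mulrA.
by rewrite RintegralZl//; exact: real_L2_integrableM.
Qed.

Lemma rip_ge0 f : 0 <= rip f f.
Proof. by apply: Rintegral_ge0 => x _; rewrite -expr2 sqr_ge0. Qed.

Lemma ripE f : real_L2 f -> (\int[mu]_(x in Om) ((f x) ^+ 2)%:E = (rip f f)%:E)%E.
Proof.
move=> Lf; rewrite /rip /Rintegral fineK; last first.
  by apply: integrable_fin_num => //; exact: real_L2_integrableM.
by apply: eq_integral => x _; rewrite expr2.
Qed.

Lemma L2P u : L2 Om u <-> real_L2 (fun x => Re (u x)) /\ real_L2 (fun x => Im (u x)).
Proof.
have E1 : measurable_fun Om (fun x => Re (u x)) -> measurable_fun Om (fun x => Im (u x)) ->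
    (sqnorm2 Om u = \int[mu]_(x in Om) ((Re (u x)) ^+ 2)%:E +
      \int[mu]_(x in Om) ((Im (u x)) ^+ 2)%:E)%E.
  move=> mr mi; rewrite /sqnorm2; under eq_integral do rewrite sqr_modulus EFinD.
  rewrite ge0_integralD//.
  - by move=> x _; rewrite lee_fin sqr_ge0.
  - by apply/measurable_EFinP; exact: measurable_funX.
  - by move=> x _; rewrite lee_fin sqr_ge0.
  - by apply/measurable_EFinP; exact: measurable_funX.
have i0 f : (0 <= \int[mu]_(x in Om) ((f x) ^+ 2)%:E)%E.
  by apply: integral_ge0 => x _; rewrite lee_fin sqr_ge0.
split=> [[mr mi u2]|[[mr ur] [mi ui]]].
  have : (sqnorm2 Om u < +oo)%E by apply: lty_poweRy u2; rewrite invr_neq0.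
  rewrite E1// => H; split; split => //; apply: le_lt_trans H.
    by rewrite leeDl.
  by rewrite leeDr.
split => //; apply: poweR_lty; rewrite E1//; exact: lte_add_pinfty.
Qed.

Lemma L2_Re u : L2 Om u -> real_L2 (fun x => Re (u x)).
Proof. by move=> /L2P[]. Qed.

Lemma L2_Im u : L2 Om u -> real_L2 (fun x => Im (u x)).
Proof. by move=> /L2P[]. Qed.

Lemma real_L2_ext f g : f =1 g -> real_L2 f -> real_L2 g.
Proof. by move=> /funext ->. Qed.

Lemma L2D u v : L2 Om u -> L2 Om v -> L2 Om (fun x => u x + v x).
Proof.
move=> /L2P[ur ui] /L2P[vr vi]; apply/L2P; split.
  by apply: real_L2_ext (real_L2D ur vr) => x; rewrite ReD.
by apply: real_L2_ext (real_L2D ui vi) => x; rewrite ImD.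
Qed.

Lemma L2Z (z : R[i]) u : L2 Om u -> L2 Om (fun x => z * u x).
Proof.
move=> /L2P[ur ui]; apply/L2P; split.
  apply: real_L2_ext (real_L2D (real_L2Z (Re z) ur) (real_L2Z (- Im z) ui)) => x.
  by rewrite ReM mulNr.
apply: real_L2_ext (real_L2D (real_L2Z (Re z) ui) (real_L2Z (Im z) ur)) => x.
by rewrite ImM.
Qed.

Lemma L2N u : L2 Om u -> L2 Om (fun x => - u x).
Proof.
by move=> /(L2Z (- 1)); congr L2; apply/funext => x; rewrite mulN1r.
Qed.

Lemma L2B u v : L2 Om u -> L2 Om v -> L2 Om (fun x => u x - v x).
Proof. by move=> Lu Lv; apply: L2D => //; exact: L2N. Qed.

(* The real inner product of L^2, i.e. the real part of the Hermitian one. *)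
Definition L2_ip u v : R :=
  rip (fun x => Re (u x)) (fun x => Re (v x)) +
  rip (fun x => Im (u x)) (fun x => Im (v x)).
Local Notation ip := L2_ip.

Lemma ipC u v : ip u v = ip v u.
Proof. by rewrite /L2_ip ripC [X in _ + X]ripC. Qed.

Lemma ipDl u v w : L2 Om u -> L2 Om v -> L2 Om w ->
  ip (fun x => u x + v x) w = ip u w + ip v w.
Proof.
move=> /L2P[ur ui] /L2P[vr vi] /L2P[wr wi]; rewrite /L2_ip.
under [X in rip X]eq_fun do rewrite ReD.
under [X in _ + rip X _]eq_fun do rewrite ImD.
by rewrite !ripDl// addrACA.
Qed.

Lemma ipZl (r : R) u w : L2 Om u -> L2 Om w -> ip (fun x => r%:C * u x) w = r * ip u w.
Proof.
move=> /L2P[ur ui] /L2P[wr wi]; rewrite /L2_ip.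
have -> : (fun x => Re (r%:C * u x)) = (fun x => r * Re (u x)).
  by apply/funext => x; rewrite ReM /= mul0r subr0.
have -> : (fun x => Im (r%:C * u x)) = (fun x => r * Im (u x)).
  by apply/funext => x; rewrite ImM /= mul0r addr0.
by rewrite !ripZl// mulrDr.
Qed.

Lemma ipNl u w : L2 Om u -> L2 Om w -> ip (fun x => - u x) w = - ip u w.
Proof.
move=> Lu Lw; rewrite -mulN1r -ipZl//; congr ip; apply/funext => x.
by rewrite (_ : (-1)%:C = -1) ?mulN1r//; apply: complex_eqP; rewrite /= ?oppr0.
Qed.

Lemma ipBl u v w : L2 Om u -> L2 Om v -> L2 Om w ->
  ip (fun x => u x - v x) w = ip u w - ip v w.
Proof.
by move=> Lu Lv Lw; rewrite ipDl ?ipNl//; exact: L2N.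
Qed.

Lemma ipDr u v w : L2 Om u -> L2 Om v -> L2 Om w ->
  ip w (fun x => u x + v x) = ip w u + ip w v.
Proof. by move=> Lu Lv Lw; rewrite ipC ipDl// ![ip _ w]ipC. Qed.

Lemma ipBr u v w : L2 Om u -> L2 Om v -> L2 Om w ->
  ip w (fun x => u x - v x) = ip w u - ip w v.
Proof. by move=> Lu Lv Lw; rewrite ipC ipBl// ![ip _ w]ipC. Qed.

Lemma ipZr (r : R) u w : L2 Om u -> L2 Om w -> ip w (fun x => r%:C * u x) = r * ip w u.
Proof. by move=> Lu Lw; rewrite ipC ipZl// ipC. Qed.

(** Skew-symmetry of multiplication by i for the real inner product: it removes the rotating part of
    the equation from both the energy and the mass balance. *)
Lemma ip_imul u v : L2 Om u -> L2 Om v ->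
  ip u (fun x => 'i * v x) = - ip (fun x => 'i * u x) v.
Proof.
move=> /L2P[ur ui] /L2P[vr vi]; rewrite /L2_ip.
have RE w : (fun x => Re ('i * w x)) = (fun x => -1 * Im (w x)).
  by apply/funext => x; rewrite ReM /= mul0r sub0r mul1r mulN1r.
have IE w : (fun x => Im ('i * w x)) = (fun x => Re (w x)).
  by apply/funext => x; rewrite ImM /= mul0r add0r mul1r.
by rewrite !RE !IE ![rip _ (fun x => -1 * _)]ripC !ripZl//
  [rip (fun x => Im (v x)) _]ripC; ring.
Qed.

Lemma ip_imul_self u : L2 Om u -> ip u (fun x => 'i * u x) = 0.
Proof.
by move=> Lu; have := ip_imul Lu Lu; rewrite [X in _ = - X]ipC; lra.
Qed.

Lemma ip_scale (z : R[i]) u : L2 Om u ->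
  ip (fun x => z * u x) (fun x => z * u x) = modulus z ^+ 2 * ip u u.
Proof.
move=> /L2P[ur ui]; rewrite /L2_ip sqr_modulus.
have -> : (fun x => Re (z * u x)) = (fun x => Re z * Re (u x) + - Im z * Im (u x)).
  by apply/funext => x; rewrite ReM mulNr.
have -> : (fun x => Im (z * u x)) = (fun x => Re z * Im (u x) + Im z * Re (u x)).
  by apply/funext => x; rewrite ImM.
have Lz (r : R) f : real_L2 f -> real_L2 (fun x => r * f x) := @real_L2Z r f.
have L1 := real_L2D (Lz (Re z) _ ur) (Lz (- Im z) _ ui).
have L2 := real_L2D (Lz (Re z) _ ui) (Lz (Im z) _ ur).
rewrite ![rip (fun x => _ + _) (fun x => _ + _)]ripDl; try by [exact: Lz|exact: L1|exact: L2].
rewrite !ripZl//; rewrite ![rip (fun x => Re (u x)) (fun x => _ + _)]ripC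
  ![rip (fun x => Im (u x)) (fun x => _ + _)]ripC.
rewrite !ripDl//; try by [exact: Lz|exact: L1|exact: L2].
rewrite !ripZl//; rewrite [rip (fun x => Im (u x)) (fun x => Re (u x))]ripC; ring.
Qed.

Lemma ip_ge0 u : 0 <= ip u u.
Proof. by rewrite addr_ge0 ?rip_ge0. Qed.

Lemma sqnorm2E u : L2 Om u -> sqnorm2 Om u = (ip u u)%:E.
Proof.
move=> /L2P[ur ui]; rewrite /sqnorm2.
under eq_integral do rewrite sqr_modulus EFinD.
rewrite ge0_integralD//.
- by rewrite !ripE// -EFinD.
- by move=> x _; rewrite lee_fin sqr_ge0.
- by case: (real_L2_integrable_sqr ur) => /integrableP[].
- by move=> x _; rewrite lee_fin sqr_ge0.
- by case: (real_L2_integrable_sqr ui) => /integrableP[].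
Qed.

Definition nrm u : R := Num.sqrt (ip u u).

Lemma nrm_ge0 u : 0 <= nrm u. Proof. exact: sqrtr_ge0. Qed.

Lemma sqr_nrm u : nrm u ^+ 2 = ip u u.
Proof. by rewrite sqr_sqrtr// ip_ge0. Qed.

Lemma L2normE u : L2 Om u -> L2norm Om u = (nrm u)%:E.
Proof.
by move=> Lu; rewrite /L2norm sqnorm2E// poweR_EFin powR12_sqrt// ip_ge0.
Qed.

Lemma ip_sqrD u v : L2 Om u -> L2 Om v ->
  ip (fun x => u x + v x) (fun x => u x + v x) = ip u u + 2 * ip u v + ip v v.
Proof.
move=> Lu Lv; have Luv := L2D Lu Lv.
by rewrite ipDl// !ipDr// [ip v u]ipC; ring.
Qed.

Lemma ip_CauchySchwarz u v : L2 Om u -> L2 Om v -> `|ip u v| <= nrm u * nrm v.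
Proof.
move=> Lu Lv.
have quad (t : R) : 0 <= ip u u + 2 * t * ip u v + t ^+ 2 * ip v v.
  have Ltv := L2Z t%:C Lv.
  have := ip_ge0 (fun x => u x + t%:C * v x); rewrite ip_sqrD//.
  rewrite ipZr// ipZl// ipZr// => H; apply: le_trans H _.
  by rewrite le_eqVlt; apply/orP; left; apply/eqP; ring.
rewrite -sqrtrM ?ip_ge0// -[`|_|]sqrtr_sqr ler_wsqrtr//.
have [v0|v0] := eqVneq (ip v v) 0.
  have [->|uv0] := eqVneq (ip u v) 0; first by rewrite v0 mulr0 expr0n.
  (* Without its quadratic term the form is affine in t, and this t gives it the value -1. *)
  have := quad (- (ip u u + 1) / (2 * ip u v)); rewrite v0 mulr0 addr0.
  have -> : ip u u + 2 * (- (ip u u + 1) / (2 * ip u v)) * ip u v = -1 by field.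
  by lra.
have {v0}v0 : 0 < ip v v by rewrite lt_def v0 ip_ge0.
(* The minimiser of the quadratic. *)
have := quad (- ip u v / ip v v).
have -> : ip u u + 2 * (- ip u v / ip v v) * ip u v + (- ip u v / ip v v) ^+ 2 * ip v v =
  ip u u - ip u v ^+ 2 / ip v v by field; rewrite gt_eqF.
by rewrite subr_ge0 ler_pdivrMr.
Qed.

Lemma nrmD u v : L2 Om u -> L2 Om v -> nrm (fun x => u x + v x) <= nrm u + nrm v.
Proof.
move=> Lu Lv; rewrite -[leRHS]ger0_norm ?addr_ge0 ?nrm_ge0// -sqrtr_sqr.
rewrite ler_wsqrtr// ip_sqrD// sqrrD !sqr_nrm -mulr_natr.
have := ip_CauchySchwarz Lu Lv; have := ler_norm (ip u v); lra.
Qed.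

Lemma nrmN u : L2 Om u -> nrm (fun x => - u x) = nrm u.
Proof.
move=> Lu; have LNu := L2N Lu; congr Num.sqrt.
by rewrite ipNl// ipC ipNl// opprK.
Qed.

Lemma nrmB u v : L2 Om u -> L2 Om v -> nrm (fun x => u x - v x) <= nrm u + nrm v.
Proof.
by move=> Lu Lv; rewrite -(nrmN Lv); apply: nrmD => //; exact: L2N.
Qed.

End L2_space.

Section test_calculus.
Context {R : realType} {N : nat}.
Local Notation E := 'rV[R]_N.
Local Notation mu := (@lebesgue_rV R N).
Local Notation Re := complex.Re.
Local Notation Im := complex.Im.
Local Notation partial i f := ('D_(basis_vec i) f).
Variable Om : set E.
Hypothesis oOm : open Om.
Implicit Types (f g h : E -> R) (u v w : E -> R[i]).

Let mOm : measurable Om. Proof. exact: open_measurable_rV. Qed.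

Lemma Ck_lin k (a b : R) f g : Ck k f -> Ck k g -> Ck k (fun x => a * f x + b * g x).
Proof.
have cl F G : continuous F -> continuous G ->
    continuous (fun x : E => a * F x + b * G x).
  move=> cF cG x; apply: (@continuousD _ _ _ (fun x : E => a * F x) (fun x : E => b * G x)).
    by apply: (@continuousM _ _ (cst a) F); [exact: cst_continuous|exact: cF].
  by apply: (@continuousM _ _ (cst b) G); [exact: cst_continuous|exact: cG].
elim: k f g => [|k IH] f g [cf Cf] [cg Cg]; first by split => //; exact: cl.
split; first exact: cl.
move=> i; have [df dCf] := Cf i; have [dg dCg] := Cg i.
have dfg x : is_derive x (basis_vec i) (fun x => a * f x + b * g x)
    (a * partial i f x + b * partial i g x).
  have Df := derivableP (df x); have Dg := derivableP (dg x).
  exact: (is_deriveD (is_deriveZ a Df) (is_deriveZ b Dg)).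
split; first by move=> x; case: (dfg x).
rewrite (_ : partial i _ = fun x => a * partial i f x + b * partial i g x).
  exact: IH.
by apply/funext => x; case: (dfg x).
Qed.

Lemma real_test_function_lin (a b : R) f g :
  real_test_function Om f -> real_test_function Om g ->
  real_test_function Om (fun x => a * f x + b * g x).
Proof.
move=> tf tg; have [Mf Mf0 fM] := real_test_function_supp_cube tf.
have [Mg Mg0 gM] := real_test_function_supp_cube tg.
have [Cf cf fOm] := tf; have [Cg cg gOm] := tg.
apply: (@real_test_functionP _ _ _ _
  (closure [set x | f x != 0] `|` closure [set x | g x != 0])).
- by apply: closedU; exact: closed_closure.
- by move=> x [/fOm|/gOm].
- exists (Num.max Mf Mg) => x; rewrite -closureU => xfg.
  apply: (closed_cube (M := Num.max Mf Mg)); apply: closureS xfg => y.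
  case=> [/fM|/gM] yM i; rewrite le_max yM ?orbT//.
- by move=> k; exact: Ck_lin.
- move=> x; have [fx|fx _] := eqVneq (f x) 0; last by left; exact: subset_closure.
  have [gx|gx _] := eqVneq (g x) 0; last by right; exact: subset_closure.
  by rewrite fx gx !mulr0 addr0 eqxx.
Qed.

Lemma partial_support f (i : 'I_N) :
  [set x | partial i f x != 0] `<=` closure [set x | f x != 0].
Proof.
move=> x /=; apply: contra_neqP => xF.
rewrite (@near_eq_derive _ _ _ _ (cst 0)); first by rewrite derive_cst.
have oF : open (~` closure [set x | f x != 0]).
  by apply: closed_openC; exact: closed_closure.
have := open_nbhs_nbhs (conj oF xF); apply: filterS => y yF.
by apply/eqP; apply: contra_notT yF => fy; exact: subset_closure.
Qed.

Lemma real_test_function_partial f (i : 'I_N) :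
  real_test_function Om f -> real_test_function Om (partial i f).
Proof.
move=> tf; have [M M0 fM] := real_test_function_supp_cube tf; have [Cf cf fOm] := tf.
apply: (@real_test_functionP _ _ _ _ (closure [set x | f x != 0])) => //.
- exact: closed_closure.
- exists M => x xF; apply: (closed_cube (M := M)); exact: closureS xF.
- by move=> k; have [_ /(_ i)[]] := Cf k.+1.
- exact: partial_support.
Qed.

Lemma real_test_function_eq0 f x : real_test_function Om f -> ~ Om x -> f x = 0.
Proof.
move=> [_ _ fOm]; apply: contra_notP => /eqP fx; apply: fOm.
exact: subset_closure.
Qed.

Lemma real_test_function_Ck k f : real_test_function Om f -> Ck k f.
Proof. by case=> /(_ k). Qed.

Lemma real_test_function_cont f : real_test_function Om f -> continuous f.
Proof. by move=> /(real_test_function_Ck 0)[]. Qed.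

Lemma integral_sqr_test f : real_test_function Om f ->
  (\int[mu]_(x in Om) ((f x) ^+ 2)%:E = \int[mu]_x ((f x) ^+ 2)%:E)%E.
Proof.
move=> tf; rewrite integral_mkcond; apply: eq_integral => x _.
rewrite patchE; case: ifPn => //; rewrite notin_setE => xOm.
by rewrite (real_test_function_eq0 tf xOm) expr0n.
Qed.

Lemma real_L2_test f : real_test_function Om f -> real_L2 Om f.
Proof.
move=> tf; have cf := real_test_function_cont tf.
have [M M0 fM] := real_test_function_supp_cube tf.
split; first by apply: measurable_funTS; exact: continuous_measurable_rV.
rewrite integral_sqr_test//; apply: integrable_lty => //.
apply: (@integrable_supp_cube _ _ (fun x => f x ^+ 2) M) => //.
  move=> x; apply: (@continuous_comp _ _ _ f (fun r : R => r ^+ 2)).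
    exact: cf.
  exact: exprn_continuous.
by move=> x; rewrite expf_eq0 /=; exact: fM.
Qed.

(** The product rule for f g, whose partial derivative has integral 0 by [integral_partial_eq0]. *)
Lemma rip_partial f g (i : 'I_N) : real_test_function Om f -> real_test_function Om g ->
  rip Om f (partial i g) = - rip Om (partial i f) g.
Proof.
move=> tf tg.
have [M M0 fM] := real_test_function_supp_cube tf.
have [cf /(_ i)[df [cdf _]]] := real_test_function_Ck 1 tf.
have [cg /(_ i)[dg [cdg _]]] := real_test_function_Ck 1 tg.
have tdf := real_test_function_partial i tf; have tdg := real_test_function_partial i tg.
have dM (j : 'I_N) x : is_derive x (basis_vec j) (fun x => f x * g x)
    (f x * partial j g x + g x * partial j f x).
  have [_ /(_ j)[dfj _]] := real_test_function_Ck 1 tf.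
  have [_ /(_ j)[dgj _]] := real_test_function_Ck 1 tg.
  exact: (is_deriveM (derivableP (dfj x)) (derivableP (dgj x))).
have C1 : Ck 1 (fun x => f x * g x).
  split; first by move=> x; apply: (@continuousM _ _ f g); [exact: cf|exact: cg].
  move=> j; split; first by move=> x; case: (dM j x).
  have -> : partial j (fun x => f x * g x) =
      fun x => f x * partial j g x + g x * partial j f x.
    by apply/funext => x; case: (dM j x).
  have [_ /(_ j)[_ [cdfj _]]] := real_test_function_Ck 1 tf.
  have [_ /(_ j)[_ [cdgj _]]] := real_test_function_Ck 1 tg.
  split => // x; apply: (@continuousD _ _ _ (fun x => f x * partial j g x)).
    by apply: (@continuousM _ _ f); [exact: cf|exact: cdgj].
  by apply: (@continuousM _ _ g); [exact: cg|exact: cdfj].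
have fgM : supp_cube M (fun x => f x * g x).
  by move=> x; rewrite mulf_eq0 negb_or => /andP[/fM].
have := integral_partial_eq0 i C1 M0 fgM.
have -> : (\int[mu]_x (partial i (fun x => f x * g x) x)%:E =
    \int[mu]_(x in Om) (f x * partial i g x + partial i f x * g x)%:E)%E.
  rewrite [RHS]integral_mkcond; apply: eq_integral => x _; rewrite patchE.
  have [_ ->] := dM i x; rewrite [g x * _]mulrC; case: ifPn => //.
  rewrite notin_setE => xOm.
  by rewrite (real_test_function_eq0 tf xOm) (real_test_function_eq0 tg xOm) mul0r mulr0 addr0.
move=> /(congr1 fine) /= H; apply/eqP; rewrite -addr_eq0; apply/eqP.
rewrite -[RHS]H /rip -RintegralD//.
  by apply: real_L2_integrableM => //; exact: real_L2_test.
by apply: real_L2_integrableM => //; exact: real_L2_test.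
Qed.

End test_calculus.

Section weak_derivatives.
Context {R : realType} {N : nat}.
Local Notation E := 'rV[R]_N.
Local Notation mu := (@lebesgue_rV R N).
Local Notation Re := complex.Re.
Local Notation Im := complex.Im.
Local Notation partial i f := ('D_(basis_vec i) f).
Variable Om : set E.
Hypothesis oOm : open Om.
Implicit Types (f : E -> R) (u v w g h : E -> R[i]).

Let mOm : measurable Om. Proof. exact: open_measurable_rV. Qed.
Local Notation ip := (L2_ip Om).
Local Notation nrm := (nrm Om).

Lemma rip_ae (f g h : E -> R) : measurable_fun Om f -> measurable_fun Om g -> measurable_fun Om h ->
  {ae mu, forall x, Om x -> f x = g x} -> rip Om f h = rip Om g h.
Proof.
move=> mf mg mh fg; congr fine; apply: ae_eq_integral => //.
- by apply/measurable_EFinP; exact: measurable_funM.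
- by apply/measurable_EFinP; exact: measurable_funM.
- by apply: filterS fg => x fg Omx; rewrite fg.
Qed.

Lemma ip_ael u v w : L2 Om u -> L2 Om v -> L2 Om w -> eq_ae Om u v -> ip u w = ip v w.
Proof.
move=> [mur mui _] [mvr mvi _] [mwr mwi _] uv; congr (_ + _); apply: rip_ae => //.
  by apply: filterS uv => x uv Omx; rewrite uv.
by apply: filterS uv => x uv Omx; rewrite uv.
Qed.

Lemma ip_aer u v w : L2 Om u -> L2 Om v -> L2 Om w -> eq_ae Om u v -> ip w u = ip w v.
Proof.
by move=> Lu Lv Lw uv; rewrite /L2_ip [LHS]ipC [RHS]ipC; exact: ip_ael.
Qed.

Lemma is_weak_partialP i u g : is_weak_partial Om i u g <->
  L2 Om g /\ forall f, real_test_function Om f ->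
    rip Om (fun x => Re (u x)) (partial i f) = - rip Om (fun x => Re (g x)) f /\
    rip Om (fun x => Im (u x)) (partial i f) = - rip Om (fun x => Im (g x)) f.
Proof.
have cE v f : cintegral Om (fun x => v x * (f x)%:C) =
    rip Om (fun x => Re (v x)) f +i* rip Om (fun x => Im (v x)) f.
  rewrite /cintegral; congr (_ +i* _); apply: eq_Rintegral => x _.
    by rewrite ReM /= mulr0 subr0.
  by rewrite ImM /= mulr0 add0r.
split=> -[Lg H]; split => // f tf; first by have := H f tf; rewrite !cE => -[].
by rewrite !cE; have [-> ->] := H f tf.
Qed.

Lemma is_weak_partial_L2 i u g : is_weak_partial Om i u g -> L2 Om g.
Proof. by case. Qed.

(** The real and imaginary parts of the difference are orthogonal to all test functions. As
    [weak_partial] is an arbitrary choice, every computation rule for it goes through this lemma and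
    holds almost everywhere only. *)
Lemma is_weak_partial_unique i u g h : is_weak_partial Om i u g ->
  is_weak_partial Om i u h -> eq_ae Om g h.
Proof.
move=> /is_weak_partialP[Lg ug] /is_weak_partialP[Lh uh].
have eq0 (F G : E -> R) : real_L2 Om F -> real_L2 Om G ->
    (forall f, real_test_function Om f -> rip Om F f = rip Om G f) ->
    {ae mu, forall x, Om x -> F x = G x}.
  move=> LF LG FG.
  have LNG : real_L2 Om (fun x => -1 * G x) by exact: real_L2Z.
  have [mD Doo] := real_L2D mOm LF LNG.
  have := @test_function_orthogonal_eq0 _ _ Om (fun x => F x + -1 * G x) oOm mD Doo.
  have H f : real_test_function Om f -> \int[mu]_(x in Om) ((F x + -1 * G x) * f x) = 0.
    move=> tf; have Lf := real_L2_test tf.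
    have := ripDl mOm LF LNG Lf; rewrite /rip => ->.
    have := ripZl mOm (-1) LG Lf; rewrite /rip => ->.
    by have := FG f tf; rewrite /rip => ->; rewrite mulN1r subrr.
  by move=> /(_ H); apply: filterS => x K /K /eqP; rewrite mulN1r subr_eq0 => /eqP.
have er : {ae mu, forall x, Om x -> Re (g x) = Re (h x)}.
  apply: eq0; [exact: L2_Re|exact: L2_Re|] => f tf; apply: oppr_inj.
  by have [<- _] := ug f tf; have [<- _] := uh f tf.
have ei : {ae mu, forall x, Om x -> Im (g x) = Im (h x)}.
  apply: eq0; [exact: L2_Im|exact: L2_Im|] => f tf; apply: oppr_inj.
  by have [_ <-] := ug f tf; have [_ <-] := uh f tf.
by apply: filterS2 er ei => x er ei Omx; apply: complex_eqP; [exact: er|exact: ei].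
Qed.

Lemma is_weak_partialD i u v g h : L2 Om u -> L2 Om v ->
  is_weak_partial Om i u g -> is_weak_partial Om i v h ->
  is_weak_partial Om i (fun x => u x + v x) (fun x => g x + h x).
Proof.
move=> Lu Lv /is_weak_partialP[Lg ug] /is_weak_partialP[Lh vh].
apply/is_weak_partialP; split; first exact: L2D.
move=> f tf; have Lf := real_L2_test tf.
have Ldf := real_L2_test (real_test_function_partial i tf).
have [u1 u2] := ug f tf; have [v1 v2] := vh f tf.
split.
  have -> : (fun x => Re (u x + v x)) = (fun x => Re (u x) + Re (v x)).
    by apply/funext => x; rewrite ReD.
  have -> : (fun x => Re (g x + h x)) = (fun x => Re (g x) + Re (h x)).
    by apply/funext => x; rewrite ReD.
  rewrite !ripDl//; try exact: L2_Re.
  by rewrite u1 v1 opprD.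
have -> : (fun x => Im (u x + v x)) = (fun x => Im (u x) + Im (v x)).
  by apply/funext => x; rewrite ImD.
have -> : (fun x => Im (g x + h x)) = (fun x => Im (g x) + Im (h x)).
  by apply/funext => x; rewrite ImD.
rewrite !ripDl//; try exact: L2_Im.
by rewrite u2 v2 opprD.
Qed.

Lemma is_weak_partialZ i (z : R[i]) u g : L2 Om u ->
  is_weak_partial Om i u g -> is_weak_partial Om i (fun x => z * u x) (fun x => z * g x).
Proof.
move=> Lu /is_weak_partialP[Lg ug].
apply/is_weak_partialP; split; first exact: L2Z.
move=> f tf; have Lf := real_L2_test tf.
have Ldf := real_L2_test (real_test_function_partial i tf).
have [u1 u2] := ug f tf.
have RE (w : E -> R[i]) F : L2 Om w -> real_L2 Om F ->
    rip Om (fun x => Re (z * w x)) F =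
    Re z * rip Om (fun x => Re (w x)) F - Im z * rip Om (fun x => Im (w x)) F.
  move=> Lw LF; have Lr := L2_Re mOm Lw; have Li := L2_Im mOm Lw.
  have -> : (fun x => Re (z * w x)) = (fun x => Re z * Re (w x) + - Im z * Im (w x)).
    by apply/funext => x; rewrite ReM mulNr.
  by rewrite ripDl ?ripZl ?mulNr//; exact: real_L2Z.
have IE (w : E -> R[i]) F : L2 Om w -> real_L2 Om F ->
    rip Om (fun x => Im (z * w x)) F =
    Re z * rip Om (fun x => Im (w x)) F + Im z * rip Om (fun x => Re (w x)) F.
  move=> Lw LF; have Lr := L2_Re mOm Lw; have Li := L2_Im mOm Lw.
  have -> : (fun x => Im (z * w x)) = (fun x => Re z * Im (w x) + Im z * Re (w x)).
    by apply/funext => x; rewrite ImM.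
  by rewrite ripDl ?ripZl//; exact: real_L2Z.
by rewrite !RE ?IE// u1 u2; split; ring.
Qed.

Definition test_partial (i : 'I_N) u : E -> R[i] :=
  fun x => partial i (fun x => Re (u x)) x +i* partial i (fun x => Im (u x)) x.

Lemma test_function_L2 u : test_function Om u -> L2 Om u.
Proof. by move=> [tr ti]; apply/(L2P mOm); split; exact: real_L2_test. Qed.

Lemma test_function_partial i u : test_function Om u -> test_function Om (test_partial i u).
Proof. by move=> [tr ti]; split; exact: real_test_function_partial. Qed.

Lemma is_weak_partial_test i u : test_function Om u ->
  is_weak_partial Om i u (test_partial i u).
Proof.
move=> tu; apply/is_weak_partialP; split.
  by apply: test_function_L2; exact: test_function_partial.
move=> f tf; have [tr ti] := tu; split; exact: rip_partial.
Qed.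

Lemma test_functionB u v : test_function Om u -> test_function Om v ->
  test_function Om (fun x => u x - v x).
Proof.
move=> [ur ui] [vr vi]; split.
  have -> : (fun x => Re (u x - v x)) = (fun x => 1 * Re (u x) + -1 * Re (v x)).
    by apply/funext => x; rewrite ReD ReN mul1r mulN1r.
  exact: real_test_function_lin.
have -> : (fun x => Im (u x - v x)) = (fun x => 1 * Im (u x) + -1 * Im (v x)).
  by apply/funext => x; rewrite ImD ImN mul1r mulN1r.
exact: real_test_function_lin.
Qed.

Lemma test_functionZ (z : R[i]) u : test_function Om u ->
  test_function Om (fun x => z * u x).
Proof.
move=> [ur ui]; split.
  have -> : (fun x => Re (z * u x)) = (fun x => Re z * Re (u x) + - Im z * Im (u x)).
    by apply/funext => x; rewrite ReM mulNr.
  exact: real_test_function_lin.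
have -> : (fun x => Im (z * u x)) = (fun x => Re z * Im (u x) + Im z * Re (u x)).
  by apply/funext => x; rewrite ImM.
exact: real_test_function_lin.
Qed.

Local Notation wp := (weak_partial Om).

Lemma weak_partialP i u : H1 Om u -> is_weak_partial Om i u (wp i u).
Proof. by move=> [_ /(_ i)[g ug]]; exact: (xgetPex (fun=> 0) (ex_intro _ g ug)). Qed.

Lemma H1_L2 u : H1 Om u -> L2 Om u. Proof. by case. Qed.

Lemma weak_partial_L2 i u : H1 Om u -> L2 Om (wp i u).
Proof. by move=> /(weak_partialP i)/is_weak_partial_L2. Qed.

Lemma H1_test u : test_function Om u -> H1 Om u.
Proof.
move=> tu; split; first exact: test_function_L2.
by move=> i; exists (test_partial i u); exact: is_weak_partial_test.
Qed.

Lemma H1D u v : H1 Om u -> H1 Om v -> H1 Om (fun x => u x + v x).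
Proof.
move=> Hu Hv; split; first by apply: L2D => //; exact: H1_L2.
move=> i; exists (fun x => wp i u x + wp i v x).
by apply: is_weak_partialD; [exact: H1_L2|exact: H1_L2|exact: weak_partialP|exact: weak_partialP].
Qed.

Lemma H1Z (z : R[i]) u : H1 Om u -> H1 Om (fun x => z * u x).
Proof.
move=> Hu; split; first by apply: L2Z => //; exact: H1_L2.
move=> i; exists (fun x => z * wp i u x).
by apply: is_weak_partialZ; [exact: H1_L2|exact: weak_partialP].
Qed.

Lemma fun_subE u v : (fun x => u x - v x) = (fun x => u x + (-1) * v x).
Proof. by apply/funext => x; rewrite mulN1r. Qed.

Lemma H1B u v : H1 Om u -> H1 Om v -> H1 Om (fun x => u x - v x).
Proof. by move=> Hu Hv; rewrite fun_subE; apply: H1D => //; exact: H1Z. Qed.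

Lemma weak_partialZ i (z : R[i]) u : H1 Om u ->
  eq_ae Om (wp i (fun x => z * u x)) (fun x => z * wp i u x).
Proof.
move=> Hu; apply: (is_weak_partial_unique (weak_partialP i (H1Z z Hu))).
by apply: is_weak_partialZ; [exact: H1_L2|exact: weak_partialP].
Qed.

Lemma weak_partialB i u v : H1 Om u -> H1 Om v ->
  eq_ae Om (wp i (fun x => u x - v x)) (fun x => wp i u x - wp i v x).
Proof.
move=> Hu Hv; apply: (is_weak_partial_unique (weak_partialP i (H1B Hu Hv))).
rewrite !fun_subE; apply: is_weak_partialD; [exact: H1_L2| |exact: weak_partialP|].
  by apply: L2Z => //; exact: H1_L2.
by apply: is_weak_partialZ; [exact: H1_L2|exact: weak_partialP].
Qed.

Lemma weak_partial_test i u : test_function Om u ->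
  eq_ae Om (wp i u) (test_partial i u).
Proof.
move=> tu; apply: (is_weak_partial_unique (weak_partialP i (H1_test tu))).
exact: is_weak_partial_test.
Qed.

Definition dirichlet_form u v : R := \sum_(i < N) ip (wp i u) (wp i v).
Local Notation dir := dirichlet_form.

Lemma dirC u v : dir u v = dir v u.
Proof. by apply: eq_bigr => i _; exact: ipC. Qed.

Lemma dir_ge0 u : 0 <= dir u u.
Proof. by apply: sumr_ge0 => i _; exact: ip_ge0. Qed.

Lemma dirBr u v w : H1 Om u -> H1 Om v -> H1 Om w ->
  dir w (fun x => u x - v x) = dir w u - dir w v.
Proof.
move=> Hu Hv Hw; rewrite /dir -sumrB; apply: eq_bigr => i _.
have Lu := weak_partial_L2 i Hu; have Lv := weak_partial_L2 i Hv.
rewrite -(ipBr mOm Lu Lv (weak_partial_L2 i Hw)).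
apply: ip_aer; [exact: (weak_partial_L2 i (H1B Hu Hv))|exact: L2B|exact: weak_partial_L2|].
exact: weak_partialB.
Qed.

Lemma dir_sqrB u v : H1 Om u -> H1 Om v ->
  dir (fun x => u x - v x) (fun x => u x - v x) = dir u u - 2 * dir u v + dir v v.
Proof.
move=> Hu Hv; have Huv := H1B Hu Hv.
rewrite (dirBr Hu Hv Huv) (dirC _ u) (dirC _ v) (dirBr Hu Hv Hu) (dirBr Hu Hv Hv).
rewrite (dirC v u).
by move: (dir u u) (dir u v) (dir v v) => A B C; ring.
Qed.

Lemma dir_imul u : H1 Om u -> dir u (fun x => 'i * u x) = 0.
Proof.
move=> Hu; apply: big1 => i _; have Lu := weak_partial_L2 i Hu.
rewrite (ip_aer (weak_partial_L2 i (H1Z 'i Hu)) (L2Z mOm 'i Lu) Lu (weak_partialZ i 'i Hu)).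
exact: (ip_imul_self mOm Lu).
Qed.

Lemma dirZ (z : R[i]) u : H1 Om u ->
  dir (fun x => z * u x) (fun x => z * u x) = modulus z ^+ 2 * dir u u.
Proof.
move=> Hu; rewrite /dir mulr_sumr; apply: eq_bigr => i _.
have Lu := weak_partial_L2 i Hu; have Lzu := L2Z mOm z Lu.
have Lwz := weak_partial_L2 i (H1Z z Hu); have wz := @weak_partialZ i z u Hu.
rewrite (ip_ael Lwz Lzu Lwz wz) (ip_aer Lwz Lzu Lzu wz).
exact: ip_scale.
Qed.

End weak_derivatives.

Lemma sqrt_le_sqr (R : realType) (x e : R) : 0 <= e -> x <= e ^+ 2 -> Num.sqrt x <= e.
Proof.
by move=> e0 xe; rewrite -[e]ger0_norm// -sqrtr_sqr ler_wsqrtr.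
Qed.

(** * H^1_0 and Green's formula *)

Section H10_space.
Context {R : realType} {N : nat}.
Local Notation E := 'rV[R]_N.
Local Notation mu := (@lebesgue_rV R N).
Local Notation Re := complex.Re.
Local Notation Im := complex.Im.
Local Notation partial i f := ('D_(basis_vec i) f).
Variable Om : set E.
Hypothesis oOm : open Om.
Implicit Types (f : E -> R) (u v w z : E -> R[i]).

Let mOm : measurable Om. Proof. exact: open_measurable_rV. Qed.
Local Notation ip := (L2_ip Om).
Local Notation nrm := (nrm Om).
Local Notation dir := (dirichlet_form Om).
Local Notation wp := (weak_partial Om).

Definition sqH1 u : R := ip u u + dir u u.

Lemma sqH1_ge0 u : 0 <= sqH1 u.
Proof. by rewrite addr_ge0 ?ip_ge0 ?dir_ge0. Qed.

Lemma ip_le_sqH1 u : ip u u <= sqH1 u.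
Proof. by rewrite lerDl dir_ge0. Qed.

Lemma dir_le_sqH1 u : dir u u <= sqH1 u.
Proof. by rewrite lerDr ip_ge0. Qed.

Lemma wp_le_sqH1 i u : ip (wp i u) (wp i u) <= sqH1 u.
Proof.
apply: le_trans (dir_le_sqH1 u); rewrite /dirichlet_form (bigD1 i)//= lerDl.
by apply: sumr_ge0 => j _; exact: ip_ge0.
Qed.

Lemma H1normE u : H1 Om u -> H1norm Om u = (Num.sqrt (sqH1 u))%:E.
Proof.
move=> Hu; rewrite /H1norm (sqnorm2E mOm (H1_L2 Hu)).
under eq_bigr do rewrite (sqnorm2E mOm (weak_partial_L2 _ Hu)).
by rewrite sumEFin -EFinD poweR_EFin powR12_sqrt// sqH1_ge0.
Qed.

Lemma H1norm_lt u (e : R) : H1 Om u -> 0 < e ->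
  (H1norm Om u < e%:E)%E = (sqH1 u < e ^+ 2).
Proof.
move=> Hu e0; rewrite H1normE// lte_fin -[e in LHS]ger0_norm ?(ltW e0)//.
by rewrite -sqrtr_sqr ltr_sqrt// exprn_gt0.
Qed.

Lemma H10_H1 u : H10 Om u -> H1 Om u. Proof. by case. Qed.

Lemma H10_approx u (e : R) : H10 Om u -> 0 < e ->
  exists2 phi, test_function Om phi & sqH1 (fun x => u x - phi x) < e ^+ 2.
Proof.
move=> [Hu ua] e0; have [phi tphi uphi] := ua e e0; exists phi => //.
by rewrite -H1norm_lt//; apply: H1B => //; exact: H1_test.
Qed.

Lemma sqH1Z (c : R[i]) u : H1 Om u -> sqH1 (fun x => c * u x) = modulus c ^+ 2 * sqH1 u.
Proof.
by move=> Hu; rewrite /sqH1 (dirZ oOm c Hu) (ip_scale mOm c (H1_L2 Hu)) -mulrDr.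
Qed.

Lemma H10Z (c : R[i]) u : H10 Om u -> H10 Om (fun x => c * u x).
Proof.
move=> Hu; have H1u := H10_H1 Hu; split; first exact: H1Z.
move=> e e0; have c0 : 0 < modulus c + 1 by rewrite ltr_wpDl ?modulus_ge0.
have [phi tphi uphi] := H10_approx Hu (divr_gt0 e0 c0).
exists (fun x => c * phi x); first exact: test_functionZ.
have Hphi := H1_test oOm tphi; have HB := H1B oOm H1u Hphi.
have -> : ((fun x => c * u x) \- (fun x => c * phi x)) = (fun x => c * (u x - phi x)).
  by apply/funext => x; rewrite /= mulrBr.
rewrite H1norm_lt//; last exact: H1Z.
rewrite sqH1Z//; apply: (@le_lt_trans _ _ ((modulus c + 1) ^+ 2 * sqH1 (fun x => u x - phi x))).
  rewrite ler_wpM2r ?sqH1_ge0// lerXn2r ?nnegrE ?modulus_ge0 ?(ltW c0)//.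
  by rewrite lerDl.
by move: uphi; rewrite expr_div_n ltr_pdivlMr ?exprn_gt0// mulrC.
Qed.

Lemma L2_sum (I : Type) (r : seq I) (F : I -> E -> R[i]) :
  (forall i, L2 Om (F i)) -> L2 Om (fun x => \sum_(i <- r) F i x).
Proof.
move=> LF; elim: r => [|i r IH].
  under eq_fun do rewrite big_nil.
  apply/(L2P mOm); split; apply: (real_L2_test (Om := Om));
    apply: (@real_test_functionP _ _ _ _ set0) => //; try exact: closed0.
  - by exists 0.
  - by move=> k; apply: (Ck_flat_expr k (flat_expr_cst 0)).
  - by move=> x; rewrite eqxx.
  - by exists 0.
  - by move=> k; apply: (Ck_flat_expr k (flat_expr_cst 0)).
  - by move=> x; rewrite eqxx.
by under eq_fun do rewrite big_cons; exact: L2D.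
Qed.

Lemma weak_laplacian_L2 u : H2 Om u -> L2 Om (weak_laplacian Om u).
Proof. by move=> [_ H2u]; apply: L2_sum => i; exact: weak_partial_L2. Qed.

Lemma ip_suml (I : Type) (r : seq I) (F : I -> E -> R[i]) w :
  (forall i, L2 Om (F i)) -> L2 Om w ->
  ip (fun x => \sum_(i <- r) F i x) w = \sum_(i <- r) ip (F i) w.
Proof.
move=> LF Lw; elim: r => [|i r IH].
  under [in LHS]eq_fun do rewrite big_nil.
  rewrite big_nil /L2_ip /rip.
  by under eq_Rintegral do rewrite mul0r; under [X in _ + X]eq_Rintegral do rewrite mul0r;
    rewrite /Rintegral integral0 addr0.
under [in LHS]eq_fun do rewrite big_cons.
by rewrite (ipDl mOm (LF i) (L2_sum r LF) Lw) IH big_cons.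
Qed.

Lemma green_test u phi : H2 Om u -> test_function Om phi ->
  ip (weak_laplacian Om u) phi = - dir u phi.
Proof.
move=> [Hu H2u] tphi; have [tr ti] := tphi.
have Lw i : L2 Om (wp i (wp i u)) by exact: weak_partial_L2.
have Lphi := test_function_L2 oOm tphi.
rewrite /weak_laplacian (ip_suml _ Lw Lphi) -sumrN; apply: eq_bigr => i _.
have Ltp := test_function_L2 oOm (test_function_partial i tphi).
rewrite (ip_aer oOm (weak_partial_L2 i (H1_test oOm tphi)) Ltp (weak_partial_L2 i Hu)
  (weak_partial_test oOm i tphi)).
have /is_weak_partialP[_ H] := weak_partialP i (H2u i).
have [Hr _] := H _ tr; have [_ Hi] := H _ ti.
by rewrite /L2_ip /test_partial /= Hr Hi -opprD opprK.
Qed.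

Lemma dir_le u v : H1 Om u -> H1 Om v ->
  `|dir u v| <= (\sum_(i < N) nrm (wp i u)) * Num.sqrt (sqH1 v).
Proof.
move=> Hu Hv; rewrite mulr_suml; apply: le_trans (ler_norm_sum _ _ _) _.
apply: ler_sum => i _.
apply: le_trans (ip_CauchySchwarz mOm (weak_partial_L2 i Hu) (weak_partial_L2 i Hv)) _.
by rewrite ler_wpM2l ?nrm_ge0// ler_wsqrtr// wp_le_sqH1.
Qed.

(** The boundary condition enters through density alone: the identity holds for test functions by
    the definition of weak derivatives, and both sides are continuous in [z] for the H^1 norm, with
    the constant [K] below. *)
Lemma green u z : H2 Om u -> H10 Om z -> ip (weak_laplacian Om u) z = - dir u z.
Proof.
move=> H2u Hz; have Hu := H2u.1; have H1z := H10_H1 Hz; have LD := weak_laplacian_L2 H2u.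
apply/eqP; rewrite -addr_eq0 -normr_le0; apply/ler_addgt0Pl => /= e e0; rewrite addr0.
pose K := nrm (weak_laplacian Om u) + \sum_(i < N) nrm (wp i u).
have K0 : 0 <= K by rewrite addr_ge0 ?nrm_ge0//; apply: sumr_ge0 => i _; exact: nrm_ge0.
have K1 : 0 < K + 1 by rewrite ltr_wpDl.
have [phi tphi zphi] := H10_approx Hz (divr_gt0 e0 K1).
have H1phi := H1_test oOm tphi; have HB := H1B oOm H1z H1phi.
have g := green_test H2u tphi.
set d := fun x => z x - phi x.
have E1 : ip (weak_laplacian Om u) z + dir u z = ip (weak_laplacian Om u) d + dir u d.
  rewrite (ipBr mOm (H1_L2 H1z) (H1_L2 H1phi) LD) (dirBr oOm H1z H1phi Hu) g.
  by move: (dir u phi) (dir u z) (ip _ z) => A B C; ring.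
have dle : Num.sqrt (sqH1 d) <= e / (K + 1).
  by apply: sqrt_le_sqr (ltW zphi); exact: divr_ge0 (ltW e0) (ltW K1).
rewrite E1; apply: le_trans (ler_normD _ _) _.
apply: (@le_trans _ _ (K * Num.sqrt (sqH1 d))).
  rewrite /K mulrDl; apply: lerD; last exact: (dir_le Hu HB).
  apply: le_trans (ip_CauchySchwarz mOm LD (H1_L2 HB)) _.
  by apply: ler_wpM2l; [exact: nrm_ge0|apply: ler_wsqrtr; exact: ip_le_sqH1].
apply: le_trans (ler_wpM2l K0 dle) _.
move: K K0 K1 {dle zphi} => {}K K0 K1; clear -e0 K0 K1.
by rewrite mulrA ler_pdivrMr// mulrDr mulr1 mulrC lerDl ltW.
Qed.

End H10_space.

(** * Sobolev embedding and the nonlinearity *)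

Section modulus_theory.
Context {R : realType}.
Implicit Types z w : R[i].
Local Notation Re := complex.Re.
Local Notation Im := complex.Im.

Lemma modulusD z w : modulus (z + w) <= modulus z + modulus w.
Proof. exact: le_normcD. Qed.

Lemma modulusM z w : modulus (z * w) = modulus z * modulus w.
Proof. exact: Normc.normcM. Qed.

Lemma modulusN z : modulus (- z) = modulus z.
Proof. exact: normcN. Qed.

Lemma modulus_le_ReIm z : modulus z <= `|Re z| + `|Im z|.
Proof.
rewrite -ler_sqr ?nnegrE ?modulus_ge0 ?addr_ge0// sqr_modulus sqrrD.
rewrite !real_normK ?num_real// -addrA lerD2l lerDr.
by rewrite mulrn_wge0// mulr_ge0.
Qed.

Lemma powRD_le (x y p : R) : 0 <= x -> 0 <= y -> 0 <= p ->
  (x + y) `^ p <= 2 `^ p * (x `^ p + y `^ p).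
Proof.
move=> x0 y0 p0.
have [xy|/ltW yx] := leP x y.
  apply: (@le_trans _ _ ((2 * y) `^ p)).
    by apply: ge0_ler_powR => //; rewrite ?nnegrE ?addr_ge0 ?mulr_ge0// mulr_natl mulr2n lerD2r.
  by rewrite powRM// ler_wpM2l ?powR_ge0// lerDr powR_ge0.
apply: (@le_trans _ _ ((2 * x) `^ p)).
  by apply: ge0_ler_powR => //; rewrite ?nnegrE ?addr_ge0 ?mulr_ge0// mulr_natl mulr2n lerD2l.
by rewrite powRM// ler_wpM2l ?powR_ge0// lerDl powR_ge0.
Qed.

Lemma modulus_powR_le z (p : R) : 0 <= p ->
  modulus z `^ p <= 2 `^ p * (`|Re z| `^ p + `|Im z| `^ p).
Proof.
move=> p0; apply: le_trans (powRD_le (normr_ge0 _) (normr_ge0 _) p0).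
by apply: ge0_ler_powR => //; rewrite ?nnegrE ?modulus_ge0 ?addr_ge0// modulus_le_ReIm.
Qed.

(* Truncating at height n trades |z - w|^p for n^(p - 2) |z - w|^2. *)
Lemma truncated_powR_le z w (n p : R) : 0 < n -> 2 <= p ->
  Num.min (modulus z) n `^ p <=
  2 `^ p * (modulus w `^ p + n `^ (p - 2) * modulus (z - w) ^+ 2).
Proof.
move=> n0 p2; have p0 : 0 <= p by lra.
have zw : modulus z <= modulus w + modulus (z - w).
  by have := modulusD w (z - w); rewrite addrC subrK.
set m := Num.min _ _.
have m0 : 0 <= m by rewrite /m le_min modulus_ge0 ltW.
have mz : m <= modulus z by rewrite /m ge_min lexx.
have mn : m <= n by rewrite /m ge_min lexx orbT.
have d0 := modulus_ge0 (z - w); have w0 := modulus_ge0 w.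
clearbody m; move: (modulus z) (modulus w) (modulus (z - w)) zw mz d0 w0 => {z w} z w d zw mz d0 w0.
have [dw|/ltW wd] := leP d w.
  apply: (@le_trans _ _ ((2 * w) `^ p)).
    by apply: ge0_ler_powR => //; rewrite ?nnegrE ?mulr_ge0//; lra.
  by rewrite powRM// ler_wpM2l ?powR_ge0// lerDl mulr_ge0 ?powR_ge0 ?sqr_ge0.
have -> : m `^ p = m `^ (p - 2) * m ^+ 2.
  have [->|mN0] := eqVneq m 0; first by rewrite expr0n/= mulr0 powR0//; apply/eqP; lra.
  by rewrite -powR_mulrn// -powRD ?mN0 ?implybT// subrK.
apply: (@le_trans _ _ (n `^ (p - 2) * (2 * d) ^+ 2)).
  apply: ler_pM; rewrite ?powR_ge0 ?sqr_ge0//.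
    by apply: ge0_ler_powR; rewrite ?nnegrE ?subr_ge0 ?(ltW n0).
  by rewrite lerXn2r ?nnegrE ?mulr_ge0//; lra.
rewrite exprMn mulrCA mulrDr; apply: ler_wpDl; first by rewrite mulr_ge0 ?powR_ge0.
rewrite ler_wpM2r ?mulr_ge0 ?powR_ge0 ?sqr_ge0//.
by rewrite -powR_mulrn// ler_powR// ler1n.
Qed.

End modulus_theory.

Section H10_sobolev.
Context {R : realType} {N : nat}.
Local Notation E := 'rV[R]_N.
Local Notation mu := (@lebesgue_rV R N).
Local Notation Re := complex.Re.
Local Notation Im := complex.Im.
Local Notation partial i f := ('D_(basis_vec i) f).
Variable Om : set E.
Hypothesis oOm : open Om.
Implicit Types (f : E -> R) (u v w z : E -> R[i]).

Let mOm : measurable Om. Proof. exact: open_measurable_rV. Qed.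
Local Notation ip := (L2_ip Om).
Local Notation nrm := (nrm Om).
Local Notation dir := (dirichlet_form Om).
Local Notation wp := (weak_partial Om).
Local Notation sqH1 := (sqH1 Om).

Lemma measurable_modulus u : L2 Om u -> measurable_fun Om (fun x => modulus (u x)).
Proof.
move=> [mr mi _].
have -> : (fun x => modulus (u x)) = (fun x => (Re (u x) ^+ 2 + Im (u x) ^+ 2) `^ 2^-1).
  apply/funext => x; rewrite powR12_sqrt ?addr_ge0 ?sqr_ge0// -sqr_modulus sqrtr_sqr.
  by rewrite ger0_norm// modulus_ge0.
by apply: measurable_fun_powRr; apply: measurable_funD; exact: measurable_funX.
Qed.

(** With d = v - u, the gap between the two sides is the square of the H^1 norm of u - d. *)
Lemma sqH1_parallelogram u v : H1 Om u -> H1 Om v ->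
  sqH1 v <= 2 * sqH1 u + 2 * sqH1 (fun x => u x - v x).
Proof.
move=> Hu Hv; have Hd := H1B oOm Hv Hu; have Hw := H1B oOm Hu Hd.
have := sqH1_ge0 Om (fun x => u x - (v x - u x)); rewrite /sqH1.
have ipE (a b : E -> R[i]) : L2 Om a -> L2 Om b ->
    ip (fun x => a x - b x) (fun x => a x - b x) = ip a a - 2 * ip a b + ip b b.
  move=> La Lb; have Lab := L2B mOm La Lb.
  rewrite (ipBr mOm La Lb Lab) (ipC Om _ a) (ipC Om _ b) (ipBr mOm La Lb La)
    (ipBr mOm La Lb Lb) (ipC Om b a).
  by move: (ip a a) (ip a b) (ip b b) => A B C; ring.
have Lu := H1_L2 Hu; have Lv := H1_L2 Hv; have Ld := H1_L2 Hd.
rewrite (ipE _ _ Lu Ld) (ipE _ _ Lv Lu) (ipE _ _ Lu Lv) (ipBr mOm Lv Lu Lu).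
rewrite (dir_sqrB oOm Hu Hd) (dir_sqrB oOm Hv Hu) (dir_sqrB oOm Hu Hv) (dirBr oOm Hv Hu Hu).
rewrite (ipC Om v u) (dirC Om v u).
move: (ip u u) (ip u v) (ip v v) (dir u u) (dir u v) (dir v v) => A B C A' B' C'.
by clear; lra.
Qed.

Lemma test_int_sqr_le phi : test_function Om phi ->
  (\int[mu]_x ((Re (phi x)) ^+ 2)%:E <= (ip phi phi)%:E)%E /\
  (\int[mu]_x ((Im (phi x)) ^+ 2)%:E <= (ip phi phi)%:E)%E.
Proof.
move=> [tr ti]; rewrite -(integral_sqr_test tr) -(integral_sqr_test ti).
rewrite (ripE mOm (real_L2_test tr)) (ripE mOm (real_L2_test ti)) !lee_fin /L2_ip.
by split; rewrite ?lerDl ?lerDr rip_ge0.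
Qed.

Lemma test_partial_ip_le i phi : test_function Om phi ->
  ip (test_partial i phi) (test_partial i phi) <= sqH1 phi.
Proof.
move=> tphi; have H1phi := H1_test oOm tphi.
have Lw := weak_partial_L2 i H1phi.
have Lt := test_function_L2 oOm (test_function_partial i tphi).
have E1 := weak_partial_test oOm i tphi.
rewrite -(ip_ael oOm Lw Lt Lt E1) -(ip_aer oOm Lw Lt Lw E1).
exact: wp_le_sqH1.
Qed.

(** H^1 approximation by test functions gives no pointwise convergence without passing to a
    subsequence. Instead |u| is truncated at height n and compared with one test function, chosen so
    close that the error stays below a constant although n is large; the bound is then uniform in n,
    and monotone convergence removes the truncation. *)
Lemma sobolev_H10 (sigma A : R) : (1 <= N)%N -> 0 < sigma ->
  ((2 < N)%N -> sigma <= 2 / (N%:R - 2)) -> 0 <= A ->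
  exists2 K : R, 0 <= K & forall u, H10 Om u -> sqH1 u <= A ->
    (\int[mu]_(x in Om) (modulus (u x) `^ (2 * sigma + 2))%:E <= K%:E)%E.
Proof.
move=> N1 s0 sN A0; set p := 2 * sigma + 2.
have p2 : 2 <= p by rewrite /p; lra.
have p0 : 0 < p by lra.
(* The approximants are taken within H^1 distance 1 of [u]; [sqH1_parallelogram] then bounds their
   squared norm by 2A + 2. *)
have B0 : 0 <= 2 * A + 2 by lra.
have [K HK] := sobolev_smooth N1 s0 sN B0; rewrite -/p in HK.
have test_real f : real_test_function Om f ->
    (\int[mu]_x ((f x) ^+ 2)%:E <= (2 * A + 2)%:E)%E ->
    (forall i, (\int[mu]_x ((partial i f x) ^+ 2)%:E <= (2 * A + 2)%:E)%E) ->
    (\int[mu]_(x in Om) (`|f x| `^ p)%:E <= (Num.max K 0)%:E)%E.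
  move=> tf f2 df2; have [M M0 fM] := real_test_function_supp_cube tf.
  have C1f := real_test_function_Ck 1 tf.
  have := HK f M M0 C1f fM f2 df2 => fK.
  apply: (@le_trans _ _ (\int[mu]_x (`|f x| `^ p)%:E)%E).
    by apply: ge0_subset_integral => //; exact: measurable_norm_powR.
  by rewrite (norm_pow_intE M0 C1f fM p0) lee_fin le_max fK.
have mf_test f : real_test_function Om f -> measurable_fun Om (fun x => (`|f x| `^ p)%:E).
  move=> tf; have [M M0 fM] := real_test_function_supp_cube tf.
  apply: measurable_funTS; exact: (measurable_norm_powR (real_test_function_Ck 1 tf)).
have test_phi phi : test_function Om phi -> sqH1 phi <= 2 * A + 2 ->
    (\int[mu]_(x in Om) (modulus (phi x) `^ p)%:E <= (2 `^ p * (2 * Num.max K 0))%:E)%E.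
  move=> tphi phiA; have [tr ti] := tphi.
  have [Ir Ii] := test_int_sqr_le tphi.
  have le1 : ((ip phi phi)%:E <= (2 * A + 2)%:E)%E.
    by rewrite lee_fin; apply: le_trans phiA; exact: ip_le_sqH1.
  have le2 i : ((ip (test_partial i phi) (test_partial i phi))%:E <= (2 * A + 2)%:E)%E.
    by rewrite lee_fin; apply: le_trans phiA; exact: test_partial_ip_le.
  have rK := test_real _ tr (le_trans Ir le1)
    (fun i => le_trans (test_int_sqr_le (test_function_partial i tphi)).1 (le2 i)).
  have iK := test_real _ ti (le_trans Ii le1)
    (fun i => le_trans (test_int_sqr_le (test_function_partial i tphi)).2 (le2 i)).
  apply: (@le_trans _ _ (\int[mu]_(x in Om) ((2 `^ p)%:E *
      ((`|Re (phi x)| `^ p)%:E + (`|Im (phi x)| `^ p)%:E)))%E).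
    apply: ge0_le_integral => //.
    - by move=> x _; rewrite lee_fin powR_ge0.
    - apply/measurable_EFinP; apply: measurable_fun_powRr.
      exact: measurable_modulus (test_function_L2 oOm tphi).
    - apply: emeasurable_funM => //; apply: emeasurable_funD; exact: mf_test.
    - by move=> x _; rewrite -EFinD -EFinM lee_fin; apply: modulus_powR_le; exact: ltW.
  rewrite ge0_integralZl//.
  - rewrite ge0_integralD//; last 2 first.
    + exact: mf_test.
    + exact: mf_test.
    rewrite EFinM lee_wpmul2l ?lee_fin ?powR_ge0//.
    by rewrite mulr_natl mulr2n EFinD; exact: leeD rK iK.
  - by apply: emeasurable_funD; exact: mf_test.
  - by move=> x _; rewrite adde_ge0// lee_fin powR_ge0.
pose C := 2 `^ p * (2 `^ p * (2 * Num.max K 0) + 1).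
have C0 : 0 <= C.
  by rewrite /C mulr_ge0 ?powR_ge0// addr_ge0// !mulr_ge0 ?powR_ge0// le_max lexx orbT.
exists C => // u Hu uA; have H1u := H10_H1 Hu; have mu_ := measurable_modulus (H1_L2 H1u).
have trunc (n : nat) :
    (\int[mu]_(x in Om) (Num.min (modulus (u x)) n.+1%:R `^ p)%:E <= C%:E)%E.
  set m : R := n.+1%:R; have m0 : 0 < m by rewrite /m ltr0n.
  have mp0 : 0 < m `^ (p - 2) by rewrite powR_gt0.
  (* Chosen so that m^(p-2) e^2 <= 1: the loss from the truncation height is compensated by the
     quality of the approximation. *)
  pose e := (1 + m `^ (p - 2))^-1.
  have e0 : 0 < e by rewrite invr_gt0 addr_gt0.
  have e1 : e <= 1 by rewrite invf_le1 ?addr_gt0// lerDl ltW.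
  have em : m `^ (p - 2) * e <= 1.
    by rewrite /e ler_pdivrMr ?addr_gt0// mul1r lerDr.
  have ee : e ^+ 2 <= e by rewrite expr2 ler_piMl// ltW.
  have [phi tphi uphi] := H10_approx oOm Hu e0.
  have H1phi := H1_test oOm tphi.
  have phiA : sqH1 phi <= 2 * A + 2.
    apply: le_trans (sqH1_parallelogram H1u H1phi) _.
    have d1 : sqH1 (fun x => u x - phi x) <= 1 by exact: le_trans (ltW uphi) (le_trans ee e1).
    by move: uA d1; move: (sqH1 u) (sqH1 _) => x y; clear; lra.
  have Lphi := H1_L2 H1phi; have Ld := L2B mOm (H1_L2 H1u) Lphi.
  have mphi := measurable_modulus Lphi; have md := measurable_modulus Ld.
  have mphip : measurable_fun Om (fun x => (modulus (phi x) `^ p)%:E).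
    by apply/measurable_EFinP; exact: measurable_fun_powRr.
  have mdp : measurable_fun Om (fun x => (modulus (u x - phi x) ^+ 2)%:E).
    by apply/measurable_EFinP; exact: measurable_funX.
  apply: (@le_trans _ _ (\int[mu]_(x in Om) ((2 `^ p)%:E *
     ((modulus (phi x) `^ p)%:E + (m `^ (p - 2))%:E * (modulus (u x - phi x) ^+ 2)%:E)))%E).
    apply: ge0_le_integral => //.
    - by move=> x _; rewrite lee_fin powR_ge0.
    - apply/measurable_EFinP; apply: measurable_fun_powRr.
      by apply: measurable_minr.
    - apply: emeasurable_funM => //; apply: emeasurable_funD => //.
      by apply: emeasurable_funM.
    - by move=> x _; rewrite lee_fin; exact: truncated_powR_le.
  rewrite ge0_integralZl//.
  - rewrite ge0_integralD//; last 2 first.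
    + by move=> x _; rewrite mule_ge0// lee_fin ?powR_ge0 ?sqr_ge0.
    + exact: emeasurable_funM.
    + rewrite ge0_integralZl// ?lee_fin ?powR_ge0//; last first.
        by move=> x _; rewrite lee_fin sqr_ge0.
      rewrite /C EFinM lee_wpmul2l ?lee_fin ?powR_ge0//.
      rewrite EFinD leeD//; first exact: test_phi.
      have := sqnorm2E mOm Ld; rewrite /sqnorm2 => ->.
      rewrite -EFinM lee_fin; apply: le_trans em.
      rewrite ler_wpM2l ?(ltW mp0)//; apply: le_trans ee.
      by apply: le_trans (ltW uphi); exact: ip_le_sqH1.
    + by move=> x _; rewrite lee_fin powR_ge0.
  - apply: emeasurable_funD => //; exact: emeasurable_funM.
  - by move=> x _; rewrite adde_ge0 ?mule_ge0 ?lee_fin ?powR_ge0 ?sqr_ge0.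
have cvg : (\int[mu]_(x in Om) (Num.min (modulus (u x)) n.+1%:R `^ p)%:E @[n --> \oo] -->
    \int[mu]_(x in Om) (limn (fun n : nat => (Num.min (modulus (u x)) n.+1%:R `^ p)%:E)))%E.
  apply: cvg_monotone_convergence => //.
  - move=> n; apply/measurable_EFinP; apply: measurable_fun_powRr.
    by apply: measurable_minr.
  - by move=> n x _; rewrite lee_fin powR_ge0.
  - move=> x _ i j ij; rewrite lee_fin; apply: ge0_ler_powR; rewrite ?(ltW p0)//.
    + by rewrite nnegrE le_min modulus_ge0 ler0n.
    + by rewrite nnegrE le_min modulus_ge0 ler0n.
    + by rewrite le_min ge_min lexx/= ge_min ler_nat ltnS ij orbT.
have limE x : limn (fun n : nat => (Num.min (modulus (u x)) n.+1%:R `^ p)%:E) =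
    (modulus (u x) `^ p)%:E.
  apply/cvg_lim => //; apply: cvg_near_cst.
  have [n _ Hn] := nbhs_infty_ger (modulus (u x)).
  exists n => // k nk; rewrite min_l//.
  by apply: le_trans (Hn k nk) _; rewrite ler_nat.
under eq_integral do rewrite -limE.
rewrite -(cvg_lim _ cvg)//; apply: lime_le.
  by apply/cvg_ex; eexists; exact: cvg.
by apply: nearW => n; exact: trunc.
Qed.

End H10_sobolev.

Section power_nonlinearity.
Context {R : realType}.
Variable s : R.
Hypothesis s0 : 0 < s.
Implicit Types z w : R[i].
Local Notation Re := complex.Re.
Local Notation Im := complex.Im.

Definition dot z w : R := Re z * Re w + Im z * Im w.

Definition cpow z : R[i] := (modulus z `^ s)%:C * z.

Lemma Re_cpow z : Re (cpow z) = modulus z `^ s * Re z.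
Proof. by rewrite ReM /= mul0r subr0. Qed.

Lemma Im_cpow z : Im (cpow z) = modulus z `^ s * Im z.
Proof. by rewrite ImM /= mul0r addr0. Qed.

Lemma modulus_real (x : R) : modulus x%:C = `|x|.
Proof. by rewrite /modulus /= expr0n/= addr0 sqrtr_sqr. Qed.

Lemma powRS (x t : R) : 0 <= x -> 0 < t -> x `^ t * x = x `^ (t + 1).
Proof.
move=> x0 t0; have [->|xN0] := eqVneq x 0.
  by rewrite mulr0 powR0// gt_eqF// addr_gt0.
by rewrite powRD ?xN0 ?implybT// powRr1.
Qed.

Lemma modulus_cpow z : modulus (cpow z) = modulus z `^ (s + 1).
Proof.
by rewrite modulusM modulus_real ger0_norm ?powR_ge0// powRS// modulus_ge0.
Qed.

Lemma sqr_modulus_cpow z : modulus (cpow z) ^+ 2 = modulus z `^ (2 * s + 2).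
Proof.
rewrite modulus_cpow -powR_mulrn ?powR_ge0// -powRrM; congr (_ `^ _); ring.
Qed.

Lemma dot_modulus z w : `|dot z w| <= modulus z * modulus w.
Proof.
rewrite -ler_sqr ?nnegrE ?mulr_ge0 ?modulus_ge0// real_normK ?num_real//.
rewrite exprMn !sqr_modulus /dot.
have := sqr_ge0 (Re z * Im w - Im z * Re w).
move: (Re z) (Re w) (Im z) (Im w) => A B C D; nra.
Qed.

Lemma dot_cpow z : dot (cpow z) z = modulus z `^ (s + 2).
Proof.
rewrite /dot Re_cpow Im_cpow -!mulrA -mulrDr -!expr2 -sqr_modulus expr2 mulrA.
have -> : s + 2 = s + 1 + 1 by ring.
by rewrite !powRS ?modulus_ge0// addr_gt0.
Qed.

(** Young's inequality with the conjugate exponents t + 1 and (t + 1)/t. It is used with t = s + 1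
    for the convexity and with t = s for the Lipschitz estimate. *)
Lemma young_powR (t x y : R) : 0 < t -> 0 <= x -> 0 <= y ->
  (t + 1) * (y * x `^ t) <= y `^ (t + 1) + t * x `^ (t + 1).
Proof.
move=> t0 x0 y0; have t1 : 0 < t + 1 by rewrite addr_gt0.
have q0 : 0 < (t + 1) / t by rewrite divr_gt0.
have pq : (t + 1)^-1 + ((t + 1) / t)^-1 = 1 by field; rewrite !gt_eqF.
have := conjugate_powR y0 (powR_ge0 x t) t1 q0 pq.
rewrite -powRrM (_ : t * ((t + 1) / t) = t + 1); last by field; rewrite gt_eqF.
rewrite -(ler_pM2l t1) => /le_trans; apply.
rewrite mulrDr !invfM invrK mulrCA divff ?gt_eqF// mulr1 lerD2l.
by rewrite mulrCA [_ * (_ * t)]mulrA divff ?gt_eqF// mul1r mulrC.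
Qed.

(* The function z |-> |z|^(s+2) / (s+2) is convex with gradient cpow. *)
Lemma cpow_convex z w :
  (s + 2) * dot (cpow z) w <= dot (cpow w) w + (s + 1) * dot (cpow z) z.
Proof.
have H := young_powR (addr_gt0 s0 ltr01) (modulus_ge0 z) (modulus_ge0 w).
rewrite !dot_cpow; move: H; rewrite -addrA => /(le_trans _); apply.
rewrite ler_pM2l ?addr_gt0//.
by rewrite mulrC -modulus_cpow; apply: le_trans (ler_norm _) (dot_modulus _ _).
Qed.

(** Young's inequality replaces the mean value theorem, so the origin needs no separate treatment:
    if |w| <= |z|, A = |z|^s and B = |w|^s, then the difference is A (z - w) + (A - B) w, and (A -
    B) |w| <= s A (|z| - |w|). *)
Lemma cpow_lipschitz z w : modulus (cpow z - cpow w) <=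
  (s + 1) * ((modulus z `^ s + modulus w `^ s) * modulus (z - w)).
Proof.
wlog wz : z w / modulus w <= modulus z => [H|].
  have [/H//|/ltW/H] := leP (modulus w) (modulus z).
  by rewrite -(modulusN (cpow w - _)) -(modulusN (w - z)) !opprB (addrC (modulus w `^ s)).
set A := modulus z `^ s; set B := modulus w `^ s.
have -> : cpow z - cpow w = A%:C * (z - w) + (A - B)%:C * w.
  by rewrite /cpow -/A -/B rmorphB /=; ring.
have z0 := modulus_ge0 z; have w0 := modulus_ge0 w.
have BA : B <= A by apply: ge0_ler_powR; rewrite ?nnegrE// ltW.
have A0 : 0 <= A by exact: powR_ge0.
have B0 : 0 <= B by exact: powR_ge0.
have d0 := modulus_ge0 (z - w).
have d : modulus z - modulus w <= modulus (z - w).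
  by rewrite lerBlDl; have := modulusD w (z - w); rewrite addrC subrK.
have Y : (A - B) * modulus w <= s * (A * (modulus z - modulus w)).
  have := young_powR s0 z0 w0; rewrite -!powRS// -/A -/B.
  move: (modulus z) (modulus w) => x y; lra.
apply: le_trans (modulusD _ _) _; rewrite !modulusM !modulus_real.
rewrite (ger0_norm A0) ger0_norm ?subr_ge0//.
have := mulr_ge0 B0 d0; have := mulr_ge0 (ltW s0) (mulr_ge0 B0 d0).
have := ler_wpM2l (ltW s0) (ler_wpM2l A0 d).
move: (modulus (z - w)) Y => D Y; nra.
Qed.

Lemma dot_cpow_imul z : dot z ('i * cpow z) = 0.
Proof. by rewrite /dot (ReM 'i) (ImM 'i) Re_cpow Im_cpow /=; ring. Qed.

Lemma dot_real (r g d : R) : dot (r%:C * g%:C) d%:C = r * g * d.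
Proof. by rewrite /dot (ReM r%:C) (ImM r%:C) /=; ring. Qed.

Lemma powR_mul_le (x y : R) : 0 <= x -> 0 <= y ->
  x `^ s * y <= x `^ (s + 1) + y `^ (s + 1).
Proof.
move=> x0 y0; rewrite -!powRS//.
have [xy|/ltW yx] := leP x y.
  have := ge0_ler_powR (ltW s0); rewrite /{homo _ : _ _ / _} => /(_ x y).
  rewrite !nnegrE => /(_ x0 y0 xy) H.
  by apply: (@le_trans _ _ (y `^ s * y)); rewrite ?ler_wpM2r// lerDr mulr_ge0 ?powR_ge0.
apply: (@le_trans _ _ (x `^ s * x)); first by rewrite ler_wpM2l ?powR_ge0.
by rewrite lerDl mulr_ge0 ?powR_ge0.
Qed.

End power_nonlinearity.

Lemma sqr_sum3_le (R : realFieldType) (A B C : R) :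
  (A + B + 2 * C) ^+ 2 <= 3 * (A ^+ 2 + B ^+ 2 + 4 * C ^+ 2).
Proof.
have := sqr_ge0 (A - B); have := sqr_ge0 (A - 2 * C); have := sqr_ge0 (B - 2 * C).
lra.
Qed.

Section nonlinear_functional.
Context {R : realType} {N : nat}.
Local Notation E := 'rV[R]_N.
Local Notation mu := (@lebesgue_rV R N).
Local Notation Re := complex.Re.
Local Notation Im := complex.Im.
Variable Om : set E.
Hypothesis oOm : open Om.
Variable s : R.
Hypothesis s0 : 0 < s.
Implicit Types (u v w z : E -> R[i]).

Let mOm : measurable Om. Proof. exact: open_measurable_rV. Qed.
Local Notation ip := (L2_ip Om).
Local Notation nrm := (nrm Om).

Lemma integrable_dot u v : L2 Om u -> L2 Om v ->
  mu.-integrable Om (fun x => (dot (u x) (v x))%:E).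
Proof.
move=> /(L2P mOm)[ur ui] /(L2P mOm)[vr vi].
exact: (integrableD mOm (real_L2_integrableM mOm ur vr) (real_L2_integrableM mOm ui vi)).
Qed.

Lemma ip_dotE u v : L2 Om u -> L2 Om v -> ip u v = \int[mu]_(x in Om) dot (u x) (v x).
Proof.
move=> /(L2P mOm)[ur ui] /(L2P mOm)[vr vi].
by rewrite /dot RintegralD//; exact: real_L2_integrableM.
Qed.

Lemma ip_le u v w z : L2 Om u -> L2 Om v -> L2 Om w -> L2 Om z ->
  (forall x, dot (u x) (v x) <= dot (w x) (z x)) -> ip u v <= ip w z.
Proof.
move=> Lu Lv Lw Lz H; rewrite !ip_dotE//.
by apply: le_Rintegral => //; exact: integrable_dot.
Qed.

Definition nl u : E -> R[i] := fun x => cpow s (u x).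

(** The squared L^2 norm of [nl u], see [nl_sqnorm2]. It is extended-real, so that a bound on it
    also expresses that [nl u] lies in L^2. *)
Definition powint u : \bar R := (\int[mu]_(x in Om) (modulus (u x) `^ (2 * s + 2))%:E)%E.

Lemma measurable_Re_Im_nl u : L2 Om u ->
  measurable_fun Om (fun x => Re (nl u x)) /\ measurable_fun Om (fun x => Im (nl u x)).
Proof.
move=> Lu; have [mr mi _] := Lu; have mm := measurable_modulus Lu.
have E1 : (fun x => Re (nl u x)) = (fun x => modulus (u x) `^ s * Re (u x)).
  by apply/funext => x; exact: Re_cpow.
have E2 : (fun x => Im (nl u x)) = (fun x => modulus (u x) `^ s * Im (u x)).
  by apply/funext => x; exact: Im_cpow.
rewrite E1 E2; split; apply: measurable_funM => //; exact: measurable_fun_powRr.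
Qed.

Lemma nl_sqnorm2 u : sqnorm2 Om (nl u) = powint u.
Proof. by apply: eq_integral => x _; rewrite (sqr_modulus_cpow s0). Qed.

Lemma nl_L2 u (K : R) : L2 Om u -> (powint u <= K%:E)%E -> L2 Om (nl u).
Proof.
move=> Lu uK; have [mr mi] := measurable_Re_Im_nl Lu; split => //.
by apply: poweR_lty; rewrite nl_sqnorm2 (le_lt_trans uK)// ltry.
Qed.

Lemma nl_ip_le u (K : R) : L2 Om u -> (powint u <= K%:E)%E -> ip (nl u) (nl u) <= K.
Proof.
move=> Lu uK; rewrite -lee_fin -(sqnorm2E mOm (nl_L2 Lu uK)).
by rewrite nl_sqnorm2.
Qed.

Lemma nl_convex u w : L2 Om u -> L2 Om w -> L2 Om (nl u) -> L2 Om (nl w) ->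
  (s + 2) * ip (nl u) w <= ip (nl w) w + (s + 1) * ip (nl u) u.
Proof.
move=> Lu Lw Lnu Lnw; rewrite !ip_dotE//.
have Iuw := integrable_dot Lnu Lw; have Iww := integrable_dot Lnw Lw.
have Iuu := integrable_dot Lnu Lu.
have Iuu' : mu.-integrable Om (fun x => ((s + 1) * dot (nl u x) (u x))%:E).
  exact: (integrableZl mOm (s + 1) Iuu).
rewrite -RintegralZl// -RintegralZl// -RintegralD//.
apply: le_Rintegral => //.
- exact: (integrableZl mOm (s + 2) Iuw).
- exact: (integrableD mOm Iww Iuu').
- by move=> x _; exact: cpow_convex.
Qed.

Lemma ip_nl_ge0 u : 0 <= ip (nl u) u.
Proof.
rewrite addr_ge0//; apply: Rintegral_ge0 => x _.
  by rewrite Re_cpow -mulrA mulr_ge0 ?powR_ge0// -expr2 sqr_ge0.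
by rewrite Im_cpow -mulrA mulr_ge0 ?powR_ge0// -expr2 sqr_ge0.
Qed.

Lemma ip_nl_imul u : L2 Om u -> L2 Om (nl u) -> ip u (fun x => 'i * nl u x) = 0.
Proof.
move=> Lu Ln; rewrite ip_dotE//; last exact: L2Z.
under eq_Rintegral do rewrite dot_cpow_imul.
by rewrite /Rintegral integral0.
Qed.

Lemma sqnorm2_real (g : E -> R) :
  sqnorm2 Om (fun x => (g x)%:C) = (\int[mu]_(x in Om) (g x ^+ 2)%:E)%E.
Proof. by apply: eq_integral => x _; rewrite modulus_real real_normK ?num_real. Qed.

Lemma L2_real (g : E -> R) : measurable_fun Om g ->
  (\int[mu]_(x in Om) (g x ^+ 2)%:E < +oo)%E -> L2 Om (fun x => (g x)%:C).
Proof.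
move=> mg goo; split => //=.
by apply: poweR_lty; rewrite sqnorm2_real.
Qed.

(** The nonlinearity is Lipschitz from L^2 into the dual of L^(2s+2), on sets bounded in L^(2s+2):
    Cauchy-Schwarz separates |u - w| from G = (|u|^s + |w|^s) |v|, and G <= |u|^(s+1) + |w|^(s+1) +
    2 |v|^(s+1) is bounded in L^2. *)
Lemma nl_weak_lipschitz u w v (K K' : R) : L2 Om u -> L2 Om w -> L2 Om v ->
  (powint u <= K%:E)%E -> (powint w <= K%:E)%E -> (powint v <= K'%:E)%E ->
  `|ip (fun x => nl u x - nl w x) v| <=
  (s + 1) * Num.sqrt (3 * (2 * K + 4 * K')) * nrm (fun x => u x - w x).
Proof.
move=> Lu Lw Lv uK wK vK.
have Lnu := nl_L2 Lu uK; have Lnw := nl_L2 Lw wK; have Ln := L2B mOm Lnu Lnw.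
have Ld := L2B mOm Lu Lw.
pose G x := (modulus (u x) `^ s + modulus (w x) `^ s) * modulus (v x).
have mU := measurable_modulus Lu; have mW := measurable_modulus Lw.
have mV := measurable_modulus Lv; have mD := measurable_modulus Ld.
have mG : measurable_fun Om G.
  apply: measurable_funM => //.
  by apply: measurable_funD; exact: measurable_fun_powRr.
have G2 x : G x ^+ 2 <= 3 * (modulus (u x) `^ (2 * s + 2) + modulus (w x) `^ (2 * s + 2) +
    4 * modulus (v x) `^ (2 * s + 2)).
  have u0 := modulus_ge0 (u x); have w0 := modulus_ge0 (w x); have v0 := modulus_ge0 (v x).
  rewrite -!(sqr_modulus_cpow s0) !(modulus_cpow s0).
  have := powR_mul_le s0 u0 v0; have := powR_mul_le s0 w0 v0.
  have := powR_ge0 (modulus (u x)) (s + 1); have := powR_ge0 (modulus (w x)) (s + 1).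
  have := powR_ge0 (modulus (v x)) (s + 1).
  have : 0 <= G x by rewrite mulr_ge0 ?addr_ge0 ?powR_ge0.
  rewrite /G mulrDl; move: (_ `^ s * _) (modulus (w x) `^ s * _) (_ `^ (s + 1))
    (modulus (w x) `^ (s + 1)) (modulus (v x) `^ (s + 1)) => P Q A B C PQ C0 B0 A0 HQ HP.
  apply: (@le_trans _ _ ((A + B + 2 * C) ^+ 2)).
    by rewrite ler_sqr ?nnegrE//; lra.
  exact: sqr_sum3_le.
have mp z : measurable_fun Om (fun x => modulus (z x)) ->
    measurable_fun Om (fun x => (modulus (z x) `^ (2 * s + 2))%:E).
  by move=> mz; apply/measurable_EFinP; exact: measurable_fun_powRr.
have IG : (\int[mu]_(x in Om) (G x ^+ 2)%:E <= (3 * (2 * K + 4 * K'))%:E)%E.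
  have mu_ := mp u mU; have mw := mp w mW; have mv := mp v mV.
  have m4 : measurable_fun Om (fun x => 4%:E * (modulus (v x) `^ (2 * s + 2))%:E)%E.
    exact: emeasurable_funM.
  have muw : measurable_fun Om (fun x =>
      (modulus (u x) `^ (2 * s + 2))%:E + (modulus (w x) `^ (2 * s + 2))%:E)%E.
    exact: emeasurable_funD.
  have p0 z x : (0 <= (modulus (z x : R[i]) `^ (2 * s + 2))%:E)%E by rewrite lee_fin powR_ge0.
  apply: (@le_trans _ _ (\int[mu]_(x in Om) (3%:E * ((modulus (u x) `^ (2 * s + 2))%:E +
      (modulus (w x) `^ (2 * s + 2))%:E + 4%:E * (modulus (v x) `^ (2 * s + 2))%:E)))%E).
    apply: ge0_le_integral => //.
    - by move=> x _; rewrite lee_fin sqr_ge0.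
    - by apply/measurable_EFinP; exact: measurable_funX.
    - by apply: emeasurable_funM => //; exact: emeasurable_funD.
    - by move=> x _; rewrite lee_fin; exact: G2.
  rewrite ge0_integralZl//; last 2 first.
  - exact: emeasurable_funD.
  - by move=> x _; rewrite !adde_ge0 ?mule_ge0.
  rewrite ge0_integralD//; last 2 first.
  - by move=> x _; rewrite adde_ge0.
  - by move=> x _; rewrite mule_ge0.
  rewrite ge0_integralD// ge0_integralZl//.
  rewrite [leRHS]EFinM; apply: lee_wpmul2l => //; rewrite [leRHS]EFinD; apply: leeD.
    by rewrite (mulr_natl K 2) (mulr2n K) EFinD; exact: leeD uK wK.
  by rewrite [leRHS]EFinM; apply: lee_wpmul2l.
have LG : L2 Om (fun x => (G x)%:C) by apply: L2_real => //; exact: le_lt_trans IG (ltry _).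
have LD : L2 Om (fun x => (modulus (u x - w x))%:C).
  apply: L2_real => //; have := sqnorm2E mOm Ld; rewrite /sqnorm2 => ->; exact: ltry.
have nG : nrm (fun x => (G x)%:C) <= Num.sqrt (3 * (2 * K + 4 * K')).
  by apply: ler_wsqrtr; rewrite -lee_fin -(sqnorm2E mOm LG) sqnorm2_real.
have nD : nrm (fun x => (modulus (u x - w x))%:C) = nrm (fun x => u x - w x).
  congr Num.sqrt; apply: EFin_inj; rewrite -(sqnorm2E mOm LD) -(sqnorm2E mOm Ld).
  by apply: eq_integral => x _; rewrite modulus_real real_normK ?num_real.
have LsG := L2Z mOm (s + 1)%:C LG.
have H : `|ip (fun x => nl u x - nl w x) v| <=
    ip (fun x => (s + 1)%:C * (G x)%:C) (fun x => (modulus (u x - w x))%:C).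
  have pt x : `|dot (nl u x - nl w x) (v x)| <=
      dot ((s + 1)%:C * (G x)%:C) (modulus (u x - w x))%:C.
    apply: le_trans (dot_modulus _ _) _.
    rewrite dot_real /G.
    apply: le_trans (ler_wpM2r (modulus_ge0 _) (cpow_lipschitz s0 _ _)) _.
    rewrite le_eqVlt; apply/orP; left; apply/eqP; ring.
  rewrite ler_norml -lerNl; apply/andP; split.
    rewrite -(ipNl mOm Ln Lv).
    apply: (ip_le (L2N mOm Ln) Lv LsG LD) => x; apply: le_trans (pt x).
    by rewrite -normrN; apply: le_trans (ler_norm _); rewrite /dot ReN ImN; lra.
  by apply: (ip_le Ln Lv LsG LD) => x; apply: le_trans (pt x); exact: ler_norm.
apply: le_trans H _; rewrite (ipZl mOm (s + 1) LG LD) -mulrA.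
rewrite ler_wpM2l ?addr_ge0 ?(ltW s0)//.
apply: le_trans (ler_norm _) _; apply: le_trans (ip_CauchySchwarz mOm LG LD) _.
by rewrite nD ler_wpM2r ?nrm_ge0.
Qed.

End nonlinear_functional.

(** * Energy along solutions *)

(** Going backwards from [t], let m be the infimum of the points s such that f rises with slope at
    most e from s to [t]. Semicontinuity from the right shows that m is itself such a point, and a
    backward step from m contradicts minimality unless m = 0. A single admissible [h] for each point
    and slope is enough. *)
Lemma le_of_left_dini (R : realType) (f : R -> R) (t : R) : 0 <= t ->
  (forall s e, 0 <= s -> 0 < e ->
    exists2 d : R, 0 < d & forall r, s <= r < s + d -> f r <= f s + e) ->
  (forall s e, 0 < s -> 0 < e ->
    exists2 h : R, 0 < h <= s & f s - f (s - h) <= e * h) ->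
  f t <= f 0.
Proof.
move=> t0 usc dini; apply/ler_addgt0Pr => /= eps eps0.
(* Slope e over [0, t] amounts to a rise of at most eps; t + 1 covers the case t = 0. *)
pose e := eps / (t + 1); have t1 : 0 < t + 1 by rewrite ltr_wpDl.
have e0 : 0 < e by rewrite divr_gt0.
suff H : f t - f 0 <= e * (t - 0).
  rewrite -lerBlDl; apply: le_trans H _; rewrite subr0 /e mulrAC ler_pdivrMr//.
  by rewrite ler_pM2l// lerDl.
pose S := [set s : R | 0 <= s <= t /\ f t - f s <= e * (t - s)].
have St : S t by split; rewrite ?t0 ?lexx// !subrr mulr0.
have lS : lbound S 0 by move=> s [/andP[]].
have hS : has_inf S by split; [exists t | exists 0].
pose m := inf S.
have m0 : 0 <= m by apply: lb_le_inf => //; exists t.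
have mt : m <= t by apply: ge_inf => //; exists 0.
(* The infimum is approached from the right, which is why one-sided semicontinuity suffices. *)
have Sm : f t - f m <= e * (t - m).
  apply/ler_addgt0Pr => /= d d0.
  have [r r0 Hr] := usc m d m0 d0.
  have [s Ss sr] := inf_adherent r0 hS.
  have ms : m <= s by apply: ge_inf => //; exists 0.
  have := Hr s; rewrite ms sr => /(_ isT) fs.
  have [_ fts] := Ss.
  have := ler_wpM2l (ltW e0) ms; rewrite mulrBr in fts; rewrite mulrBr.
  move: (f t) (f s) (f m) (e * t) (e * s) (e * m) fts fs => A B C D F G; lra.
have [m1|mp] : m = 0 \/ 0 < m.
  by move: m0; rewrite le_eqVlt eq_sym => /orP[/eqP|]; [left|right].
  by rewrite -m1.
have [h /andP[h0 hm] Hh] := dini m e mp e0.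
have : m <= m - h.
  apply: ge_inf; first by exists 0.
  split; first by apply/andP; split; lra.
  rewrite mulrBr mulrBr; rewrite mulrBr in Sm.
  move: (f t) (f (m - h)) (f m) (e * t) (e * h) (e * m) Sm Hh => A B C D F G; lra.
lra.
Qed.

Section energy_identities.
Context {R : realType} {N : nat}.
Local Notation E := 'rV[R]_N.
Local Notation mu := (@lebesgue_rV R N).
Local Notation Re := complex.Re.
Local Notation Im := complex.Im.
Variable Om : set E.
Hypothesis oOm : open Om.
Variable s : R.
Hypothesis s0 : 0 < s.
Variables a c k m : R.
Hypotheses (a0 : 0 < a) (c0 : 0 < c) (k0 : 0 < k).
Implicit Types (u v w z : E -> R[i]).

Let mOm : measurable Om. Proof. exact: open_measurable_rV. Qed.
Local Notation ip := (L2_ip Om).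
Local Notation nrm := (nrm Om).
Local Notation dir := (dirichlet_form Om).
Local Notation wp := (weak_partial Om).
Local Notation sqH1 := (sqH1 Om).
Local Notation Lap := (weak_laplacian Om).
Local Notation nl := (nl s).
Local Notation powint := (powint Om s).

(** [ip (nl u) u] is the integral of |u|^(s+2). *)
Definition energy u : R :=
  a / 2 * dir u u - c / (s + 2) * ip (nl u) u - k / 2 * ip u u.

Lemma ip_sqrB u v : L2 Om u -> L2 Om v ->
  ip (fun x => u x - v x) (fun x => u x - v x) = ip u u - 2 * ip u v + ip v v.
Proof.
move=> Lu Lv; have Luv := L2B mOm Lu Lv.
rewrite (ipBr mOm Lu Lv Luv) (ipC Om _ u) (ipC Om _ v) (ipBr mOm Lu Lv Lu)
  (ipBr mOm Lu Lv Lv) (ipC Om v u).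
by move: (ip u u) (ip u v) (ip v v) => A B C; ring.
Qed.

(* For m = alpha/a, [flow] is the right-hand side of the equation; the energy
   decreases because [force] is minus its gradient. *)
Definition reaction z : E -> R[i] := fun x => a%:C * Lap z x + c%:C * nl z x.

Lemma reaction_L2 z (K : R) : H2 Om z -> (powint z <= K%:E)%E -> L2 Om (reaction z).
Proof.
move=> H2z zK; have Lz := H1_L2 H2z.1.
apply: L2D => //; apply: L2Z => //; first exact: weak_laplacian_L2.
exact: nl_L2 zK.
Qed.

Lemma ip_reaction z w (K : R) : H2 Om z -> (powint z <= K%:E)%E -> L2 Om w ->
  ip (reaction z) w = a * ip (Lap z) w + c * ip (nl z) w.
Proof.
move=> H2z zK Lw; have Lz := H1_L2 H2z.1.
have LD := weak_laplacian_L2 oOm H2z; have Ln := nl_L2 s0 Lz zK.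
by rewrite (ipDl mOm (L2Z mOm a%:C LD) (L2Z mOm c%:C Ln) Lw) (ipZl mOm a LD Lw)
  (ipZl mOm c Ln Lw).
Qed.

Definition force z : E -> R[i] := fun x => reaction z x + k%:C * z x.

Lemma force_L2 z (K : R) : H2 Om z -> (powint z <= K%:E)%E -> L2 Om (force z).
Proof.
move=> H2z zK; apply: L2D => //; first exact: reaction_L2 zK.
by apply: L2Z => //; exact: H1_L2 H2z.1.
Qed.

Lemma ip_force z w (K : R) : H2 Om z -> (powint z <= K%:E)%E -> L2 Om w ->
  ip (force z) w = a * ip (Lap z) w + c * ip (nl z) w + k * ip z w.
Proof.
move=> H2z zK Lw; have Lz := H1_L2 H2z.1; have Lr := reaction_L2 H2z zK.
by rewrite (ipDl mOm Lr (L2Z mOm k%:C Lz) Lw) (ip_reaction H2z zK Lw) (ipZl mOm k Lz Lw).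
Qed.

(** Here [z] is the later state, [z'] the earlier one and [D] their difference quotient. Convexity
    bounds the Dirichlet increment by the gradient at [z], where Green's formula is available
    because [z] lies in H^2; nothing of the kind is asked of [z']. *)
Lemma energy_backward z z' (D : E -> R[i]) (h K : R) : H2 Om z -> H10 Om z -> H10 Om z' ->
  (powint z <= K%:E)%E -> (powint z' <= K%:E)%E -> L2 Om D -> 0 < h ->
  (forall x, z x - z' x = h%:C * D x) ->
  energy z - energy z' <= h * (- ip (force z) D
    + c * ip (fun x => nl z x - nl z' x) D + k / 2 * h * ip D D).
Proof.
move=> H2z Hz Hz' zK zK' LD h0 dE; have H1z := H10_H1 Hz; have H1z' := H10_H1 Hz'.
have Lz := H1_L2 H1z; have Lz' := H1_L2 H1z'.
have LL := weak_laplacian_L2 oOm H2z.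
have Ln := nl_L2 s0 Lz zK; have Ln' := nl_L2 s0 Lz' zK'.
pose d x := z x - z' x.
have dhD : d = fun x => h%:C * D x by apply/funext => x; exact: dE.
have e1 := dir_ge0 Om d; rewrite (dir_sqrB oOm H1z H1z') in e1.
have e2 : h * ip (Lap z) D = - dir z z + dir z z'.
  rewrite -(ipZr mOm h LD LL) -dhD (ipBr mOm Lz Lz' LL) (green oOm H2z Hz)
    (green oOm H2z Hz') opprK.
  by [].
have e3 : h * ip (nl z') D = ip (nl z') z - ip (nl z') z'.
  by rewrite -(ipZr mOm h LD Ln') -dhD (ipBr mOm Lz Lz' Ln').
(* The power term has a minus sign, so its convexity is used at the earlier state. This yields
   [nl z'] where the force contains [nl z], and hence the error term of the conclusion. *)
have e4 := nl_convex oOm s0 Lz' Lz Ln' Ln.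
have e5 : h * ip z D = ip z z - ip z z'.
  by rewrite -(ipZr mOm h LD Lz) -dhD (ipBr mOm Lz Lz' Lz).
have e6 : h * (h * ip D D) = ip z z - 2 * ip z z' + ip z' z'.
  rewrite -(ip_sqrB Lz Lz') -/d dhD (ipZr mOm h LD (L2Z mOm h%:C LD)).
  by rewrite (ipZl mOm h LD LD).
rewrite (ip_force H2z zK LD) (ipBl mOm Ln Ln' LD) /energy.
move: (dir z z) (dir z z') (dir z' z') (ip (Lap z) D) (ip (nl z') D) (ip (nl z) D)
  (ip (nl z') z) (ip (nl z') z') (ip (nl z) z) (ip z z) (ip z z') (ip z' z') (ip z D)
  (ip D D) e1 e2 e3 e4 e5 e6 => d1 d2 d3 l1 n1 n2 n3 n4 n5 p1 p2 p3 p4 p5 e1 e2 e3 e4 e5 e6.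
have f1 : a / 2 * (d1 - d3) <= - (a * (h * l1)).
  rewrite e2; have := ler_wpM2l (ltW a0) e1; lra.
have f2 : c * (h * n1) <= c / (s + 2) * (n5 - n4).
  rewrite e3 -mulrA ler_pM2l// mulrC ler_pdivlMr ?addr_gt0//.
  lra.
have f3 : k / 2 * (p1 - p3) = k * (h * p4) - k / 2 * (h * (h * p5)).
  by rewrite e5 e6; field.
have -> : h * (- (a * l1 + c * n2 + k * p4) + c * (n2 - n1) + k / 2 * h * p5) =
  - (a * (h * l1)) - c * (h * n1) - (k * (h * p4) - k / 2 * (h * (h * p5))) by ring.
rewrite -f3; move: f1 f2; rewrite !mulrBr; clear; lra.
Qed.

(** The Laplacian contributes the Dirichlet form of z and iz, which is 0 by skew-symmetry; the
    nonlinear part vanishes pointwise, being a real multiple of [z]. *)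
Lemma ip_reaction_imul z (K : R) : H2 Om z -> H10 Om z -> (powint z <= K%:E)%E ->
  ip z (fun x => 'i * reaction z x) = 0.
Proof.
move=> H2z Hz zK; have H1z := H10_H1 Hz; have Lz := H1_L2 H1z.
have Lr := reaction_L2 H2z zK; have Ln := nl_L2 s0 Lz zK.
rewrite (ip_imul mOm Lz Lr) ipC (ip_reaction H2z zK (L2Z mOm 'i Lz)).
rewrite (green oOm H2z (H10Z oOm 'i Hz)) (dir_imul oOm H1z).
rewrite (ipC Om (nl z)).
have H := ip_nl_imul oOm Lz Ln; rewrite (ip_imul mOm Lz Ln) in H.
by rewrite [X in c * X](oppr_inj (etrans H (esym (oppr0 _)))) !(oppr0, mulr0, addr0).
Qed.

Definition flow z : E -> R[i] := fun x => (1 +i* m) * reaction z x + k%:C * z x.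

Lemma flowE z : flow z = fun x => force z x + m%:C * ('i * reaction z x).
Proof.
apply/funext => x; rewrite /flow /force.
have -> : 1 +i* m = 1 + m%:C * 'i.
  by apply: complex_eqP; rewrite ?ReD ?ImD ?ReM ?ImM /=; ring.
by rewrite mulrDl mul1r -mulrA addrAC.
Qed.

(** The pairing equals the squared norm of the force: with X = [reaction z], both <X, iX> and <z,
    iX> vanish. *)
Lemma ip_force_flow z (K : R) : H2 Om z -> H10 Om z -> (powint z <= K%:E)%E ->
  0 <= ip (force z) (flow z).
Proof.
move=> H2z Hz zK; have Lz := H1_L2 (H10_H1 Hz).
have Lr := reaction_L2 H2z zK; have Lf := force_L2 H2z zK; have Lir := L2Z mOm 'i Lr.
rewrite flowE (ipDr mOm Lf (L2Z mOm m%:C Lir) Lf) (ipZr mOm m Lir Lf).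
rewrite [X in _ + m * X](ipDl mOm Lr (L2Z mOm k%:C Lz) Lir) (ipZl mOm k Lz Lir).
rewrite (ip_imul_self mOm Lr) (ip_reaction_imul H2z Hz zK) mulr0 addr0 mulr0 addr0.
exact: ip_ge0.
Qed.

(** Twice the energy contains the power integral with the factor 2c/(s+2), the pairing with the
    factor c; the surplus is nonnegative because c > 0 and s > 0. *)
Lemma ip_flow z (K : R) : H2 Om z -> H10 Om z -> (powint z <= K%:E)%E ->
  - 2 * energy z <= ip z (flow z).
Proof.
move=> H2z Hz zK; have Lz := H1_L2 (H10_H1 Hz).
have Lr := reaction_L2 H2z zK; have Lf := force_L2 H2z zK; have Lir := L2Z mOm 'i Lr.
rewrite flowE (ipDr mOm Lf (L2Z mOm m%:C Lir) Lz) (ipZr mOm m Lir Lz).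
rewrite (ip_reaction_imul H2z Hz zK) mulr0 addr0 ipC (ip_force H2z zK Lz).
rewrite (green oOm H2z Hz) /energy.
have := ip_nl_ge0 Om s z; move: (ip (nl z) z) (ip z z) (dir z z) => n p d n0.
have -> : - 2 * (a / 2 * d - c / (s + 2) * n - k / 2 * p) =
  - a * d + 2 / (s + 2) * (c * n) + k * p by field; rewrite gt_eqF// addr_gt0.
have : 2 / (s + 2) * (c * n) <= 1 * (c * n).
  rewrite ler_wpM2r ?mulr_ge0 ?(ltW c0)// ler_pdivrMr ?addr_gt0// mul1r lerDr.
  exact: ltW.
lra.
Qed.

(** Upper semicontinuity only: convexity bounds the decrease of the power term by a functional that
    is linear in w - z with gradient at the fixed point [z], so that [C] depends on [z] and not on
    [w]. *)
Lemma energy_usc z (K : R) : H10 Om z -> (powint z <= K%:E)%E ->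
  exists2 C : R, 0 <= C & forall w r, H10 Om w -> (powint w <= K%:E)%E -> 0 <= r ->
    sqH1 (fun x => w x - z x) <= r ^+ 2 -> energy w <= energy z + C * (r ^+ 2 + r).
Proof.
move=> Hz zK; have H1z := H10_H1 Hz; have Lz := H1_L2 H1z.
have Ln := nl_L2 s0 Lz zK.
pose C := a * (\sum_(i < N) nrm (wp i z)) + c * nrm (nl z) + k * nrm z.
have S0 : 0 <= \sum_(i < N) nrm (wp i z) by apply: sumr_ge0 => i _; exact: nrm_ge0.
have C0 : 0 <= C by rewrite !addr_ge0 ?mulr_ge0 ?nrm_ge0// ltW.
exists (a / 2 + C); first by rewrite addr_ge0// divr_ge0// ltW.
move=> w r Hw wK r0 wr; have H1w := H10_H1 Hw; have Lw := H1_L2 H1w.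
have Lnw := nl_L2 s0 Lw wK.
pose d x := w x - z x; have Ld : L2 Om d by exact: L2B.
have Hd : H1 Om d by exact: H1B.
have sr : Num.sqrt (sqH1 d) <= r by exact: sqrt_le_sqr.
have nd : nrm d <= r.
  by apply: sqrt_le_sqr => //; apply: le_trans wr; exact: ip_le_sqH1.
have b1 : `|dir z d| <= (\sum_(i < N) nrm (wp i z)) * r.
  by apply: le_trans (dir_le oOm H1z Hd) _; rewrite ler_wpM2l.
have b2 : `|ip (nl z) d| <= nrm (nl z) * r.
  by apply: le_trans (ip_CauchySchwarz mOm Ln Ld) _; rewrite ler_wpM2l ?nrm_ge0.
have b3 : `|ip z d| <= nrm z * r.
  by apply: le_trans (ip_CauchySchwarz mOm Lz Ld) _; rewrite ler_wpM2l ?nrm_ge0.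
have b4 : dir d d <= r ^+ 2 by apply: le_trans wr; exact: dir_le_sqH1.
have b5 := ip_ge0 Om d.
have e1 := dir_sqrB oOm H1w H1z; rewrite -/d in e1.
have e2 := dirBr oOm H1w H1z H1z; rewrite -/d (dirC Om z w) in e2.
have e3 := ip_sqrB Lw Lz; rewrite -/d in e3.
have e4 := ipBr mOm Lw Lz Lz; rewrite -/d (ipC Om z w) in e4.
have e5 := nl_convex oOm s0 Lz Lw Ln Lnw.
have e6 := ipBr mOm Lw Lz Ln; rewrite -/d in e6.
rewrite /energy; move: C0; rewrite /C.
move: (\sum_(i < N) _) (nrm (nl z)) (nrm z) (dir w w) (dir w z) (dir z z) (dir z d) (dir d d)
  (ip w w) (ip w z) (ip z z) (ip z d) (ip d d) (ip (nl w) w) (ip (nl z) w) (ip (nl z) z)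
  (ip (nl z) d) b1 b2 b3 b4 b5 e1 e2 e3 e4 e5 e6
  => S n1 n2 dww dwz dzz dzd ddd pww pwz pzz pzd pdd bww bzw bzz bzd
  b1 b2 b3 b4 b5 e1 e2 e3 e4 e5 e6 C0.
have f1 : a / 2 * (dww - dzz) <= a / 2 * r ^+ 2 + a * (S * r).
  have -> : dww - dzz = ddd + 2 * dzd by lra.
  have := ler_norm dzd => H; have := ler_wpM2l (ltW a0) (le_trans H b1).
  have := ler_wpM2l (ltW a0) b4; lra.
have f2 : - (c / (s + 2) * (bww - bzz)) <= c * (n1 * r).
  apply: (@le_trans _ _ (c * `|bzd|)); last by rewrite ler_pM2l.
  rewrite -mulrA -mulrN ler_pM2l// mulrC -mulNr ler_pdivrMr ?addr_gt0//.
  apply: (@le_trans _ _ (- bzd * (s + 2))); first by rewrite e6; lra.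
  by rewrite ler_wpM2r ?addr_ge0 ?(ltW s0)// -normrN ler_norm.
have f3 : - (k / 2 * (pww - pzz)) <= k * (n2 * r).
  have -> : pww - pzz = pdd + 2 * pzd by lra.
  have := ler_norm (- pzd); rewrite normrN => H; have := ler_wpM2l (ltW k0) (le_trans H b3).
  have := mulr_ge0 (ltW k0) b5; lra.
have : 0 <= (a * S + c * n1 + k * n2) * r ^+ 2 by rewrite mulr_ge0 ?sqr_ge0.
have : 0 <= a / 2 * r by rewrite mulr_ge0 ?divr_ge0 ?(ltW a0).
move: f1 f2 f3; rewrite !mulrBr !mulrDr !mulrDl; lra.
Qed.

End energy_identities.

(** * Energy decay and mass growth along a bounded trajectory *)

Section trajectory.
Context {R : realType} {N : nat}.
Local Notation E := 'rV[R]_N.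
Local Notation mu := (@lebesgue_rV R N).
Variable Om : set E.
Hypothesis oOm : open Om.
Variable s : R.
Hypothesis s0 : 0 < s.
Variables a c k m : R.
Hypotheses (a0 : 0 < a) (c0 : 0 < c) (k0 : 0 < k).

Let mOm : measurable Om. Proof. exact: open_measurable_rV. Qed.
Local Notation ip := (L2_ip Om).
Local Notation nrm := (nrm Om).
Local Notation sqH1 := (sqH1 Om).
Local Notation nl := (nl s).
Local Notation powint := (powint Om s).
Local Notation energy := (energy Om s a c k).
Local Notation force := (force Om s a c k).
Local Notation flow := (flow Om s a c k m).

Lemma H10B (v w : E -> R[i]) : H10 Om v -> H10 Om w -> H10 Om (fun x => v x - w x).
Proof.
move=> Hv Hw; have H1v := H10_H1 Hv; have H1w := H10_H1 Hw.
have H1vw := H1B oOm H1v H1w; split => // e e0.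
(* Half the tolerance is enough, as 2 (e/2)^2 + 2 (e/2)^2 = e^2 in [sqH1_parallelogram]. *)
have e2 : 0 < e / 2 by rewrite divr_gt0.
have [p tp vp] := H10_approx oOm Hv e2; have [q tq wq] := H10_approx oOm Hw e2.
have tpq := test_functionB tp tq.
exists (fun x => p x - q x) => //.
have Hvp := H1B oOm H1v (H1_test oOm tp); have Hwq := H1B oOm H1w (H1_test oOm tq).
have Hd := H1B oOm H1vw (H1_test oOm tpq).
have -> : ((fun x => v x - w x) \- (fun x => p x - q x))%R =
    (fun x => (v x - w x) - (p x - q x)) by [].
rewrite H1norm_lt//.
have := sqH1_parallelogram oOm Hvp Hd.
have -> : (fun x => v x - p x - (v x - w x - (p x - q x))) = (fun x => w x - q x).
  by apply/funext => x; ring.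
move: vp wq; rewrite expr_div_n; move: (sqH1 _) (sqH1 _) (sqH1 _) => A B C; lra.
Qed.

Lemma nrmZ_le (h : R) (v : E -> R[i]) : 0 <= h -> L2 Om v ->
  nrm (fun x => h%:C * v x) <= h * nrm v.
Proof.
move=> h0 Lv; apply: sqrt_le_sqr; first by rewrite mulr_ge0 ?nrm_ge0.
by rewrite (ip_scale mOm h%:C Lv) modulus_real exprMn sqr_nrm real_normK ?num_real.
Qed.

Lemma nl_nrm_le v (K : R) : L2 Om v -> (powint v <= K%:E)%E -> nrm (nl v) <= Num.sqrt K.
Proof. by move=> Lv vK; apply: ler_wsqrtr; exact: nl_ip_le. Qed.

Variables (u : R -> E -> R[i]) (K : R).
Hypothesis uH : forall t : R, 0 <= t -> H10 Om (u t).
Hypothesis uK : forall t : R, 0 <= t -> (powint (u t) <= K%:E)%E.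
(** Applied to a single fixed difference quotient; its power integral only has to be finite, with no
    uniformity in the step. *)
Hypothesis sobolev : forall w, H10 Om w -> exists K', (powint w <= K'%:E)%E.
Hypothesis ucont : forall t e : R, 0 <= t -> 0 < e -> exists2 d : R, 0 < d &
  forall r : R, 0 <= r -> `|r - t| < d -> sqH1 (fun x => u r x - u t x) <= e ^+ 2.
Hypothesis uH2 : forall t : R, 0 < t -> H2 Om (u t).

Definition dquot t h : E -> R[i] := fun x => (h^-1)%:C * (u (t + h) x - u t x).

Hypothesis uder : forall t e : R, 0 < t -> 0 < e -> exists2 d : R, 0 < d &
  forall h : R, h != 0 -> `|h| < d -> nrm (fun x => dquot t h x - flow (u t) x) <= e.

Let uL2 t : 0 <= t -> L2 Om (u t).
Proof. by move=> t0; exact: H1_L2 (H10_H1 (uH t0)). Qed.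

Let flow_L2 t : 0 < t -> L2 Om (flow (u t)).
Proof.
move=> t0; apply: L2D => //; apply: L2Z => //; last exact: uL2 (ltW t0).
exact: reaction_L2 (uH2 t0) (uK (ltW t0)).
Qed.

Lemma dquot_H10 (t h : R) : 0 <= t -> 0 <= t + h -> H10 Om (dquot t h).
Proof. by move=> t0 th0; apply: (H10Z oOm); apply: H10B; exact: uH. Qed.

Lemma dquotE (t h : R) x : h != 0 -> u t x - u (t - h) x = h%:C * dquot t (- h) x.
Proof.
move=> hN0; rewrite /dquot invrN mulrA -rmorphM /= mulrN divff// rmorphN /= rmorph1.
by rewrite mulN1r opprB.
Qed.

Lemma backward_quotient (t e : R) : 0 < t -> 0 < e -> exists d : R, 0 < d <= t /\
  forall h : R, 0 < h <= d -> [/\ L2 Om (dquot t (- h)),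
    nrm (fun x => dquot t (- h) x - flow (u t) x) <= e,
    nrm (dquot t (- h)) <= nrm (flow (u t)) + e &
    exists K', (powint (dquot t (- h)) <= K'%:E)%E].
Proof.
move=> t0 e0; have [d d0 Hd] := uder t0 e0.
(* Halving turns the strict condition |h| < d into a non-strict one; the bound by t keeps t - h
   nonnegative. *)
exists (Num.min (d / 2) t); split.
  by rewrite lt_min t0 divr_gt0//= ge_min lexx orbT.
move=> h /andP[h0]; rewrite le_min => /andP[hd ht].
have HD : H10 Om (dquot t (- h)) by apply: dquot_H10; lra.
have LD := H1_L2 (H10_H1 HD); have Lv := flow_L2 t0.
have Dv : nrm (fun x => dquot t (- h) x - flow (u t) x) <= e.
  by apply: Hd; [rewrite oppr_eq0 gt_eqF|rewrite normrN gtr0_norm//; lra].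
split => //; last exact: sobolev.
have -> : dquot t (- h) = fun x => flow (u t) x + (dquot t (- h) x - flow (u t) x).
  by apply/funext => x; rewrite addrC subrK.
by apply: le_trans (nrmD mOm Lv (L2B mOm LD Lv)) _; rewrite lerD2l.
Qed.

(* nl (u (t - h)) need not converge in L^2; it converges against a fixed difference
   quotient, which lies in L^(2 s + 2), and the quotients are L^2-close to each other. *)
Lemma energy_left_dini (t e : R) : 0 < t -> 0 < e ->
  exists2 h : R, 0 < h <= t & energy (u t) - energy (u (t - h)) <= e * h.
Proof.
move=> t0 e0; set z := u t; have t0' := ltW t0.
have H2z : H2 Om z := uH2 t0; have Hz : H10 Om z := uH t0'; have zK := uK t0'.
have Lz : L2 Om z := uL2 t0'; have Lf := force_L2 oOm s0 a c k H2z zK.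
have Lv : L2 Om (flow z) := flow_L2 t0; have Lnz := nl_L2 s0 Lz zK.
set M := nrm (force z); set V := nrm (flow z); set S := Num.sqrt K.
have M0 : 0 <= M by exact: nrm_ge0.
have V0 : 0 <= V by exact: nrm_ge0.
have S0 : 0 <= S by exact: sqrtr_ge0.
have P0 : 0 <= M + 4 * c * S by rewrite addr_ge0// !mulr_ge0 ?(ltW c0).
have P1 : 0 < M + 4 * c * S + 1 by rewrite ltr_wpDl.
(* First half of the error budget: [M] is the cost of replacing [D] by the flow in the force term,
   and 4 c S that of replacing [D] by the fixed quotient [w] in the nonlinear term. *)
pose eta := e / 2 / (M + 4 * c * S + 1).
have eta0 : 0 < eta by rewrite !divr_gt0.
have Peta : (M + 4 * c * S) * eta <= e / 2.
  rewrite /eta mulrCA ler_piMr ?divr_ge0 ?(ltW e0)// ler_pdivrMr// mul1r.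
  by rewrite lerDl.
have [d [/andP[d0 dt] Hd]] := backward_quotient t0 eta0.
have [] := Hd d; first by rewrite d0 lexx.
set w := dquot t (- d) => Lw wv _ [K' wK'].
pose C := (s + 1) * Num.sqrt (3 * (2 * K + 4 * K')).
have C0 : 0 <= C by rewrite mulr_ge0 ?sqrtr_ge0 ?addr_ge0 ?(ltW s0).
have V1 : 0 <= V + eta by rewrite addr_ge0// ltW.
(* Second half of the budget: [Q] collects the errors proportional to h. The constant [C] involves
   [K'], hence [w], which is why [w] is fixed before h. *)
pose Q := c * (C * (V + eta)) + k / 2 * (V + eta) ^+ 2.
have Q0 : 0 <= Q.
  apply: addr_ge0; first exact: mulr_ge0 (ltW c0) (mulr_ge0 C0 V1).
  exact: mulr_ge0 (divr_ge0 (ltW k0) (ler0n _ _)) (sqr_ge0 _).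
have Q1 : 0 < Q + 1 by rewrite ltr_wpDl.
pose h := Num.min d (e / 2 / (Q + 1)).
have h0 : 0 < h by rewrite lt_min d0 !divr_gt0.
have hd : h <= d by rewrite ge_min lexx.
have hQ : h * Q <= e / 2.
  apply: (@le_trans _ _ (e / 2 / (Q + 1) * Q)).
    by rewrite ler_wpM2r// ge_min lexx orbT.
  by rewrite mulrAC ler_pdivrMr// ler_pM2l ?divr_gt0// lerDl.
exists h; first by rewrite h0 (le_trans hd).
have [] := Hd h; first by rewrite h0 hd.
set D := dquot t (- h) => LD Dv DV _.
have th0 : 0 <= t - h by rewrite subr_ge0 (le_trans hd).
set z' := u (t - h); have Hz' : H10 Om z' := uH th0; have zK' := uK th0.
have Lz' : L2 Om z' := uL2 th0; have Lnz' := nl_L2 s0 Lz' zK'.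
have dE x : z x - z' x = h%:C * D x by apply: dquotE; rewrite gt_eqF.
have EB := energy_backward oOm s0 k a0 c0 H2z Hz Hz' zK zK' LD h0 dE.
apply: le_trans EB _.
rewrite mulrC ler_pM2r//.
have Ldn := L2B mOm Lnz Lnz'.
(* The pairing of force and flow is nonnegative, and [D] is within eta of the flow. *)
have b1 : - ip (force z) D <= M * eta.
  have Hf : 0 <= ip (force z) (flow z) := ip_force_flow oOm s0 a c k m H2z Hz zK.
  have := ipBr mOm LD Lv Lf => E1.
  have := le_trans (ip_CauchySchwarz mOm Lf (L2B mOm LD Lv)) (ler_wpM2l M0 Dv).
  rewrite E1 ler_norml => /andP[H _].
  move: Hf H; move: (ip _ _) (ip _ _) (M * eta) => x y p.
  by clear -m mOm oOm s0 a0 c0 k0 sobolev ucont uder uL2 flow_L2; lra.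
(* Write D = w + (D - w). Against [w] the weak Lipschitz bound applies, with |z - z'| = O(h);
   against D - w, of norm at most 2 eta, the crude bound 2S on the nonlinear difference is
   enough. *)
have b2 : ip (fun x => nl z x - nl z' x) D <= 4 * S * eta + h * (C * (V + eta)).
  have n1 : nrm (fun x => nl z x - nl z' x) <= 2 * S.
    apply: le_trans (nrmB mOm Lnz Lnz') _.
    have := nl_nrm_le Lz zK; have := nl_nrm_le Lz' zK'; rewrite -/S.
    move: (nrm _) (nrm _) => x y.
    by clear -m mOm oOm s0 a0 c0 k0 sobolev ucont uder uL2 flow_L2; lra.
  have n2 : nrm (fun x => D x - w x) <= 2 * eta.
    have -> : (fun x => D x - w x) = (fun x => (D x - flow z x) - (w x - flow z x)).
      by apply/funext => x; ring.
    apply: le_trans (nrmB mOm (L2B mOm LD Lv) (L2B mOm Lw Lv)) _.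
    move: Dv wv; move: (nrm _) (nrm _) => x y.
    by clear -m mOm oOm s0 a0 c0 k0 sobolev ucont uder uL2 flow_L2; lra.
  have n3 : nrm (fun x => z x - z' x) <= h * (V + eta).
    have -> : (fun x => z x - z' x) = (fun x => h%:C * D x) by apply/funext.
    by apply: le_trans (nrmZ_le (ltW h0) LD) _; rewrite ler_wpM2l// ltW.
  have n4 := nl_weak_lipschitz oOm s0 Lz Lz' Lw zK zK' wK'.
  rewrite -/C in n4; have := le_trans n4 (ler_wpM2l C0 n3) => n5.
  have E1 := ipBr mOm LD Lw Ldn.
  have n6 := ip_CauchySchwarz mOm Ldn (L2B mOm LD Lw).
  have n7 := ler_pM (nrm_ge0 _ _) (nrm_ge0 _ _) n1 n2.
  have := le_trans (ler_norm _) (le_trans n6 n7); rewrite E1.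
  have := le_trans (ler_norm _) n5.
  move: (ip _ w) (ip _ D) => x y; rewrite mulrCA => G1 G2.
  by clear -G1 G2 m mOm oOm s0 a0 c0 k0 sobolev ucont uder uL2 flow_L2; lra.
have b3 : ip D D <= (V + eta) ^+ 2.
  by rewrite -sqr_nrm lerXn2r ?nnegrE ?nrm_ge0.
have := ler_wpM2l (ltW c0) b2.
have := ler_wpM2l (mulr_ge0 (divr_ge0 (ltW k0) (ltW (ltr0n _ 2))) (ltW h0)) b3.
move: hQ Peta b1; rewrite /Q.
move: (ip _ _) (ip _ _) (ip _ _) => x y p.
by clear -m mOm oOm s0 a0 c0 k0 sobolev ucont uder uL2 flow_L2; lra.
Qed.

Lemma small_quadratic (C e : R) : 0 <= C -> 0 < e ->
  exists2 r : R, 0 < r & C * (r ^+ 2 + r) <= e.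
Proof.
move=> C0 e0; have C1 : 0 < 2 * C + 1 by rewrite ltr_wpDl ?mulr_ge0.
pose r := Num.min 1 (e / (2 * C + 1)).
have r0 : 0 < r by rewrite lt_min ltr01 divr_gt0.
have r1 : r <= 1 by rewrite ge_min lexx.
exists r => //; apply: (@le_trans _ _ (C * (r + r))).
  by rewrite ler_wpM2l// lerD2r expr2 ler_piMr// ltW.
have : r * (2 * C + 1) <= e by rewrite -ler_pdivlMr// ge_min lexx orbT.
have := ltW r0; lra.
Qed.

Lemma energy_le (t : R) : 0 <= t -> energy (u t) <= energy (u 0).
Proof.
move=> t0; apply: (@le_of_left_dini R (fun t => energy (u t))) => // [r e r0 e0|r e r0 e0].
  have [C C0 HC] := energy_usc oOm s0 a0 c0 k0 (uH r0) (uK r0).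
  have [q q0 Cq] := small_quadratic C0 e0.
  have [d d0 Hd] := ucont r0 q0.
  exists d => // p /andP[rp pd]; have p0 := le_trans r0 rp.
  apply: (@le_trans _ _ (energy (u r) + C * (q ^+ 2 + q))); last by rewrite lerD2l.
  apply: HC; [exact: uH|exact: uK|exact: ltW|].
  by apply: Hd => //; rewrite ger0_norm ?subr_ge0// ltrBlDl.
exact: energy_left_dini.
Qed.

(** Energy decay keeps -4 E(u(t)) above kap = -4 E(u(0)), and [ip_flow] gives a mass growth rate of
    at least -4 E(u(t)). So kap t - |u(t)|^2 has a nonpositive left derivative, and the same
    comparison lemma applies. *)
Lemma mass_growth (t : R) : 0 <= t -> - 4 * energy (u 0) * t <= ip (u t) (u t).
Proof.
move=> t0; set kap := - 4 * energy (u 0).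
suff : kap * t - ip (u t) (u t) <= kap * 0 - ip (u 0) (u 0).
  by have := ip_ge0 Om (u 0); move: (ip (u 0) _) (ip (u t) _) => x y; lra.
apply: (@le_of_left_dini R (fun t => kap * t - ip (u t) (u t))) => // [r e r0 e0|r e r0 e0].
  set z := u r; have Lz : L2 Om z := uL2 r0.
  have C0 : 0 <= `|kap| + 2 * nrm z by rewrite addr_ge0 ?mulr_ge0 ?nrm_ge0.
  have [q q0 Cq] := small_quadratic C0 e0.
  have [d d0 Hd] := ucont r0 q0.
  exists (Num.min d q); first by rewrite lt_min d0.
  move=> p /andP[rp]; rewrite -ltrBlDl lt_min => /andP[pd pq]; have p0 := le_trans r0 rp.
  have Lp : L2 Om (u p) := uL2 p0.
  have := Hd p p0; rewrite ger0_norm ?subr_ge0// => /(_ pd) hq.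
  have nq : nrm (fun x => u p x - z x) <= q.
    by apply: sqrt_le_sqr; [exact: ltW|apply: le_trans hq; exact: ip_le_sqH1].
  have := ip_sqrB oOm Lp Lz => E1; have := ip_ge0 Om (fun x => u p x - z x).
  have := ipBr mOm Lp Lz Lz; rewrite (ipC Om z (u p)) => E2.
  have := le_trans (ip_CauchySchwarz mOm Lz (L2B mOm Lp Lz)) (ler_wpM2l (nrm_ge0 _ _) nq).
  rewrite E1 E2 ler_norml => /andP[H _].
  have G : kap * (p - r) <= `|kap| * q.
    apply: (@le_trans _ _ (`|kap| * (p - r))).
      by rewrite ler_wpM2r ?subr_ge0// ler_norm.
    by rewrite ler_wpM2l// ltW.
  have G2 : (`|kap| + 2 * nrm z) * q <= e.
    by apply: le_trans Cq; rewrite ler_wpM2l// lerDr sqr_ge0.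
  move: (ip (u p) (u p)) (ip (u p) z) (ip z z) (nrm z) H G2 => x y w n H G2; lra.
set z := u r; have r0' := ltW r0.
have H2z : H2 Om z := uH2 r0; have Hz : H10 Om z := uH r0'; have zK := uK r0'.
have Lz : L2 Om z := uL2 r0'; have Lv : L2 Om (flow z) := flow_L2 r0.
have n0 := nrm_ge0 Om z; have V0 := nrm_ge0 Om (flow z).
(* The error is split again: eta pays for replacing the quotient by the flow, h for the quadratic
   remainder h |D|^2. *)
pose eta := e / 2 / (2 * nrm z + 1).
have n1 : 0 < 2 * nrm z + 1 by rewrite ltr_wpDl ?mulr_ge0.
have eta0 : 0 < eta by rewrite !divr_gt0.
have Peta : 2 * nrm z * eta <= e / 2.
  rewrite /eta mulrCA ler_piMr ?divr_ge0 ?(ltW e0)// ler_pdivrMr// mul1r.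
  by rewrite lerDl.
set V := nrm (flow z) in V0 *.
have [d [/andP[d0 dt] Hd]] := backward_quotient r0 eta0.
pose Q := (V + eta) ^+ 2; have Q0 : 0 <= Q by exact: sqr_ge0.
have Q1 : 0 < Q + 1 by rewrite ltr_wpDl.
pose h := Num.min d (e / 2 / (Q + 1)).
have h0 : 0 < h by rewrite lt_min d0 !divr_gt0.
have hd : h <= d by rewrite ge_min lexx.
have hQ : h * Q <= e / 2.
  apply: (@le_trans _ _ (e / 2 / (Q + 1) * Q)).
    by rewrite ler_wpM2r// ge_min lexx orbT.
  by rewrite mulrAC ler_pdivrMr// ler_pM2l ?divr_gt0// lerDl.
exists h; first by rewrite h0 (le_trans hd).
have [] := Hd h; first by rewrite h0 hd.
set D := dquot r (- h) => LD Dv DV _.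
have th0 : 0 <= r - h by rewrite subr_ge0 (le_trans hd).
set z' := u (r - h); have Lz' : L2 Om z' := uL2 th0.
have dE x : z x - z' x = h%:C * D x by apply: dquotE; rewrite gt_eqF.
have dF : (fun x => z x - z' x) = fun x => h%:C * D x by apply/funext.
have E1 := ip_sqrB oOm Lz Lz'; have E2 := ipBr mOm Lz Lz' Lz.
rewrite dF (ipZr mOm h LD (L2Z mOm h%:C LD)) (ipZl mOm h LD LD) in E1.
rewrite dF (ipZr mOm h LD Lz) in E2.
have DD : ip D D <= Q by rewrite -sqr_nrm lerXn2r ?nnegrE ?nrm_ge0// addr_ge0// ltW.
have E3 := ipBr mOm LD Lv Lz.
have := le_trans (ip_CauchySchwarz mOm Lz (L2B mOm LD Lv)) (ler_wpM2l n0 Dv).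
rewrite E3 ler_norml => /andP[H _].
have F1 := ip_flow oOm s0 a k m c0 H2z Hz zK.
have F2 : kap <= - 4 * energy z.
  by rewrite /kap; have := energy_le r0'; rewrite -/z; lra.
(* This is the increment of kap t - |u|^2 over the step, because |z|^2 - |z'|^2 = 2h <z, D> - h^2
   |D|^2. *)
have G1 : h * (kap - 2 * ip z D + h * ip D D) <= h * e.
  rewrite ler_pM2l//; have := ler_wpM2l (ltW h0) DD.
  move: F1 F2 H Peta hQ; move: (energy z) (ip z D) (ip z (flow z)) (ip D D) (nrm z) => x y w p n.
  by clear -m mOm oOm s0 a0 c0 k0 sobolev ucont uder uL2 flow_L2; lra.
rewrite [e * h]mulrC; apply: le_trans G1.
have -> : h * (kap - 2 * ip z D + h * ip D D) = h * kap - 2 * (h * ip z D) + h * (h * ip D D).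
  by ring.
rewrite E1 E2; move: (ip z z) (ip z z') (ip z' z') => x y w.
by clear -m mOm oOm s0 a0 c0 k0 sobolev ucont uder uL2 flow_L2; lra.
Qed.

End trajectory.

(** * Invariance under almost everywhere equality *)

Section ae_invariance.
Context {R : realType} {N : nat}.
Local Notation E := 'rV[R]_N.
Local Notation mu := (@lebesgue_rV R N).
Local Notation Re := complex.Re.
Local Notation Im := complex.Im.
Variable Om : set E.
Hypothesis oOm : open Om.
Implicit Types (u v g : E -> R[i]).

Let mOm : measurable Om. Proof. exact: open_measurable_rV. Qed.

Lemma ip_ae u v : L2 Om u -> L2 Om v -> eq_ae Om u v -> L2_ip Om u u = L2_ip Om v v.
Proof.
by move=> Lu Lv uv; rewrite (ip_ael oOm Lu Lv Lu uv) (ip_aer oOm Lu Lv Lv uv).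
Qed.

Lemma is_weak_partial_ae i u v g : L2 Om u -> L2 Om v -> eq_ae Om u v ->
  is_weak_partial Om i v g -> is_weak_partial Om i u g.
Proof.
move=> Lu Lv uv /is_weak_partialP[Lg H]; apply/is_weak_partialP; split => // f tf.
have [mf _] := real_L2_test (real_test_function_partial i tf).
have [H1 H2] := H f tf; have [ur ui _] := Lu; have [vr vi _] := Lv.
split.
  rewrite -H1; apply: (rip_ae oOm ur vr mf).
  by apply: filterS uv => x uv Omx; rewrite uv.
rewrite -H2; apply: (rip_ae oOm ui vi mf).
by apply: filterS uv => x uv Omx; rewrite uv.
Qed.

Lemma dir_ae u v : H1 Om u -> H1 Om v -> eq_ae Om u v ->
  dirichlet_form Om u u = dirichlet_form Om v v.
Proof.
move=> Hu Hv uv; apply: eq_bigr => i _.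
apply: ip_ae; [exact: weak_partial_L2|exact: weak_partial_L2|].
apply: (is_weak_partial_unique oOm (weak_partialP i Hu)).
exact: is_weak_partial_ae (H1_L2 Hu) (H1_L2 Hv) uv (weak_partialP i Hv).
Qed.

Lemma ip_eq0 u : L2 Om u -> L2_ip Om u u = 0 -> eq_ae Om u (fun=> 0).
Proof.
move=> Lu u0; have := sqnorm2E mOm Lu; rewrite u0 /sqnorm2 => H.
have mm : measurable_fun Om (fun x => (modulus (u x) ^+ 2)%:E).
  by apply/measurable_EFinP; apply: measurable_funX; exact: measurable_modulus.
have : (\int[mu]_(x in Om) `|(modulus (u x) ^+ 2)%:E| = 0)%E.
  apply: etrans H; apply: eq_integral => x _; rewrite gee0_abs// lee_fin.
  exact: sqr_ge0.
move=> /(ae_eq_integral_abs mu mOm mm); apply: filterS => x K Omx.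
have := K Omx => -[] /eqP; rewrite expf_eq0 /= => /eqP; exact: Normc.eq0_normc.
Qed.

End ae_invariance.

Section dirichlet_eigenfunction.
Context {R : realType} {N : nat}.
Local Notation E := 'rV[R]_N.
Variable Om : set E.
Hypothesis oOm : open Om.
Variables (lam : nat -> R) (n : nat).

Let mOm : measurable Om. Proof. exact: open_measurable_rV. Qed.

Lemma dirichlet_eigenfunction : dirichlet_eigenvalues Om lam -> (1 <= n)%N ->
  exists phi, [/\ H10 Om phi, 0 < L2_ip Om phi phi &
    dirichlet_form Om phi phi = lam n * L2_ip Om phi phi].
Proof.
move=> [_ [phi [eig free _]]] n1; have [H2p H0p pE] := eig n n1.
have Lp := H1_L2 (H10_H1 H0p).
exists (phi n); split => //.
- rewrite lt_def ip_ge0 andbT; apply/eqP => /(ip_eq0 oOm Lp) p0.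
  (* A null eigenfunction would contradict linear independence, with coefficient 1 at index [n] and
     0 elsewhere. *)
  have /(free n) : eq_ae Om (fun x => \sum_(1 <= j < n.+1)
      (fun j => if j == n then 1 else 0) j * phi j x) (fun=> 0).
    apply: filterS p0 => x p0 Omx; rewrite big_nat_recr//= eqxx mul1r p0//.
    rewrite addr0 big_nat big1// => j /andP[_ jn].
    by rewrite ltn_eqF// mul0r.
  by move=> /(_ n); rewrite n1 leqnn eqxx => /(_ isT)/eqP; rewrite oner_eq0.
- have LD := weak_laplacian_L2 oOm H2p.
  have := green oOm H2p H0p.
  have LpE : eq_ae Om (weak_laplacian Om (phi n)) (fun x => (- lam n)%:C * phi n x).
    by apply: filterS pE => x pE Omx; rewrite rmorphN /= mulNr -pE// opprK.
  rewrite (ip_ael oOm LD (L2Z mOm _ Lp) Lp LpE) (ipZl mOm _ Lp Lp) mulNr.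
  by move=> /oppr_inj.
Qed.

End dirichlet_eigenfunction.

Section solution_bounds.
Context {R : realType} {N : nat}.
Local Notation E := 'rV[R]_N.
Variable Om : set E.
Hypothesis oOm : open Om.

Let mOm : measurable Om. Proof. exact: open_measurable_rV. Qed.

(** The ratio condition makes both complex coefficients real multiples of the same number 1 + im,
    with m = α/a; the second multiple is b = -c. *)
Lemma gl_rhsE (a alpha b beta k sigma : R) u : a != 0 -> b != 0 ->
  alpha / a = beta / b ->
  gl_rhs Om a alpha b beta k sigma u = flow Om sigma a (- b) k (alpha / a) u.
Proof.
move=> a0 b0 ab; apply/funext => x; rewrite /gl_rhs /flow /reaction /nl /cpow.
have -> : a +i* alpha = (1 +i* (alpha / a)) * a%:C.
  by apply: complex_eqP; rewrite ?ReM ?ImM /=; field.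
have -> : b +i* beta = - ((1 +i* (alpha / a)) * (- b)%:C).
  by rewrite ab; apply: complex_eqP; rewrite ?ReN ?ImN ?ReM ?ImM /=; field.
by ring.
Qed.

Lemma strong_solution_cont (a alpha b beta k sigma : R) u0 (u : R -> E -> R[i]) (t e : R) :
  strong_solution Om a alpha b beta k sigma u0 +oo u -> 0 <= t -> 0 < e ->
  exists2 d : R, 0 < d & forall r : R, 0 <= r -> `|r - t| < d ->
    sqH1 Om (fun x => u r x - u t x) <= e ^+ 2.
Proof.
move=> [_ _ uH ucont _] t0 e0.
have tm (r : R) : 0 <= r -> times +oo%E r by move=> r0; split => //; exact: ltry.
have oe : nbhs (0 : \bar R)%E [set y : \bar R | (y < e%:E)%E].
  by apply: open_nbhs_nbhs; split; [exact: open_ereal_lt_ereal|rewrite /= lte_fin].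
have := ucont t (tm t t0) _ oe; rewrite /nbhs /= /within /=.
move=> /nbhs_ballP[d /= d0 Hd]; exists d => // r r0 rd.
have := Hd r; rewrite /ball /= distrC => /(_ rd (tm r r0)) H.
have Hrt := H1B oOm (H10_H1 (uH r (tm r r0))) (H10_H1 (uH t (tm t t0))).
by apply: ltW; rewrite -(H1norm_lt oOm Hrt e0).
Qed.

Lemma strong_solution_deriv (a alpha b beta k sigma K : R) u0 (u : R -> E -> R[i]) (t e : R) :
  a != 0 -> b != 0 -> alpha / a = beta / b -> 0 < sigma ->
  strong_solution Om a alpha b beta k sigma u0 +oo u -> 0 < t -> 0 < e ->
  (powint Om sigma (u t) <= K%:E)%E ->
  exists2 d : R, 0 < d & forall h : R, h != 0 -> `|h| < d ->
    nrm Om (fun x => dquot u t h x - flow Om sigma a (- b) k (alpha / a) (u t) x) <= e.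
Proof.
move=> a0 b0 ab s0 [_ _ uH _ uder] t0 e0 uK.
have tm (r : R) : 0 <= r -> times +oo%E r by move=> r0; split => //; exact: ltry.
have uL (r : R) : 0 <= r -> L2 Om (u r) by move=> /tm/uH/H10_H1/H1_L2.
have [H2u [v [Lv vder] vE]] := uder t (tm t (ltW t0)) t0.
rewrite gl_rhsE// in vE.
have oe : nbhs (0 : \bar R)%E [set y : \bar R | (y < e%:E)%E].
  by apply: open_nbhs_nbhs; split; [exact: open_ereal_lt_ereal|rewrite /= lte_fin].
have := vder _ oe; rewrite /nbhs /= /dnbhs /within /=.
(* Bounding |h| by t keeps t + h in the time interval, where the solution is known to lie in L^2. *)
move=> /nbhs_ballP[d /= d0 Hd]; exists (Num.min d t); first by rewrite lt_min d0.
move=> h h0; rewrite lt_min => /andP[hd ht].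
have th : 0 <= t + h by have := ler_norm (- h); rewrite normrN; lra.
have Lq : L2 Om (dquot u t h).
  by apply: L2Z => //; apply: L2B => //; apply: uL => //; exact: ltW.
have Lf : L2 Om (flow Om sigma a (- b) k (alpha / a) (u t)).
  apply: L2D => //; apply: L2Z => //; last exact: uL (ltW t0).
  exact: reaction_L2 uK.
have := Hd h; rewrite /ball /= sub0r normrN => /(_ hd h0).
rewrite -/(dquot u t h) => H.
have -> : nrm Om (fun x => dquot u t h x - flow Om sigma a (- b) k (alpha / a) (u t) x) =
    nrm Om (fun x => dquot u t h x - v x).
  congr Num.sqrt; apply: (ip_ae oOm); [exact: L2B|exact: L2B|].
  by apply: filterS vE => x vE Omx; rewrite vE.
rewrite -lee_fin -(L2normE mOm (L2B mOm Lq Lv)).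
exact: ltW.
Qed.

End solution_bounds.

Local Close Scope complex_scope.
Local Close Scope classical_set_scope.

Theorem theorem1p5 (R : realType) (N : nat) (Omega : set 'rV[R]_N)
    (lambda : nat -> R) (a alpha b beta k sigma : R) (n : nat)
    (hN : (1 <= N)%N)
    (hOmega : bounded_C2_domain Omega)
    (hlambda : dirichlet_eigenvalues Omega lambda)
    (hsigma : 0 < sigma)
    (hsigmaN : (2 < N)%N -> sigma <= 2 / (N%:R - 2))
    (ha : 0 < a) (hb : b < 0)
    (hratio : alpha / a = beta / b)
    (hk : 0 < k)
    (hn : (1 <= n)%N)
    (hka : lambda n < k / a < lambda n.+1) :
  zero_unstable Omega a alpha b beta k sigma.
Proof.
have [_ oOm _ _ _] := hOmega.
have mOm : measurable Omega by exact: open_measurable_rV.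
have [phi [Hphi phi0 phiE]] := dirichlet_eigenfunction oOm hlambda hn.
have H1phi := H10_H1 Hphi; have Lphi := H1_L2 H1phi.
have c0 : 0 < - b by rewrite oppr_gt0.
have aN0 : a != 0 by rewrite gt_eqF.
have bN0 : b != 0 by rewrite lt_eqF.
(* Any δ would do: growth is linear and unbounded. With δ = 1 the contradiction occurs at time
   1/kap. *)
move=> /(_ 1 ltr01)[eps eps0 stable].
have p1 : 0 < 1 + sqH1 Omega phi by rewrite ltr_pwDl// sqH1_ge0.
(* With x the squared H^1 norm of phi, the smallness of r phi amounts to x < (1 + x)^2, which spares
   a square root. *)
pose r := eps / (1 + sqH1 Omega phi); have r0 : 0 < r by rewrite divr_gt0.
pose v x := (r%:C)%C * phi x.
have Hv : H10 Omega v by exact: H10Z.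
have v_small : (H1norm Omega v < eps%:E)%E.
  rewrite (H1norm_lt oOm (H10_H1 Hv) eps0) (sqH1Z oOm _ H1phi) modulus_real.
  rewrite real_normK ?num_real// /r expr_div_n mulrAC ltr_pdivrMr ?exprn_gt0//.
  rewrite ltr_pM2l ?exprn_gt0//; have := sqH1_ge0 Omega phi.
  by move: (sqH1 _ _) => x x0; have := sqr_ge0 x; rewrite sqrrD; lra.
have [T [u [max_sol T_infty small]]] := stable v Hv v_small.
rewrite T_infty in max_sol; have [sol _] := max_sol.
have [_ u0v uH _ uder] := sol.
have tm (t : R) : 0 <= t -> times +oo%E t by move=> t0; split => //; exact: ltry.
have {}uH (t : R) : 0 <= t -> H10 Omega (u t) by move=> /tm; exact: uH.
have uh1 (t : R) : 0 <= t -> sqH1 Omega (u t) < 1.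
  move=> t0; have := H1norm_lt oOm (H10_H1 (uH t t0)) ltr01.
  rewrite expr1n => <-; apply: le_lt_trans small; apply: ereal_sup_ubound.
  by exists t.
have [K K0 HK] := sobolev_H10 oOm hN hsigma hsigmaN ler01.
have uK (t : R) : 0 <= t -> (powint Omega sigma (u t) <= K%:E)%E.
  by move=> t0; apply: HK; [exact: uH|exact: ltW (uh1 t t0)].
have sob w : H10 Omega w -> exists K', (powint Omega sigma w <= K'%:E)%E.
  move=> Hw; have [K' _ HK'] := sobolev_H10 oOm hN hsigma hsigmaN (sqH1_ge0 Omega w).
  by exists K'; exact: HK'.
have growth := mass_growth oOm hsigma ha c0 hk uH uK sob
  (fun t e t0 e0 => strong_solution_cont oOm sol t0 e0)
  (fun t t0 => (uder t (tm t (ltW t0)) t0).1)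
  (fun t e t0 e0 => strong_solution_deriv oOm aN0 bN0 hratio hsigma sol t0 e0
     (uK t (ltW t0))).
have Hu0 := uH 0 (lexx 0); have Lu0 := H1_L2 (H10_H1 Hu0).
(* [u 0] agrees with r phi almost everywhere only, so the quadratic terms are transferred by
   invariance. The power term enters through its sign, which leaves the bound r^2 |phi|^2 (a λ_n -
   k) / 2 < 0. *)
have E0 : energy Omega sigma a (- b) k (u 0) < 0.
  rewrite /energy (dir_ae oOm (H10_H1 Hu0) (H10_H1 Hv) u0v).
  rewrite (ip_ae oOm Lu0 (H1_L2 (H10_H1 Hv)) u0v).
  rewrite (dirZ oOm _ H1phi) (ip_scale mOm _ Lphi) phiE modulus_real real_normK ?num_real//.
  have nl0 : 0 <= - b / (sigma + 2) * L2_ip Omega (nl sigma (u 0)) (u 0).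
    by rewrite mulr_ge0 ?ip_nl_ge0// divr_ge0 ?addr_ge0 ?(ltW c0) ?(ltW hsigma).
  have lk : a * lambda n < k.
    by case/andP: hka => lk _; rewrite mulrC -ltr_pdivlMr.
  have rp : 0 < r ^+ 2 * L2_ip Omega phi phi by rewrite mulr_gt0 ?exprn_gt0.
  have := mulr_gt0 rp; rewrite -subr_gt0 in lk => /(_ _ lk).
  move: nl0; move: (_ * L2_ip Omega (nl _ _) _) (L2_ip Omega phi phi) => x y; lra.
have kap0 : 0 < - 4 * energy Omega sigma a (- b) k (u 0) by lra.
move: kap0 growth; move: (- 4 * _) => kap kap0 growth.
have t0 : 0 <= kap^-1 by rewrite invr_ge0 ltW.
have := growth _ t0; rewrite divff ?gt_eqF//; apply/negP; rewrite -ltNge.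
exact: le_lt_trans (ip_le_sqH1 _ _) (uh1 _ t0).
Qed.
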